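(* Let $1\le p\le+\infty$. Assume that $B\in\mathcal L(U,\partial X)$ is $p$-boundary admissible and that $e^+\mathcal R^{\mathrm{BC}}_t\subset X^+$ for all $t>0$. Then the following holds. (i) $a^+\mathcal R^{\mathrm{BC}}$ is a closed convex cone, invariant under $(T(t))_{t\ge0}$ and under $R(\lambda,A)$ for $\lambda>\omega_0(A)$. (ii) For all $\lambda>\omega_0(A)$, $$a^+\mathcal R^{\mathrm{BC}}=\overline{\operatorname{co}}\bigl\{\bigl(e^{\lambda\beta}T(t-\beta)-e^{\lambda\alpha}T(t-\alpha)\bigr)B_\lambda v:\ t\ge0,\ 0\le\alpha\le\beta\le t,\ v\in U^+\bigr\}.$$ (iii) For all $w>\omega_0(A)$, $$a^+\mathcal R^{\mathrm{BC}}=\overline{\operatorname{co}}\{T(t)B_\lambda v:\ t\ge0,\ \lambda>w,\ v\in U^+\}.$$ (iv) For some, and in fact for all, $w>\omega_0(A)$, $$a^+\mathcal R^{\mathrm{BC}}=\overline{\operatorname{co}}\{R(\lambda,A)^nB_\lambda v:\ n\in\{0,1,2,\dots\},\ \lambda>w,\ v\in U^+\}.$$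
   Context: Abstract setting. $X$, $\partial X$, $U$ are Banach spaces, and in addition $X$ and $U$ are Banach lattices with positive cones $X^+$, $U^+$; no positivity is assumed on $T(t)$, $B$ or $Q_\lambda$. $A_m:D(A_m)\subseteq X\to X$ is a closed, densely defined operator; $Q\in\mathcal L([D(A_m)],\partial X)$, where $[D(A_m)]$ is $D(A_m)$ with the graph norm; $B\in\mathcal L(U,\partial X)$. Standing assumptions: (i) the restriction $A\subset A_m$ with domain $D(A):=\ker Q$ generates a strongly continuous semigroup $(T(t))_{t\ge0}$ on $X$; (ii) $Q:D(A_m)\to\partial X$ is surjective. $\omega_0(A)$ is the growth bound of $(T(t))_{t\ge0}$ and $R(\lambda,A)=(\lambda-A)^{-1}$. For $\lambda\in\rho(A)$ the restriction $Q|_{\ker(\lambda-A_m)}$ is invertible with bounded inverse $Q_\lambda:\partial X\to\ker(\lambda-A_m)\subseteq X$, and $B_\lambda:=Q_\lambda B\in\mathcal L(U,X)$. $B$ is called $p$-boundary admissible if there exist $t>0$ and $\lambda\in\rho(A)$ such that $\int_0^tT(t-s)B_\lambda u(s)\,ds\in D(A)$ for all $u\in L^p([0,t],U)$; the same then holds for every $t>0$ and $\lambda\in\rho(A)$. In this case, for $t>0$ the controllability map $\mathcal B_t^{\mathrm{BC}}\in\mathcal L(L^p([0,t],U),X)$ is $\mathcal B_t^{\mathrm{BC}}u:=(\lambda-A)\int_0^tT(t-s)B_\lambda u(s)\,ds$, which does not depend on $\lambda\in\rho(A)$ (and $\mathcal B_0^{\mathrm{BC}}=0$). Positive reachability spaces: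 $e^+\mathcal R^{\mathrm{BC}}_t:=\{\mathcal B_t^{\mathrm{BC}}u:u\in L^p([0,t],U^+)\}$, $a^+\mathcal R^{\mathrm{BC}}_t:=\overline{e^+\mathcal R^{\mathrm{BC}}_t}$, $a^+\mathcal R^{\mathrm{BC}}:=\overline{\bigcup_{t\ge0}a^+\mathcal R^{\mathrm{BC}}_t}$. $\overline{\operatorname{co}}\,S$ denotes the closed convex hull of $S\subset X$. *)

(* Defs.v *)
From HB Require Import structures.
From mathcomp Require Import all_boot all_order all_algebra.
From mathcomp Require Import all_classical all_reals all_analysis.

Set Implicit Arguments.
Unset Strict Implicit.
Unset Printing Implicit Defensive.

Import Order.TTheory GRing.Theory Num.Theory.
Import numFieldNormedType.Exports.

Local Open Scope classical_set_scope.
Local Open Scope ring_scope.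

(* Real Banach lattices. The order is a field of the mixin because the
   Order.Lattice and NormedModule hierarchies have no common extension other
   than the (totally ordered) number types, and adding one is rejected by
   Hierarchy Builder. Meets are given by - vjoin (- x) (- y), and vjoin x (- x)
   is the modulus of x. *)
HB.mixin Record isBanachLattice (R : realType) X of CompleteNormedModule R X := {
  vle : rel X ;
  vle_refl : reflexive vle ;
  vle_anti : antisymmetric vle ;
  vle_trans : transitive vle ;
  vjoin : X -> X -> X ;
  vjoinP : forall x y z : X, vle (vjoin x y) z = vle x z && vle y z ;
  vleD2r : forall z x y : X, vle x y -> vle (x + z) (y + z) ;
  vscale_ge0 : forall (a : R) (x : X), 0 <= a -> vle 0 x -> vle 0 (a *: x) ;
  vnorm_le : forall x y : X,
    vle (vjoin x (- x)) (vjoin y (- y)) -> `|x| <= `|y|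
}.

#[short(type="banachLatticeType")]
HB.structure Definition BanachLattice (R : realType) :=
  { X of CompleteNormedModule R X & isBanachLattice R X }.

Definition positive_cone (R : realType) (X : banachLatticeType R) : set X :=
  [set x | vle 0 x].

Section Bochner.
Context {R : realType} {X : completeNormedModType R}.
Implicit Types (t : R) (f s : R -> X).

Local Notation mu := (@lebesgue_measure R).

Definition simple_function s : Prop :=
  finite_set (range s) /\ forall x, measurable (s @^-1` [set x]).

(* Everywhere (rather than almost everywhere) limits of Borel simple functions:
   every almost everywhere class of Bochner measurable functions contains such a
   representative. *)
Definition strongly_measurable t f : Prop :=
  exists2 s_ : nat -> R -> X, (forall n, simple_function (s_ n)) &
    forall r, 0 <= r <= t -> s_ n r @[n --> \oo] --> f r.

Definition simple_integral t s : X :=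
  \sum_(x \in [set: X]) fine (mu (`[0, t] `&` s @^-1` [set x])) *: x.

Definition is_bochner_integral t f (y : X) : Prop :=
  strongly_measurable t f /\
  exists s_ : nat -> R -> X,
    [/\ forall n, simple_function (s_ n),
        (\int[mu]_(r in `[0%R, t]) `|f r - s_ n r|%:E)%E @[n --> \oo]
          --> 0%:E
      & simple_integral t (s_ n) @[n --> \oo] --> y].

Definition bochner_integral t f : X := xget 0 (is_bochner_integral t f).

(* Representatives, defined on the whole line, of the elements of
   L^p([0, t], X); their values outside [0, t] are irrelevant. *)
Definition Lp (p : \bar R) t : set (R -> X) :=
  [set u | strongly_measurable t u /\
    (Lnorm mu p ((fun r => `|u r|%:E) \_ `[0%R, t]) < +oo)%E].

End Bochner.

Definition Lp_pos (R : realType) (U : banachLatticeType R) (p : \bar R) (t : R)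
    : set (R -> U) :=
  [set u | Lp p t u /\
    {ae @lebesgue_measure R, forall r, 0 <= r <= t -> positive_cone (u r)}].

Section Semigroups.
Context {R : realType} {X : completeNormedModType R}.
Implicit Types (T : R -> {linear X -> X}) (D : set X) (A : X -> X) (lambda : R).

(* Only the values T t with 0 <= t matter. *)
Definition C0_semigroup T : Prop :=
  [/\ forall t, 0 <= t -> continuous (T t),
      forall x, T 0 x = x,
      forall s t x, 0 <= s -> 0 <= t -> T (s + t) x = T s (T t x)
    & forall x, T h x @[h --> 0^'+] --> x].

Definition is_generator T D A : Prop :=
  forall x y, (D x /\ A x = y) <->
    (h^-1 *: (T h x - x) @[h --> 0^'+] --> y).

Definition growth_bound T : \bar R :=
  ereal_inf [set w%:E | w in [set w | exists M : R, forall t x, 0 <= t ->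
    `|T t x| <= M * expR (w * t) * `|x|]].

Definition resolvent D A lambda (y : X) : X :=
  xget 0 [set x | D x /\ lambda *: x - A x = y].

Definition resolvent_set D A : set R :=
  [set lambda | set_bij D [set: X] (fun x => lambda *: x - A x) /\
                continuous (resolvent D A lambda)].

End Semigroups.

(* An unbounded operator is a domain D together with a function on the whole
   space whose values outside D are irrelevant. *)
Definition linear_on (R : realType) (X Y : completeNormedModType R)
    (D : set X) (f : X -> Y) : Prop :=
  D 0 /\ forall (a : R) x y, D x -> D y ->
    D (a *: x + y) /\ f (a *: x + y) = a *: f x + f y.

(* bcs_domm is the domain of both the maximal operator bcs_Am and the boundary
   operator bcs_Q; bcs_Q_bounded is boundedness for the graph norm. *)
Record boundary_control_system (R : realType)
    (X dX U : completeNormedModType R) := BoundaryControlSystem {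
  bcs_domm : set X ;
  bcs_Am : X -> X ;
  bcs_Q : X -> dX ;
  bcs_B : {linear U -> dX} ;
  bcs_T : R -> {linear X -> X} ;
  bcs_Am_linear : linear_on bcs_domm bcs_Am ;
  bcs_Am_closed : closed [set z : X * X | bcs_domm z.1 /\ bcs_Am z.1 = z.2] ;
  bcs_Am_dense : dense bcs_domm ;
  bcs_Q_linear : linear_on bcs_domm bcs_Q ;
  bcs_Q_bounded : exists C : R, forall x, bcs_domm x ->
    `|bcs_Q x| <= C * (`|x| + `|bcs_Am x|) ;
  bcs_Q_surj : bcs_Q @` bcs_domm = [set: dX] ;
  bcs_B_continuous : continuous bcs_B ;
  bcs_T_semigroup : C0_semigroup bcs_T ;
  bcs_T_generator :
    is_generator bcs_T [set x | bcs_domm x /\ bcs_Q x = 0] bcs_Am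
}.

Section BoundaryControl.
Context {R : realType} {X dX U : completeNormedModType R}.
Variable S : boundary_control_system X dX U.
Implicit Types (t lambda : R) (p : \bar R) (u : R -> U).

Local Notation T := (bcs_T S).
Local Notation A := (bcs_Am S).

Definition bcs_dom : set X := [set x | bcs_domm S x /\ bcs_Q S x = 0].

Definition bcs_rho : set R := resolvent_set bcs_dom A.

Definition bcs_R lambda : X -> X := resolvent bcs_dom A lambda.

Definition dirichlet_op lambda (d : dX) : X :=
  xget 0 [set x | [/\ bcs_domm S x, lambda *: x - A x = 0 & bcs_Q S x = d]].

Definition bcs_Bl lambda (v : U) : X := dirichlet_op lambda (bcs_B S v).

Definition input_integral lambda t u : X :=
  bochner_integral t (fun s => T (t - s) (bcs_Bl lambda (u s))).

Definition boundary_admissible p : Prop :=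
  exists t lambda, [/\ 0 < t, bcs_rho lambda &
    forall u, Lp p t u -> bcs_dom (input_integral lambda t u)].

(* The value does not depend on the point lambda of the resolvent set, which is
   nonempty; xget selects one. *)
Definition controllability_map t u : X :=
  let lambda := xget 0 bcs_rho in
  lambda *: input_integral lambda t u - A (input_integral lambda t u).

End BoundaryControl.

Section PositiveReachability.
Context {R : realType} {X dX : completeNormedModType R}.
Context {U : banachLatticeType R}.
Variables (S : boundary_control_system X dX U) (p : \bar R).

Definition exact_pos_reach (t : R) : set X :=
  [set controllability_map S t u | u in Lp_pos p t].

Definition approx_pos_reach_at (t : R) : set X := closure (exact_pos_reach t).

Definition approx_pos_reach : set X :=
  closure (\bigcup_(t in [set t : R | 0 <= t]) approx_pos_reach_at t).

End PositiveReachability.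

Section Convexity.
Context {R : realType} {X : completeNormedModType R}.

Definition closed_convex_hull (A : set X) : set X :=
  smallest [set C : set X | closed C /\ convex_set C] A.

Definition closed_convex_cone (C : set X) : Prop :=
  [/\ closed C, convex_set C, C 0 &
      forall (a : R) x, 0 <= a -> C x -> C (a *: x)].

End Convexity.

(* Main.v *)
(* A control e^(l r) v, switched on for r in ]a, b], steers to the increment
   e^(l b) T(t - b) B_l v - e^(l a) T(t - a) B_l v, by the fundamental theorem of
   calculus; so the hull of the increments is contained in the reachability cone.
   Conversely, R(m) maps a reachable state to the integral of T(t - s) B_m u(s),
   which lies in the closed convex cone of the orbits T(t) B_m v, and m R(m) tends
   to the identity as m grows. Finally, for m > l and y = T(t) B_l v,
   T(t) B_m v = y - (m - l) R(m) y is an average of the increments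
   y - e^(- l s) T(s) y, which closes the circle. Iterates of resolvents and orbits
   of the semigroup are exchanged by the Laplace transform in one direction, and by
   Euler's formula and the Neumann series in the other. *)

Require Import Defs.
From HB Require Import structures.
From mathcomp Require Import finmap.
From mathcomp Require Import all_boot all_order all_algebra.
From mathcomp Require Import all_classical all_reals all_analysis.
From mathcomp Require Import measurable_realfun ess_sup_inf ring lra.

Set Implicit Arguments.
Unset Strict Implicit.
Unset Printing Implicit Defensive.

Import Order.TTheory GRing.Theory Num.Theory.
Import numFieldNormedType.Exports.

Local Open Scope classical_set_scope.
Local Open Scope ring_scope.

(** Bochner integrals occur only around the input integrals that define the states. Elsewhere a
    Laplace transform or an average is replaced by an explicit primitive and a mean value theorem
    for closed convex cones, [cone_mvt]: if the right derivatives of g lie in C, so do its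
    increments. The choice of C gives the different uses: the cone at hand for invariance, the norm
    cone of X * R for resolvent estimates, the closed range of m - A for surjectivity, and {0} for
    the fundamental theorem of calculus. Closedness and density of the generator are classically
    obtained from integrals of orbits. Here both come from a single point of the resolvent set,
    which admissibility provides; every number above an exponential bound of the semigroup is then
    shown to lie in the resolvent set. The controllability map is computed at a parameter selected
    by [xget]. A reachable state is therefore handled through its image under R(m), which is the
    input integral of B_m for every m with a resolvent. Reachable sets of different times are not
    compared. The increments are shown to be reachable in all large times, so that sums of
    increments remain in one reachable set. *)

Section LinearIdentities.
Context {R : pzRingType} {V : lmodType R}.

(** Syntax of linear combinations, for proving vector identities by reflection: the scalars stay in
    the ring and only the vectors are abstracted into atoms. *)
Inductive vexpr :=
| VZero | VAtom of nat | VAdd of vexpr & vexpr | VOpp of vexpr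
| VScale of R & vexpr.

Fixpoint veval (env : seq V) (e : vexpr) : V :=
  match e with
  | VZero => 0 | VAtom i => nth 0 env i
  | VAdd e1 e2 => veval env e1 + veval env e2
  | VOpp e1 => - veval env e1 | VScale c e1 => c *: veval env e1
  end.

(** [eqn] is used because it reduces under [cbn] on the literal indices produced by reification. *)
Fixpoint vcoef (i : nat) (e : vexpr) : R :=
  match e with
  | VZero => 0 | VAtom j => if eqn i j then 1 else 0
  | VAdd e1 e2 => vcoef i e1 + vcoef i e2
  | VOpp e1 => - vcoef i e1 | VScale c e1 => c * vcoef i e1
  end.

Lemma vevalE env e : veval env e = \sum_(i < size env) vcoef i e *: env`_i.
Proof.
elim: e => [|j|e1 IH1 e2 IH2|e IH|c e IH] /=.
- by rewrite big1// => i _; rewrite scale0r.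
- have [jn|nj] := ltnP j (size env); last first.
    rewrite nth_default// big1// => i _; case: eqnP => [ij|]; last by rewrite scale0r.
    by move: (ltn_ord i); rewrite ij ltnNge nj.
  rewrite (bigD1 (Ordinal jn))//= (introT eqnP erefl) scale1r big1 ?addr0// => i.
  case: eqnP => [ij /eqP[]|_ _]; [exact/val_inj|by rewrite scale0r].
- by rewrite IH1 IH2 -big_split; apply: eq_bigr => i _; rewrite scalerDl.
- by rewrite IH -sumrN; apply: eq_bigr => i _; rewrite scaleNr.
- by rewrite IH scaler_sumr; apply: eq_bigr => i _; rewrite scalerA.
Qed.

(** A conjunction instead of a quantification over indices, so that [cbn] yields finitely many
    scalar equations, which [repeat split] separates for [ring] or a given tactic. *)
Fixpoint vcoefs_eq (n : nat) (e1 e2 : vexpr) : Prop :=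
  if n is n'.+1 then vcoef n' e1 = vcoef n' e2 /\ vcoefs_eq n' e1 e2 else True.

Lemma veval_eq env e1 e2 : vcoefs_eq (size env) e1 e2 ->
  veval env e1 = veval env e2.
Proof.
move=> h; rewrite !vevalE; apply: eq_bigr => i _; congr (_ *: _).
elim: (size env) h i => [_ [//]|n IH /= [h1 h2] [i /=]].
rewrite ltnS leq_eqVlt => /orP[/eqP -> //|ltin]; exact: (IH h2 (Ordinal ltin)).
Qed.

End LinearIdentities.

(* Atoms are compared up to conversion, since the same sum may be built along
   different paths of the algebraic hierarchy. *)
Ltac vsame x y := match goal with _ => unify x y end.
Ltac vmem x l :=
  lazymatch l with
  | nil => constr:(false)
  | cons ?y ?l' =>
    match goal with
    | _ => let _ := vsame x y in constr:(true)
    | _ => vmem x l'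
    end
  end.
Ltac vatoms e l :=
  lazymatch e with
  | (?a + ?b)%R => let l' := vatoms a l in vatoms b l'
  | (- ?a)%R => vatoms a l
  | (_ *: ?a)%R => vatoms a l
  | 0%R => l
  | _ => let b := vmem e l in
         lazymatch b with true => l | false => constr:(cons e l) end
  end.
Ltac vindex x l :=
  lazymatch l with
  | cons ?y ?l' =>
    match goal with
    | _ => let _ := vsame x y in constr:(0%N)
    | _ => let n := vindex x l' in constr:(S n)
    end
  end.
Ltac vreify K e l :=
  lazymatch e with
  | (?a + ?b)%R => let a' := vreify K a l in let b' := vreify K b l in
                   constr:(@VAdd K a' b')
  | (- ?a)%R => let a' := vreify K a l in constr:(@VOpp K a')
  | (?c *: ?a)%R => let a' := vreify K a l in constr:(@VScale K c a')
  | 0%R => constr:(@VZero K)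
  | _ => let n := vindex e l in constr:(@VAtom K n)
  end.
(* Decides equalities of linear combinations, by comparing coefficients. *)
Ltac vring_with K tac :=
  lazymatch goal with
  | |- @eq ?T ?x ?y =>
    let l := vatoms x (@nil T) in
    let l := vatoms y l in
    let ex := vreify K x l in
    let ey := vreify K y l in
    refine (@veval_eq K _ l ex ey _); cbn [size vcoefs_eq vcoef eqn];
    repeat split; tac
  end.
Ltac vring := lazymatch goal with R : realType |- _ => vring_with R ltac:(try ring) end.

(** * Convex cones *)

Section RightLimits.
Context {R : realType} {V : normedModType R}.
Implicit Types (f : R -> V) (l : V).

Lemma cvg_right0P f l : f h @[h --> 0^'+] --> l <->
  forall e, 0 < e -> exists2 d, 0 < d & forall h, 0 < h < d -> `|f h - l| < e.
Proof.
split=> [/cvgrPdist_lt fl e e0|fl].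
  have := fl e e0; rewrite near_withinE /= => /nbhs_ballP[d d0 dP].
  exists d => // h /andP[h0 hd]; rewrite distrC; apply: dP => //=.
  by rewrite /ball /= sub0r normrN gtr0_norm.
apply/cvgrPdist_lt => e e0; have [d d0 dP] := fl e e0.
rewrite near_withinE; apply/nbhs_ballP; exists d => // h /=.
rewrite /ball /= sub0r normrN => hd h0; rewrite distrC; apply: dP.
by rewrite h0 -(gtr0_norm h0).
Qed.

Lemma cvg_seqP (u : nat -> V) l : u n @[n --> \oo] --> l <->
  forall e, 0 < e -> exists N, forall n, (N <= n)%N -> `|u n - l| < e.
Proof.
split=> [/cvgrPdist_lt ul e e0|ul].
  have [N _ NP] := ul e e0; exists N => n Nn; rewrite distrC; exact: NP.
apply/cvgrPdist_lt => e e0; have [N NP] := ul e e0.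
by exists N => // n /= Nn; rewrite distrC; exact: NP.
Qed.

Lemma closedP (C : set V) (x : V) : closed C ->
  (forall e, 0 < e -> exists2 y, C y & `|x - y| < e) -> C x.
Proof.
move=> cC xC; rewrite (closure_id C).1// => B /nbhs_ballP[e e0 eB].
by have [y Cy xy] := xC e e0; exists y; split => //; apply: eB; rewrite -ball_normE.
Qed.

Lemma closureP (C : set V) (x : V) : closure C x <->
  (forall e, 0 < e -> exists2 y, C y & `|x - y| < e).
Proof.
split=> [clx e e0|xC].
  have [y [Cy /=]] := clx _ (nbhsx_ballx x e e0).
  by rewrite -ball_normE /= => xy; exists y.
move=> B /nbhs_ballP[e e0 eB].
by have [y Cy xy] := xC e e0; exists y; split => //; apply: eB; rewrite -ball_normE.
Qed.

End RightLimits.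

Section Cones.
Context {R : realType} {V : normedModType R}.
Implicit Types (C : set V).

Definition convex_cone C : Prop :=
  [/\ C 0, forall x y, C x -> C y -> C (x + y)
    & forall (a : R) x, 0 <= a -> C x -> C (a *: x)].

Lemma convex_cone_sum C (I : eqType) (r : seq I) (F : I -> V) : convex_cone C ->
  (forall i, i \in r -> C (F i)) -> C (\sum_(i <- r) F i).
Proof.
move=> [C0 CD _] CF; rewrite big_seq; elim/big_ind : _ => // i; exact: CF.
Qed.

Lemma convex_cone_closure C : convex_cone C -> convex_cone (closure C).
Proof.
move=> [C0 CD CZ]; split; first exact: subset_closure.
- move=> x y /closureP Cx /closureP Cy; apply/closureP => e e0.
  have e20 : 0 < e / 2 by lra.
  have [x' Cx' xx'] := Cx _ e20; have [y' Cy' yy'] := Cy _ e20.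
  exists (x' + y'); first exact: CD.
  rewrite opprD addrACA (le_lt_trans (ler_normD _ _))//; lra.
- move=> a x a0 /closureP Cx; apply/closureP => e e0.
  have a10 : 0 < a + 1 by lra.
  have [x' Cx' xx'] := Cx (e / (a + 1)) (divr_gt0 e0 a10).
  exists (a *: x'); first exact: CZ.
  rewrite -scalerBr normrZ ger0_norm//.
  rewrite ltr_pdivlMr// in xx'; rewrite mulrC (le_lt_trans _ xx')// ler_wpM2l//; lra.
Qed.

(** This plays the role of integrating g' inside C. Consider the points c up to which g c - g a
    stays within ep (c - a) of C. Left continuity puts their supremum m in this set; if m < b, the
    right derivative at m, which lies in C, pushes the property beyond m. One-sided conditions
    suffice and are the ones available for orbits. *)
Lemma cone_mvt C (g g' : R -> V) (a b : R) : closed C -> convex_cone C ->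
  a <= b ->
  (forall s, a < s <= b -> g (s - h) @[h --> 0^'+] --> g s) ->
  (forall s, a <= s < b -> h^-1 *: (g (s + h) - g s) @[h --> 0^'+] --> g' s) ->
  (forall s, a <= s < b -> C (g' s)) ->
  C (g b - g a).
Proof.
move=> clC [C0 CD CZ] ab gl gr Cg'.
apply: closedP => // e e0.
(* The total drift ep (b - a) must stay below e / 2; the added 1 covers a = b. *)
pose ep := e / (2 * (b - a + 1)).
have ep0 : 0 < ep by rewrite divr_gt0//; lra.
have epE : ep * (b - a) < e / 2.
  have : ep * (2 * (b - a + 1)) = e by rewrite divfK// gt_eqF//; lra.
  lra.
(* The slack eta is there because the distance to C need not be attained; it is also what absorbs
   the passage to the supremum. *)
pose P c := forall eta, 0 < eta ->
  exists2 k, C k & `|g c - g a - k| <= ep * (c - a) + eta.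
pose E := [set c | a <= c <= b /\ P c].
have Ea : E a.
  split; first by rewrite lexx.
  by move=> eta eta0; exists 0 => //; rewrite !subrr normr0 mulr0 add0r ltW.
have supE : has_sup E.
  by split; [exists a|exists b => c [/andP[]]].
pose m := sup E.
have am : a <= m by apply: ub_le_sup => //; exact: supE.2.
have mb : m <= b by apply: ge_sup => [|c [/andP[]]//]; exists a.
have Pm : P m.
  move=> eta eta0; have [ma|ma] := eqVneq m a.
    by rewrite ma; case: Ea => _; apply.
  have {}ma : a < m by rewrite lt_neqAle eq_sym ma.
  have eta20 : 0 < eta / 2 by lra.
  have /gl/cvg_right0P/(_ _ eta20)[d d0 dP] : a < m <= b by rewrite ma.
  have [c Ec cm] := sup_adherent d0 supE.
  have cm' : c <= m by apply: ub_le_sup => //; exact: supE.2.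
  have [k Ck kP] := Ec.2 _ eta20; exists k => //.
  have -> : g m - g a - k = - (g c - g m) + (g c - g a - k) by vring.
  rewrite (le_trans (ler_normD _ _))// normrN.
  have gcm : `|g c - g m| <= eta / 2.
    have [->|cm0] := eqVneq c m; first by rewrite subrr normr0; lra.
    have /ltW : `|g (m - (m - c)) - g m| < eta / 2.
      apply: dP; apply/andP; split; last by rewrite /m; lra.
      by rewrite subr_gt0 lt_neqAle cm0.
    by rewrite subKr.
  have := ler_pM2l ep0 (c - a) (m - a); rewrite lerB// => /esym; lra.
have mbE : m = b.
  apply/eqP; rewrite eq_le mb /= leNgt; apply/negP => mltb.
  have amb : a <= m < b by rewrite am.
  have /cvg_right0P/(_ _ ep0)[d d0 dP] := gr _ amb.
  pose h := Num.min (d / 2) (b - m).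
  have h0 : 0 < h by rewrite lt_min; apply/andP; split; lra.
  have hd : h < d by rewrite gt_min; apply/orP; left; lra.
  have hb : m + h <= b.
    have : h <= b - m by rewrite ge_min lexx orbT.
    lra.
  suff : E (m + h).
    move=> /(ub_le_sup supE.2); rewrite -/m; lra.
  split; first by rewrite hb andbT; lra.
  move=> eta eta0; have [k Ck kP] := Pm _ eta0.
  exists (k + h *: g' m); first by apply: CD => //; apply: CZ; [exact: ltW|exact: Cg'].
  have -> : g (m + h) - g a - (k + h *: g' m) =
     (g m - g a - k) + h *: (h^-1 *: (g (m + h) - g m) - g' m).
    by vring; field; rewrite gt_eqF.
  rewrite (le_trans (ler_normD _ _))// normrZ gtr0_norm//.
  have := dP h; rewrite h0 hd => /(_ isT) /ltW => /(ler_wpM2l (ltW h0)).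
  lra.
have [k Ck] := Pm (e / 2) ltac:(lra).
rewrite mbE => kP; exists k => //; lra.
Qed.

End Cones.

(** * Bounded operators *)

Section BoundedLinear.
Context {R : realType} {V W : normedModType R}.
Implicit Types (f : V -> W) (x : V).

Definition bounded_linear f : Prop :=
  linear f /\ exists2 M : R, 0 < M & forall x, `|f x| <= M * `|x|.

Section Linear.
Variable f : V -> W.
Hypothesis lf : linear f.

Lemma lin0 : f 0 = 0.
Proof. by have := lf (-1) 0 0; rewrite scaler0 addr0 scaleN1r addNr. Qed.

Lemma linZ a x : f (a *: x) = a *: f x.
Proof. by have := lf a x 0; rewrite lin0 !addr0. Qed.

Lemma linD x y : f (x + y) = f x + f y.
Proof. by have := lf 1 x y; rewrite !scale1r. Qed.

Lemma linN x : f (- x) = - f x.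
Proof. by rewrite -scaleN1r linZ scaleN1r. Qed.

Lemma linB x y : f (x - y) = f x - f y.
Proof. by rewrite linD linN. Qed.
End Linear.

Lemma continuous_bounded_linear f : linear f -> continuous f -> bounded_linear f.
Proof.
move=> lf cf; split=> //.
have /cvgrPdist_lt/(_ 1 ltr01)/nbhs_ballP[d /= d0 dP] := cf 0.
exists (2 / d); first by rewrite divr_gt0.
move=> x; have [->|x0] := eqVneq x 0; first by rewrite lin0// !normr0 mulr0.
have nx : 0 < `|x| by rewrite normr_gt0.
have c0 : 0 < d / 2 / `|x| by rewrite !divr_gt0.
have : `|f 0 - f ((d / 2 / `|x|) *: x)| < 1.
  apply: dP; rewrite -ball_normE /ball_/= sub0r normrN normrZ gtr0_norm//.
  by rewrite divfK ?gt_eqF//; lra.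
rewrite lin0// sub0r normrN linZ// normrZ gtr0_norm// => /ltW.
rewrite -ler_pdivlMl// mulr1 => /le_trans; apply.
by rewrite !invf_div mulrC -mulrA mulrC.
Qed.

Lemma continuous_of_bounded_linear f : bounded_linear f -> continuous f.
Proof.
move=> [lf [M M0 fM]] x; apply/cvgrPdist_lt => e e0.
apply/nbhs_ballP; exists (e / M) => /=; first by rewrite divr_gt0.
move=> y; rewrite -ball_normE /ball_/= ltr_pdivlMr// mulrC => xy.
by rewrite -linB// (le_lt_trans (fM _)).
Qed.

Lemma bounded_linear_closure f (C : set V) (D : set W) : bounded_linear f ->
  closed D -> (forall x, C x -> D (f x)) -> forall x, closure C x -> D (f x).
Proof.
move=> [lf [M M0 fM]] cD CD x /closureP Cx; apply: closedP => // e e0.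
have [y Cy xy] := Cx (e / M) (divr_gt0 e0 M0).
exists (f y); first exact: CD.
by rewrite -linB// (le_lt_trans (fM _))// mulrC -ltr_pdivlMr.
Qed.

End BoundedLinear.

Section BanachSteinhaus.
Context {R : realType} {V : completeNormedModType R} {W : normedModType R}.

Lemma uniform_boundedness (I : Type) (f : I -> V -> W) :
  (forall i, bounded_linear (f i)) ->
  (forall x, exists M : R, forall i, `|f i x| <= M) ->
  exists2 M : R, 0 < M & forall i x, `|f i x| <= M * `|x|.
Proof.
move=> bf pf.
have /(_ 1) [M MP] : uniform_bounded [set g | exists i, g = f i].
  apply: Banach_Steinhauss.
    move=> _ [i ->]; have [lf [M M0 fM]] := bf i; split=> // r.
    exists (M * r) => x xr; rewrite (le_trans (fM x))// ler_wpM2l// ltW//.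
  by move=> x; have [M MP] := pf x; exists M => _ [i ->]; exact: MP.
exists (`|M| + 1); first by rewrite ltr_wpDl.
move=> i x; have [lf _] := bf i.
have [->|x0] := eqVneq x 0; first by rewrite lin0// !normr0 mulr0.
have nx : 0 < `|x| by rewrite normr_gt0.
have := MP (f i) (ex_intro _ i erefl) (`|x|^-1 *: x).
rewrite normrZ normfV normr_id mulVf ?gt_eqF// lexx => /(_ isT).
rewrite linZ// normrZ normfV normr_id ler_pdivrMl// => h.
by rewrite (le_trans h)// mulrC ler_wpM2r//; have := ler_norm M; lra.
Qed.

End BanachSteinhaus.

Section ClosedGraph.
Context {R : realType} {V W : completeNormedModType R}.

(** The distance estimate is part of the conclusion because the closed graph theorem needs the size
    of the limit. *)
Lemma geometric_cvg (U : completeNormedModType R) (u : nat -> U) (c q : R) :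
  0 <= q < 1 -> (forall n, `|u n.+1 - u n| <= c * q ^+ n) ->
  exists2 l, u n @[n --> \oo] --> l & forall n, `|l - u n| <= c * q ^+ n / (1 - q).
Proof.
move=> /andP[q0 q1] uq.
have c0 : 0 <= c by have := le_trans (normr_ge0 _) (uq 0%N); rewrite expr0 mulr1.
have q1' : 0 < 1 - q by lra.
(* The exact geometric partial sum, so that the induction on m closes. *)
have un n m : `|u (n + m)%N - u n| <= c * q ^+ n / (1 - q) * (1 - q ^+ m).
  elim: m => [|m IH]; first by rewrite addn0 subrr normr0 expr0 subrr mulr0.
  have -> : u (n + m.+1)%N - u n = (u (n + m).+1 - u (n + m)%N) + (u (n + m)%N - u n).
    by rewrite addnS; vring.
  rewrite (le_trans (ler_normD _ _))//.
  have := uq (n + m)%N; rewrite exprD exprS.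
  have -> : c * q ^+ n / (1 - q) * (1 - q * q ^+ m) =
     c * (q ^+ n * q ^+ m) + c * q ^+ n / (1 - q) * (1 - q ^+ m).
    by field; lra.
  lra.
have {}un n m : `|u (n + m)%N - u n| <= c * q ^+ n / (1 - q).
  rewrite (le_trans (un n m))// ler_piMr//.
    by rewrite divr_ge0 ?mulr_ge0 ?exprn_ge0// ltW.
  by rewrite gerBl exprn_ge0.
have cq : c * q ^+ n / (1 - q) @[n --> \oo] --> (0 : R).
  rewrite -[0](mul0r (1 - q)^-1) -[X in X * _](mulr0 c).
  by apply: cvgMl; apply: cvgMr; apply: cvg_expr; rewrite ger0_norm.
have : cvg (u n @[n --> \oo]).
  apply: cauchy_cvg; apply: cauchy_exP => e e0.
  have /cvg_seqP/(_ _ e0)[N NP] := cq.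
  exists (u N); exists N => // m /= Nm.
  rewrite -ball_normE /ball_ /= distrC -(subnKC Nm) (le_lt_trans (un _ _))//.
  by have := NP _ (leqnn N); rewrite subr0 => /(le_lt_trans (ler_norm _)).
move=> /cvg_ex[l ul]; exists l => // n.
apply/ler_addgt0Pr => e e0.
have /cvg_seqP/(_ _ e0)[N NP] := ul.
have -> : l - u n = - (u (n + N)%N - l) + (u (n + N)%N - u n) by vring.
rewrite (le_trans (ler_normD _ _))// normrN.
by have := NP _ (leq_addl n N); have := un n N; lra.
Qed.

(* Zabreiko: the closures of the sets [|f| <= n] cover V, so by Baire one of them
   contains a ball; by closedness of the graph f is bounded on that ball. *)
Lemma closed_graph_bounded (f : V -> W) : linear f ->
  (forall (u : nat -> V) x y, u n @[n --> \oo] --> x ->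
     f (u n) @[n --> \oo] --> y -> f x = y) ->
  bounded_linear f.
Proof.
move=> lf gf; split=> //.
pose A n := [set x | `|f x| <= n%:R].
have [n ndO] : exists n, ~ dense (~` closure (A n)).
  apply/existsNP => dA.
  have /Baire : forall n, open (~` closure (A n)) /\ dense (~` closure (A n)).
    move=> n; split; last exact: dA.
    by apply: closed_openC; exact: closed_closure.
  move=> /(_ setT) []; [by exists 0|exact: openT|].
  move=> x [_ /(_ (Num.truncn `|f x|).+1 I)]; apply; apply: subset_closure.
  by rewrite /A /= ltW// Num.Theory.truncnS_gt.
have [G [[x0 [Go Gx0]] GA]] := denseNE ndO.
have /nbhs_ballP[r /= r0 rG] : nbhs x0 G by apply: open_nbhs_nbhs.
have clA x : `|x - x0| < r -> closure (A n) x.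
  move=> xr; apply: contrapT => nA; suff : (G `&` ~` closure (A n)) x by rewrite GA.
  by split=> //; apply: rG; rewrite -ball_normE /ball_ /= distrC.
have n0 : 0 <= n%:R :> R by [].
(* Moves the ball from x0 to the origin: x is the difference of x0 + x and x0, each approximated
   from [A n], whence the factor 2. *)
have app x e : `|x| < r -> 0 < e -> exists2 y, `|f y| <= 2 * n%:R & `|x - y| < e.
  move=> xr e0; have e20 : 0 < e / 2 by lra.
  have [a Aa ax] : exists2 a, A n a & `|x0 + x - a| < e / 2.
    by apply: (closureP _ _).1 => //; apply: clA; rewrite addrAC subrr add0r.
  have [b Ab bx] : exists2 b, A n b & `|x0 - b| < e / 2.
    by apply: (closureP _ _).1 => //; apply: clA; rewrite subrr normr0.
  exists (a - b).
    rewrite linB// (le_trans (ler_normB _ _))//.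
    by move: Aa Ab; rewrite /A /=; lra.
  have -> : x - (a - b) = (x0 + x - a) - (x0 - b) by vring.
  by rewrite (le_lt_trans (ler_normB _ _))//; lra.
(* The smallness of x is a premise under the existential, so that the choice [next] is a total
   function and the residues can be defined by recursion. *)
have step k x : exists y, `|x| < r * 2^-1 ^+ k ->
    `|f y| <= 2 * n%:R * 2^-1 ^+ k /\ `|x - y| < r * 2^-1 ^+ k.+1.
  have [xr|] := boolP (`|x| < r * 2^-1 ^+ k); last by exists 0.
  have q0 : 0 < 2^-1 ^+ k :> R by rewrite exprn_gt0.
  have rq : 0 < r * 2^-1 by rewrite mulr_gt0.
  have qq : (2^-1 ^+ k)^-1 * 2^-1 ^+ k = 1 :> R by rewrite mulVf// gt_eqF.
  have [|y fy xy] := app ((2^-1 ^+ k)^-1 *: x) _ _ rq.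
    by rewrite normrZ gtr0_norm ?invr_gt0// ltr_pdivrMl// mulrC.
  exists (2^-1 ^+ k *: y) => _; split.
    by rewrite linZ// normrZ gtr0_norm// mulrC ler_pM2r.
  have -> : x - 2^-1 ^+ k *: y = 2^-1 ^+ k *: ((2^-1 ^+ k)^-1 *: x - y).
    by rewrite scalerBr scalerA divff ?scale1r// gt_eqF.
  by rewrite normrZ gtr0_norm// exprS [ltRHS]mulrA [ltRHS]mulrC ltr_pM2l.
pose next k x := sval (cid (step k x)).
have nextP k x : `|x| < r * 2^-1 ^+ k -> `|f (next k x)| <= 2 * n%:R * 2^-1 ^+ k /\
   `|x - next k x| < r * 2^-1 ^+ k.+1 by rewrite /next; case: cid.
(* The residues halve at each step, so x is the sum of the successive corrections. Their images are
   summable, and the closed graph identifies the sum of the images with f x; 4 n is 2 n / (1 -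
   1/2). *)
have bnd x : `|x| < r -> `|f x| <= 4 * n%:R.
  move=> xr; pose res := fix res k := if k is k'.+1 then res k' - next k' (res k') else x.
  have resP k : `|res k| < r * 2^-1 ^+ k.
    elim: k => [|k IH]; first by rewrite expr0 mulr1.
    by have [] := nextP _ _ IH.
  have sx : (x - res k) @[k --> \oo] --> x.
    apply/cvg_seqP => e e0.
    have : 2^-1 ^+ k @[k --> \oo] --> (0 : R) by apply: cvg_expr; rewrite ger0_norm//; lra.
    move=> /cvg_seqP/(_ (e / r) (divr_gt0 e0 r0))[N NP]; exists N => k Nk.
    rewrite addrAC subrr add0r normrN (lt_trans (resP k))//.
    have := NP k Nk; rewrite subr0 => /(le_lt_trans (ler_norm _)).
    by rewrite ltr_pdivlMr// mulrC.
  have [|k|l fl /(_ 0%N)] := @geometric_cvg _ (fun k => f (x - res k)) (2 * n%:R) 2^-1.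
  - lra.
  - rewrite -linB//.
    have -> : x - res k.+1 - (x - res k) = next k (res k) by rewrite /=; vring.
    by have [] := nextP _ _ (resP k).
  rewrite /= subrr lin0// subr0 (gf _ _ _ sx fl) expr0 => /le_trans; apply.
  have -> : 1 - 2^-1 = 2^-1 :> R by lra.
  by rewrite invrK; lra.
(* Rescaling x to norm r / 2 gives the factor 2 / r; the added 1 keeps the bound positive when n =
   0. *)
exists ((4 * n%:R + 1) * (2 / r)); first by rewrite !mulr_gt0 ?invr_gt0//; lra.
move=> x; have [->|xn0] := eqVneq x 0; first by rewrite lin0// !normr0 mulr0.
have nx : 0 < `|x| by rewrite normr_gt0.
have c0 : 0 < r / 2 / `|x| by rewrite !divr_gt0.
have := bnd ((r / 2 / `|x|) *: x).
rewrite normrZ gtr0_norm// divfK ?gt_eqF// ltr_pdivrMr// ltr_pMr// ltr1n => /(_ isT).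
rewrite linZ// normrZ gtr0_norm// -ler_pdivlMl// => /le_trans; apply.
have -> : (r / 2 / `|x|)^-1 = 2 / r * `|x| by field; rewrite !gt_eqF.
have : 0 <= 2 / r * `|x| by rewrite mulr_ge0// divr_ge0// ltW.
by rewrite -(mulrA (_ + 1)); move: (2 / r * `|x|) => q q0; lra.
Qed.

End ClosedGraph.

(** * The Bochner integral *)

Section SimpleMaps.
Context {R : realType}.
Local Notation mu := (@lebesgue_measure R).

(** The body of [simple_function] for values in any choice type. Pairs, booleans and grid indices
    are then allowed as values, and every construction of a simple function is a composition with a
    map on values. *)
Definition simple_map (Z : choiceType) (g : R -> Z) : Prop :=
  finite_set (range g) /\ forall z, measurable (g @^-1` [set z]).

Definition mass (t : R) (E : set R) : R := fine (mu (`[0, t] `&` E)).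

Lemma mass_ge0 t E : 0 <= mass t E.
Proof. by rewrite fine_ge0. Qed.

Lemma lebesgue_itv_fin (t : R) (E : set R) : measurable E ->
  (mu (`[0%R, t] `&` E) < +oo)%E.
Proof.
move=> mE; apply: (@le_lt_trans _ _ (mu `[0%R, t])).
  by apply: le_measure; rewrite ?inE//; exact: measurableI.
by rewrite lebesgue_measure_itv/=; case: ifP => _; rewrite ?ltry// EFinN oppr0 adde0 ltry.
Qed.

Lemma massE t E : measurable E -> (mass t E)%:E = mu (`[0, t] `&` E).
Proof. by move=> mE; rewrite fineK// ge0_fin_numE// lebesgue_itv_fin. Qed.

Section OneMap.
Context {Z : choiceType} {g : R -> Z}.
Hypothesis sg : simple_map g.

Definition vals : seq Z := enum_fset (fset_set (range g)).

Lemma mem_vals r : g r \in vals.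
Proof. by rewrite /vals in_fset_set ?inE; [exists r|case: sg]. Qed.

Lemma vals_uniq : uniq vals. Proof. exact: fset_uniq. Qed.

Lemma preimage_simple (A : set Z) : g @^-1` A =
  \bigcup_(z in [set z | z \in vals /\ A z]) (g @^-1` [set z]).
Proof.
apply/seteqP; split=> [r Agr|r [z [zv Az] /= ->]//].
by exists (g r) => //; split=> //; exact: mem_vals.
Qed.

Lemma measurable_simple (A : set Z) : measurable (g @^-1` A).
Proof.
rewrite preimage_simple; apply: fin_bigcup_measurable => [|z _].
  apply: (@sub_finite_set _ _ [set` vals]) => [z []//|].
  exact: finite_seq.
exact: sg.2.
Qed.

Lemma mass_simple t (A : pred Z) :
  mass t (g @^-1` [set z | A z]) = \sum_(z <- vals | A z) mass t (g @^-1` [set z]).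
Proof.
apply: EFin_inj; rewrite massE; last exact: measurable_simple.
rewrite -sumEFin preimage_simple setI_bigcupr measure_fin_bigcup.
- rewrite (fsbigE [seq z <- vals | A z]) ?filter_uniq ?vals_uniq//.
  + rewrite big_filter_cond big_seq_cond [RHS]big_seq_cond.
    apply: eq_big => [z|z _]; last by rewrite massE//; exact: sg.2.
    have [zv|//] := boolP (z \in vals); have [Az|//] := boolP (A z).
    by rewrite mem_set.
  + by move=> z /=; rewrite mem_filter => /andP[].
  + by move=> z [zv Az]; rewrite mem_filter zv /= Az.
- apply: (@sub_finite_set _ _ [set` vals]) => [z []//|].
  exact: finite_seq.
- by move=> z1 z2 _ _ [r [[_ /= <-] [_ /= <-]]].
- by move=> z _; apply: measurableI => //; exact: sg.2.
Qed.

Lemma simple_map_comp (Z' : choiceType) (phi : Z -> Z') : simple_map (phi \o g).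
Proof.
split=> [|z].
  by rewrite -(image_comp g phi); exact: finite_image sg.1.
exact: (measurable_simple (phi @^-1` [set z])).
Qed.

Lemma measurable_fun_simple (phi : Z -> R) (D : set R) :
  measurable_fun D (fun r => phi (g r)).
Proof.
move=> mD B mB; apply: measurableI => //.
exact: (measurable_simple (phi @^-1` B)).
Qed.

Lemma integral_simple_map t (phi : Z -> R) : (forall z, 0 <= phi z) ->
  (\int[mu]_(r in `[0%R, t]) (phi (g r))%:E =
   (\sum_(z <- vals) mass t (g @^-1` [set z]) * phi z)%:E)%E.
Proof.
move=> phi0.
transitivity (\int[mu]_(r in `[0%R, t])
    \sum_(z <- vals) ((phi z)%:E * (\1_(g @^-1` [set z]) r)%:E))%E.
  apply: eq_integral => r _.
  rewrite (bigD1_seq (g r)) ?mem_vals ?vals_uniq//= big1 => [|z zr].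
    by rewrite adde0 indicE mem_set// mule1.
  by rewrite indicE memNset ?mule0// => /= /esym; exact/eqP.
rewrite ge0_integral_sum//; last 2 first.
- move=> z; apply/measurable_EFinP; apply: measurable_funM => //.
  by apply: measurable_indic; exact: sg.2.
- by move=> z r _; rewrite lee_fin mulr_ge0.
rewrite -sumEFin; apply: eq_bigr => z _.
rewrite ge0_integralZl_EFin//; last first.
  by apply/measurable_EFinP; apply: measurable_indic; exact: sg.2.
rewrite integral_indic//; last exact: sg.2.
by rewrite EFinM massE; [rewrite setIC muleC|exact: sg.2].
Qed.

(** Each level set of the composite is the disjoint union of the level sets of g over a fibre of h;
    exchanging the two sums regroups the terms by values of g. *)
Lemma sum_mass_comp t (V : lmodType R) (Z' : choiceType) (h : Z -> Z') (r : seq Z')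
    (phi : Z' -> V) :
  uniq r -> (forall z, z \in vals -> h z \in r) ->
  \sum_(x <- r) mass t ((h \o g) @^-1` [set x]) *: phi x =
  \sum_(z <- vals) mass t (g @^-1` [set z]) *: phi (h z).
Proof.
move=> ur hr.
transitivity (\sum_(x <- r) \sum_(z <- vals | h z == x)
    mass t (g @^-1` [set z]) *: phi (h z)).
  apply: eq_bigr => x _.
  have -> : (h \o g) @^-1` [set x] = g @^-1` [set z | h z == x].
    by apply/seteqP; split=> s /= /eqP.
  by rewrite mass_simple scaler_suml; apply: eq_bigr => z /eqP ->.
rewrite (exchange_big_dep xpredT)//= big_seq [RHS]big_seq.
apply: eq_bigr => z zv.
rewrite big_mkcond (bigD1_seq (h z)) ?hr//= eqxx big1 ?addr0// => x.
by rewrite eq_sym => /negbTE ->.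
Qed.

End OneMap.

Lemma simple_map_pair (Z1 Z2 : choiceType) (g1 : R -> Z1) (g2 : R -> Z2) :
  simple_map g1 -> simple_map g2 -> simple_map (fun r => (g1 r, g2 r)).
Proof.
move=> s1 s2; split=> [|[z1 z2]].
  apply: (@sub_finite_set _ _ (range g1 `*` range g2)).
    by move=> _ [r _ <-]; split; exists r.
  by apply: finite_setX; [case: s1|case: s2].
have -> : (fun r => (g1 r, g2 r)) @^-1` [set (z1, z2)] =
    g1 @^-1` [set z1] `&` g2 @^-1` [set z2].
  by apply/seteqP; split=> r /= [-> ->].
by apply: measurableI; [exact: s1.2|exact: s2.2].
Qed.

Lemma simple_map_cst (Z : choiceType) (z : Z) : simple_map (fun=> z).
Proof.
split=> [|y]; first by apply: (@sub_finite_set _ _ [set z]) => // _ [r _ <-].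
by have [->|zy] := eqVneq z y; rewrite ?preimage_cst; case: ifP.
Qed.

Lemma simple_map_indic (E : set R) : measurable E ->
  simple_map (fun r => r \in E).
Proof.
move=> mE; split=> [|b].
  by apply: (@sub_finite_set _ _ [set` [:: true; false]]) => // b _; case: b.
case: b.
  rewrite (_ : _ @^-1` _ = E)//; apply/seteqP.
  by split=> r /=; [move=> /set_mem|move=> /mem_set].
rewrite (_ : _ @^-1` _ = ~` E); first exact: measurableC.
by apply/seteqP; split=> r /=; [move=> /negbT /negP rE /mem_set|move=> rE; exact: memNset].
Qed.

End SimpleMaps.

Arguments vals {R Z} g.

Section SimpleIntegral.
Context {R : realType}.
Local Notation mu := (@lebesgue_measure R).

Lemma simple_integral_comp {X : completeNormedModType R} t (Z : choiceType)
    (g : R -> Z) (phi : Z -> X) : simple_map g ->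
  simple_integral t (phi \o g) =
  \sum_(z <- vals g) mass t (g @^-1` [set z]) *: phi z.
Proof.
move=> sg; have sp := simple_map_comp sg phi.
rewrite /simple_integral (fsbigTE (fset_set (range (phi \o g)))).
  apply: (sum_mass_comp sg t (fun x => x)); first exact: fset_uniq.
  move=> z; rewrite /vals in_fset_set ?inE; last by case: sg.
  by move=> [r _ <-]; exact: (mem_vals sp).
move=> x; rewrite in_fset_set; last by case: sp.
move=> /negP nx; rewrite (_ : _ @^-1` _ = set0); first by rewrite setI0 measure0 scale0r.
by apply/seteqP; split=> // r /= rx; apply: nx; apply/mem_set; exists r.
Qed.

Context {X Y : completeNormedModType R}.

Lemma simple_integralE t (s : R -> X) : simple_function s ->
  simple_integral t s = \sum_(z <- vals s) mass t (s @^-1` [set z]) *: z.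
Proof. by move=> ss; rewrite -(@simple_integral_comp _ _ _ s id). Qed.

(** All three integrals are written over the values of the pair (s1, s2), a common refinement on
    which the identity holds term by term. *)
Lemma simple_integral_lin t (a : R) (s1 s2 : R -> X) :
  simple_function s1 -> simple_function s2 ->
  simple_integral t (fun r => a *: s1 r + s2 r) =
  a *: simple_integral t s1 + simple_integral t s2.
Proof.
move=> ss1 ss2; have sp := simple_map_pair ss1 ss2.
rewrite (@simple_integral_comp _ t _ _ (fun z => a *: z.1 + z.2) sp).
rewrite (@simple_integral_comp _ t _ _ fst sp) (@simple_integral_comp _ t _ _ snd sp).
rewrite scaler_sumr -big_split; apply: eq_bigr => z _ /=.
by rewrite scalerDr !scalerA mulrC.
Qed.

Lemma norm_simple_integral t (s : R -> X) : simple_function s ->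
  (`|simple_integral t s|%:E <= \int[mu]_(r in `[0%R, t]) `|s r|%:E)%E.
Proof.
move=> ss; rewrite (integral_simple_map ss t (phi := fun x => `|x|))// lee_fin.
rewrite simple_integralE// (le_trans (ler_norm_sum _ _ _))// ler_sum// => z _.
by rewrite normrZ ger0_norm// mass_ge0.
Qed.

Lemma simple_integral_linear t (s : R -> X) (f : X -> Y) : linear f ->
  simple_function s -> simple_integral t (f \o s) = f (simple_integral t s).
Proof.
move=> lf ss; rewrite (simple_integral_comp t f ss) simple_integralE//.
elim: (vals s) => [|z l IH]; first by rewrite !big_nil lin0.
by rewrite !big_cons IH lf.
Qed.

End SimpleIntegral.

Lemma ecvg0P (R : realType) (u : nat -> \bar R) : (forall n, 0 <= u n)%E ->
  u n @[n --> \oo] --> 0%:E <->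
  forall e : R, 0 < e -> exists N, forall n, (N <= n)%N -> (u n < e%:E)%E.
Proof.
move=> u0; split=> [ucv e e0|ucv].
  have : nbhs 0%:E [set y : \bar R | (y < e%:E)%E].
    rewrite /nbhs /= /ereal_nbhs /=; apply/nbhs_ballP; exists e => // r.
    rewrite /ball /= sub0r normrN lte_fin; exact: le_lt_trans (ler_norm _).
  by move=> /ucv[N _ NP]; exists N => n; exact: NP.
move=> B /= [e /= e0 eB]; have [N NP] := ucv e e0.
exists N => // n /= /NP; have := u0 n; case: (u n) => [r||]//.
rewrite lee_fin lte_fin => r0 re; apply: eB.
by rewrite /ball /= sub0r normrN ger0_norm.
Qed.

Section StronglyMeasurable.
Context {R : realType} {X : completeNormedModType R}.
Local Notation mu := (@lebesgue_measure R).
Implicit Types (f g s : R -> X) (t : R).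

Lemma simple_lin (a : R) (s1 s2 : R -> X) : simple_function s1 ->
  simple_function s2 -> simple_function (fun r => a *: s1 r + s2 r).
Proof.
move=> ss1 ss2.
exact: (simple_map_comp (simple_map_pair ss1 ss2) (fun z => a *: z.1 + z.2)).
Qed.

Lemma simple_strongly_measurable t s : simple_function s ->
  strongly_measurable t s.
Proof. by move=> ss; exists (fun=> s) => // r _; exact: cvg_cst. Qed.

Lemma eq_strongly_measurable t f g : (forall r, 0 <= r <= t -> f r = g r) ->
  strongly_measurable t f -> strongly_measurable t g.
Proof. by move=> fg [s ss sf]; exists s => // r rt; rewrite -fg//; exact: sf. Qed.

Lemma strongly_measurable_lin t a f g : strongly_measurable t f ->
  strongly_measurable t g -> strongly_measurable t (fun r => a *: f r + g r).
Proof.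
move=> [s ss sf] [s' ss' sg].
exists (fun n r => a *: s n r + s' n r) => [n|r rt]; first exact: simple_lin.
by apply: cvgD; [apply: cvgZr; exact: sf|exact: sg].
Qed.

Lemma strongly_measurableZ t a f : strongly_measurable t f ->
  strongly_measurable t (fun r => a *: f r).
Proof.
move=> mf; apply: (@eq_strongly_measurable t (fun r => a *: f r + 0)).
  by move=> r _; rewrite addr0.
apply: strongly_measurable_lin => //.
by apply: simple_strongly_measurable; exact: (simple_map_cst (0 : X)).
Qed.

Lemma strongly_measurableB t f g : strongly_measurable t f ->
  strongly_measurable t g -> strongly_measurable t (fun r => f r - g r).
Proof.
move=> mf mg; apply: (@eq_strongly_measurable t (fun r => (-1) *: g r + f r)).
  by move=> r _; rewrite scaleN1r addrC.
exact: strongly_measurable_lin.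
Qed.

Lemma strongly_measurableD t f g : strongly_measurable t f ->
  strongly_measurable t g -> strongly_measurable t (fun r => f r + g r).
Proof.
move=> mf mg; apply: (@eq_strongly_measurable t (fun r => 1 *: f r + g r)).
  by move=> r _; rewrite scale1r.
exact: strongly_measurable_lin.
Qed.

Lemma simple_restrict (E : set R) s : measurable E -> simple_function s ->
  simple_function (fun r => if r \in E then s r else 0).
Proof.
move=> mE ss.
exact: (simple_map_comp (simple_map_pair (simple_map_indic mE) ss)
  (fun z => if z.1 then z.2 else 0)).
Qed.

Lemma strongly_measurable_restrict t (E : set R) f : measurable E ->
  strongly_measurable t f ->
  strongly_measurable t (fun r => if r \in E then f r else 0).
Proof.
move=> mE [s ss sf]; exists (fun n r => if r \in E then s n r else 0).
  by move=> n; exact: simple_restrict.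
by move=> r rt; case: ifP => _; [exact: sf|exact: cvg_cst].
Qed.

Lemma measurable_norm t f : strongly_measurable t f ->
  measurable_fun `[0, t] (fun r => `|f r|).
Proof.
move=> [s ss sf].
apply: (@measurable_fun_cvg _ _ _ _ (fun n r => `|s n r|)).
  by move=> n; exact: (measurable_fun_simple (ss n) (fun x => `|x|)).
by move=> r /=; rewrite in_itv/= => rt; apply: cvg_norm; exact: sf.
Qed.

Lemma measurable_enorm t f : strongly_measurable t f ->
  measurable_fun `[0, t] (fun r => `|f r|%:E).
Proof. by move=> mf; apply/measurable_EFinP; exact: measurable_norm. Qed.

Definition L1norm t f : \bar R := (\int[mu]_(r in `[0%R, t]) `|f r|%:E)%E.

Lemma L1norm_ge0 t f : (0 <= L1norm t f)%E.
Proof. by apply: integral_ge0 => r _; rewrite lee_fin. Qed.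

Lemma eq_L1norm t f g : (forall r, 0 <= r <= t -> f r = g r) ->
  L1norm t f = L1norm t g.
Proof.
move=> fg; apply: eq_integral => r.
by rewrite inE/= in_itv/= => /fg ->.
Qed.

Lemma L1normD t f g : strongly_measurable t f -> strongly_measurable t g ->
  (L1norm t (fun r => (f r + g r)%R) <= L1norm t f + L1norm t g)%E.
Proof.
move=> mf mg; rewrite -ge0_integralD//; [|exact: measurable_enorm..].
apply: ge0_le_integral => //.
- by apply: measurable_enorm; exact: strongly_measurableD.
- by apply: emeasurable_funD; exact: measurable_enorm.
- by move=> r _; rewrite -EFinD lee_fin ler_normD.
Qed.

End StronglyMeasurable.

Section StronglyMeasurable2.
Context {R : realType} {X Y : completeNormedModType R}.
Local Notation mu := (@lebesgue_measure R).

Lemma le_L1norm t (C : R) (f : R -> X) (g : R -> Y) : 0 <= C ->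
  strongly_measurable t f -> strongly_measurable t g ->
  (forall r, 0 <= r <= t -> `|f r| <= C * `|g r|) ->
  (L1norm t f <= C%:E * L1norm t g)%E.
Proof.
move=> C0 mf mg fg; rewrite -ge0_integralZl_EFin//; last exact: measurable_enorm.
apply: ge0_le_integral => //; first exact: measurable_enorm.
by apply: measurable_funeM; exact: measurable_enorm.
Qed.

Lemma strongly_measurable_comp t (L : X -> Y) (f : R -> X) : continuous L ->
  strongly_measurable t f -> strongly_measurable t (L \o f).
Proof.
move=> cL [s ss sf]; exists (fun n => L \o s n).
  by move=> n; exact: (simple_map_comp (ss n) L).
by move=> r rt; apply: continuous_cvg; [exact: cL|exact: sf].
Qed.

End StronglyMeasurable2.

Section Bochner.
Context {R : realType} {X : completeNormedModType R}.
Local Notation mu := (@lebesgue_measure R).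
Implicit Types (f g s : R -> X) (t : R).

(** One approximant for each error replaces the approximating sequence; errors 1 / (n + 1) give the
    sequence back. *)
Lemma is_bochner_integralP t f y : is_bochner_integral t f y <->
  strongly_measurable t f /\ forall e : R, 0 < e -> exists s,
    [/\ simple_function s, (L1norm t (fun r => f r - s r)%R < e%:E)%E
      & `|simple_integral t s - y| < e].
Proof.
split=> [[mf [s [ss fs sy]]]|[mf fs]].
  split=> // e e0.
  have /(ecvg0P (fun n => L1norm_ge0 t (fun r => f r - s n r))) := fs.
  move=> /(_ e e0)[N NP]; move/cvg_seqP : sy => /(_ e e0)[N' NP'].
  exists (s (maxn N N')); split=> //; [apply: NP; exact: leq_maxl|apply: NP'; exact: leq_maxr].
split=> //.
have /choice[s sP] : forall n : nat, exists s,
    [/\ simple_function s, (L1norm t (fun r => f r - s r)%R < (n.+1%:R^-1)%:E)%E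
      & `|simple_integral t s - y| < n.+1%:R^-1] by move=> n; apply: fs.
have small (e : R) : 0 < e -> exists N, forall n, (N <= n)%N -> n.+1%:R^-1 < e.
  move=> e0; have /cvg_seqP/(_ e e0)[N NP] := @cvg_harmonic R.
  exists N => n /NP; rewrite /harmonic subr0; exact: le_lt_trans (ler_norm _).
exists s; split.
- by move=> n; case: (sP n).
- apply/(ecvg0P (fun n => L1norm_ge0 t (fun r => f r - s n r))) => e e0.
  have [N NP] := small e e0; exists N => n /NP ne.
  by case: (sP n) => _ + _; move/lt_trans; apply; rewrite lte_fin.
- apply/cvg_seqP => e e0; have [N NP] := small e e0; exists N => n /NP ne.
  by case: (sP n) => _ _; move/lt_trans; exact.
Qed.

Lemma eq_is_bochner_integral t f g y : (forall r, 0 <= r <= t -> f r = g r) ->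
  is_bochner_integral t f y -> is_bochner_integral t g y.
Proof.
move=> fg /is_bochner_integralP[mf fs]; apply/is_bochner_integralP; split.
  exact: eq_strongly_measurable mf.
move=> e e0; have [s [ss fse sy]] := fs e e0; exists s; split=> //.
by rewrite -(@eq_L1norm _ _ t (fun r => f r - s r))// => r /fg ->.
Qed.

Lemma is_bochner_integral_lin t a f g y z : is_bochner_integral t f y ->
  is_bochner_integral t g z ->
  is_bochner_integral t (fun r => a *: f r + g r) (a *: y + z).
Proof.
move=> /is_bochner_integralP[mf fs] /is_bochner_integralP[mg gs].
apply/is_bochner_integralP; split; first exact: strongly_measurable_lin.
move=> e e0; pose d := e / (`|a| + 1).
have a1 : 0 < `|a| + 1 by rewrite ltr_wpDl.
have d0 : 0 < d by rewrite divr_gt0.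
have dE : `|a| * d + d = e by rewrite /d; field; rewrite gt_eqF.
have [s [ss fse sy]] := fs d d0; have [s' [ss' gse sz]] := gs d d0.
exists (fun r => a *: s r + s' r); split; first exact: simple_lin.
  rewrite (@eq_L1norm _ _ _ _ (fun r => a *: (f r - s r) + (g r - s' r))); last first.
    by move=> r _; vring.
  have mfs : strongly_measurable t (fun r => f r - s r).
    by apply: strongly_measurableB => //; exact: simple_strongly_measurable.
  have mgs : strongly_measurable t (fun r => g r - s' r).
    by apply: strongly_measurableB => //; exact: simple_strongly_measurable.
  have afs : (L1norm t (fun r => a *: (f r - s r)) <= (`|a| * d)%:E)%E.
    rewrite (le_trans (@le_L1norm _ _ _ t `|a| _ (fun r => f r - s r) _ _ _ _))//.
    - exact: strongly_measurableZ.
    - by move=> r _; rewrite normrZ.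
    - by rewrite EFinM lee_wpmul2l// ltW.
  rewrite (le_lt_trans (L1normD _ mgs))//; first exact: strongly_measurableZ.
  rewrite -dE EFinD lee_ltD// ge0_fin_numE ?L1norm_ge0//.
  by rewrite (le_lt_trans afs)// ltry.
rewrite simple_integral_lin//.
have -> : a *: simple_integral t s + simple_integral t s' - (a *: y + z) =
  a *: (simple_integral t s - y) + (simple_integral t s' - z) by vring.
by rewrite (le_lt_trans (ler_normD _ _))// normrZ -dE ler_ltD// ler_wpM2l// ltW.
Qed.

(** The bound passes from simple functions to f because both the integral and the L^1 norm move by
    at most the approximation error. Applied to f - f it yields uniqueness of the integral. *)
Lemma is_bochner_integral_le t f y : is_bochner_integral t f y ->
  (`|y|%:E <= L1norm t f)%E.
Proof.
move=> /is_bochner_integralP[mf fs]; apply/lee_addgt0Pr => e e0.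
have e20 : 0 < e / 2 by lra.
have [s [ss fse sy]] := fs _ e20.
have : (L1norm t s <= L1norm t f + (e / 2)%:E)%E.
  rewrite -(@eq_L1norm _ _ t (fun r => f r + (-1) *: (f r - s r))); last first.
    by move=> r _; vring.
  have mfs : strongly_measurable t (fun r => f r - s r).
    by apply: strongly_measurableB => //; exact: simple_strongly_measurable.
  rewrite (le_trans (L1normD _ _))//; first exact: strongly_measurableZ.
  rewrite leeD2l// ltW// (le_lt_trans _ fse)//.
  rewrite -[leRHS]mul1e; apply: le_L1norm => //; first exact: strongly_measurableZ.
  by move=> r _; rewrite scaleN1r normrN mul1r.
move=> h; have := le_trans (norm_simple_integral t ss) h.
move=> {}h; apply: (@le_trans _ _ (`|simple_integral t s|%:E + (e / 2)%:E)%E).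
  rewrite -EFinD lee_fin.
  have := ler_normB (simple_integral t s) (simple_integral t s - y).
  by rewrite subKr; lra.
rewrite (le_trans (leeD2r _ h))// -addeA -EFinD leeD2l// lee_fin; lra.
Qed.

Lemma is_bochner_integral0 t : is_bochner_integral t (fun=> 0 : X) 0.
Proof.
apply/is_bochner_integralP.
have s0 : simple_function (fun=> 0 : X) by exact: (simple_map_cst (0 : X)).
split; first exact: simple_strongly_measurable.
move=> e e0; exists (fun=> 0); split=> //.
  rewrite /L1norm; under eq_integral do rewrite subr0 normr0.
  by rewrite integral0 lte_fin.
(* If I is the integral of the zero function, linearity gives I = - I + I. *)
rewrite -[X in simple_integral t X](_ : (fun r => (-1) *: (fun=> 0 : X) r + (fun=> 0) r) = _); last first.
  by apply/funext => r; rewrite scaler0 addr0.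
by rewrite simple_integral_lin// scaleN1r addNr subrr normr0.
Qed.

Lemma is_bochner_integralZ t a f y : is_bochner_integral t f y ->
  is_bochner_integral t (fun r => a *: f r) (a *: y).
Proof.
move=> fy; rewrite -[a *: y]addr0.
apply: (@eq_is_bochner_integral _ (fun r => a *: f r + 0)).
  by move=> r _; rewrite addr0.
by apply: is_bochner_integral_lin => //; exact: is_bochner_integral0.
Qed.

Lemma is_bochner_integralB t f g y z : is_bochner_integral t f y ->
  is_bochner_integral t g z ->
  is_bochner_integral t (fun r => f r - g r) (y - z).
Proof.
move=> fy gz; have -> : y - z = (-1) *: z + y by vring.
apply: eq_is_bochner_integral (is_bochner_integral_lin (-1) gz fy).
by move=> r _; vring.
Qed.

Lemma is_bochner_integralD t f g y z : is_bochner_integral t f y ->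
  is_bochner_integral t g z ->
  is_bochner_integral t (fun r => f r + g r) (y + z).
Proof.
move=> fy gz; have -> : y + z = 1 *: y + z by vring.
apply: eq_is_bochner_integral (is_bochner_integral_lin 1 fy gz).
by move=> r _; vring.
Qed.

Lemma is_bochner_integral_unique t f y z : is_bochner_integral t f y ->
  is_bochner_integral t f z -> y = z.
Proof.
move=> fy fz; have /is_bochner_integral_le := is_bochner_integralB fy fz.
rewrite /L1norm; under eq_integral do rewrite subrr normr0.
rewrite integral0 lee_fin normr_le0 subr_eq0; exact/eqP.
Qed.

Lemma bochner_integralE t f y : is_bochner_integral t f y ->
  bochner_integral t f = y.
Proof.
move=> fy; apply: (is_bochner_integral_unique _ fy).
by rewrite /bochner_integral; apply: xgetPex; exists y.
Qed.

(* Simple functions converging pointwise to f, cut off where they exceed 2|f|,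
   converge to f in L^1 by dominated convergence. *)
Lemma is_bochner_integral_exists t f : strongly_measurable t f ->
  (L1norm t f < +oo)%E -> exists y, is_bochner_integral t f y.
Proof.
move=> mf fi; have [s ss sf] := mf.
pose E n := `[0, t] `&` (fun r => 2 * `|f r| - `|s n r|) @^-1` `[0, +oo[.
have mE n : measurable (E n).
  have : measurable_fun `[0, t] (fun r => 2 * `|f r| - `|s n r|).
    apply: measurable_funB; last exact: (measurable_fun_simple (ss n) (fun x => `|x|)).
    by apply: measurable_funM => //; exact: measurable_norm.
  by move=> /(_ (measurable_itv _)); apply; exact: measurable_itv.
have EP n r : 0 <= r <= t -> (r \in E n) = (`|s n r| <= 2 * `|f r|).
  move=> rt; apply/idP/idP => [/set_mem[_]|h].
    by rewrite /= in_itv/= andbT subr_ge0.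
  by apply/mem_set; split; rewrite /= in_itv//= andbT subr_ge0.
pose s' n r := if r \in E n then s n r else 0.
have ss' n : simple_function (s' n) by exact: simple_restrict.
have ms' n : strongly_measurable t (s' n) by exact: simple_strongly_measurable.
have mfs' n : strongly_measurable t (fun r => f r - s' n r).
  exact: strongly_measurableB.
have s'f r : 0 <= r <= t -> s' n r @[n --> \oo] --> f r.
  move=> rt; have [fr0|fr0] := eqVneq (f r) 0.
    rewrite fr0 (_ : s' ^~ r = fun=> 0); first exact: cvg_cst.
    apply/funext => n; rewrite /s' EP// fr0 normr0 mulr0 normr_le0.
    by case: ifP => // /eqP.
  apply/cvg_seqP => e e0; have /cvg_seqP sr := sf r rt.
  (* Once s n r is closer to f r than the norm of f r, its norm is below twice that of f r and the
     cut-off is inactive. *)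
  have fr : 0 < `|f r| by rewrite normr_gt0.
  have [N NP] := sr e e0; have [N' NP'] := sr _ fr.
  exists (maxn N N') => n; rewrite geq_max => /andP[/NP h /NP' h'].
  rewrite /s' EP// (_ : _ <= _)//.
  have := ler_normD (s n r - f r) (f r); rewrite subrK; lra.
have cv : (L1norm t (fun r => f r - s' n r)%R @[n --> \oo] --> 0%:E)%E.
  have [|||||_ _] := @dominated_convergence _ _ _ mu `[0%R, t] (measurable_itv _)
    (fun n r => `|f r - s' n r|%:E) (cst 0%E) (fun r => (3 * `|f r|)%:E).
  - by move=> n; exact: measurable_enorm.
  - exact: measurable_cst.
  - apply: aeW => r /=; rewrite in_itv/= => rt.
    apply: cvg_EFin; first by near=> n.
    rewrite -(normr0 X) -(subrr (f r)); apply: cvg_norm.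
    by apply: cvgB; [exact: cvg_cst|exact: s'f].
  - apply/integrableP; split.
      by apply/measurable_EFinP; apply: measurable_funM => //; exact: measurable_norm.
    rewrite (_ : (fun r => _) = (fun r => 3%:E * `|f r|%:E)%E); last first.
      by apply/funext => r; rewrite gee0_abs ?lee_fin ?mulr_ge0.
    rewrite ge0_integralZl_EFin//; last exact: measurable_enorm.
    by rewrite lte_mul_pinfty.
  - apply: aeW => r n /=; rewrite in_itv/= => rt.
    rewrite lee_fin normr_id /s' EP//; case: ifP => [h|_].
      by rewrite (le_trans (ler_normB _ _))//; lra.
    by rewrite subr0 ler_peMl// ler1n.
  by rewrite integral0.
have cv' := (ecvg0P (fun n => L1norm_ge0 t (fun r => f r - s' n r))).1 cv.
have : cvg (simple_integral t (s' n) @[n --> \oo]).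
  apply: cauchy_cvg; apply: cauchy_exP => e e0.
  have e20 : 0 < e / 2 by lra.
  have [N NP] := cv' _ e20.
  exists (simple_integral t (s' N)); exists N => // m /= Nm.
  rewrite -ball_normE /ball_ /=.
  have -> : simple_integral t (s' N) - simple_integral t (s' m) =
      simple_integral t (fun r => (-1) *: s' m r + s' N r).
    by rewrite simple_integral_lin//; vring.
  rewrite -lte_fin (le_lt_trans (norm_simple_integral _ _))//; first exact: simple_lin.
  rewrite (_ : (\int[_]_(_ in _) _)%E = L1norm t (fun r => (f r - s' m r) + (-1) *: (f r - s' N r))); last first.
    by apply: eq_L1norm => r _; vring.
  rewrite (le_lt_trans (L1normD _ _))//; first exact: strongly_measurableZ.
  rewrite (_ : e%:E = ((e / 2)%:E + (e / 2)%:E)%E); last by rewrite -EFinD; congr EFin; lra.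
  rewrite lteD ?NP// (le_lt_trans _ (NP N (leqnn N)))//.
  rewrite -[leRHS]mul1e; apply: le_L1norm => //; first exact: strongly_measurableZ.
  by move=> r _; rewrite scaleN1r normrN mul1r.
move=> /cvg_ex[y sy]; exists y; split=> //; exists s'; split=> //.
Unshelve. all: by end_near. Qed.

End Bochner.

Lemma is_bochner_integral_comp (R : realType) (X Y : completeNormedModType R)
    t (L : X -> Y) (f : R -> X) y : bounded_linear L ->
  is_bochner_integral t f y -> is_bochner_integral t (L \o f) (L y).
Proof.
move=> bL /is_bochner_integralP[mf fs]; apply/is_bochner_integralP.
have cL := continuous_of_bounded_linear bL; have [lL [M M0 LM]] := bL.
split; first exact: strongly_measurable_comp.
move=> e e0; have [s [ss fse sy]] := fs _ (divr_gt0 e0 M0).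
have ssL : simple_function (L \o s) by exact: (simple_map_comp ss L).
exists (L \o s); split=> //.
  apply: (@le_lt_trans _ _ (M%:E * L1norm t (fun r => f r - s r)%R)%E).
    apply: le_L1norm; first exact: ltW.
    - apply: strongly_measurableB; first exact: strongly_measurable_comp.
      exact: simple_strongly_measurable.
    - by apply: strongly_measurableB => //; exact: simple_strongly_measurable.
    - by move=> r _; rewrite /= -linB.
  by rewrite -lte_pdivlMl// -EFinM mulrC.
rewrite simple_integral_linear// -linB// (le_lt_trans (LM _))//.
by rewrite mulrC -ltr_pdivlMr.
Qed.

Section ConeIntegral.
Context {R : realType} {X : completeNormedModType R}.
Local Notation mu := (@lebesgue_measure R).

(* If s is a simple function L^1-close to f, then the distance of s to C is at
   most |f - s| almost everywhere, so the values of s can be moved into C. *)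
Lemma is_bochner_integral_cone t (f : R -> X) y (C : set X) : closed C ->
  convex_cone C -> is_bochner_integral t f y ->
  {ae mu, forall r, 0 <= r <= t -> C (f r)} -> C y.
Proof.
move=> clC cC /is_bochner_integralP[mf fs] fC; apply: closedP => // e e0.
have e30 : 0 < e / 3 by lra.
have [s [ss fse sy]] := fs _ e30.
pose dist z := inf [set `|z - c| | c in C].
have lb z : has_lbound [set `|z - c| | c in C].
  by exists 0 => _ [c _ <-].
have ne z : [set `|z - c| | c in C] !=set0.
  by case: cC => C0 _ _; exists `|z - 0|; exists 0.
have dist0 z : 0 <= dist z.
  by apply: lb_le_inf => // _ [c _ <-].
have distle z c : C c -> dist z <= `|z - c|.
  by move=> Cc; apply: ge_inf => //; exists c.
have sum_dist : \sum_(z <- vals s) mass t (s @^-1` [set z]) * dist z < e / 3.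
  rewrite -lte_fin -(integral_simple_map ss t dist0) (le_lt_trans _ fse)//.
  apply: ae_ge0_le_integral => //.
  - by move=> r _; rewrite lee_fin.
  - by apply/measurable_EFinP; exact: measurable_fun_simple.
  - apply: measurable_enorm; apply: strongly_measurableB => //.
    exact: simple_strongly_measurable.
  - case: fC => N [mN N0 CN]; exists N; split=> // r /= h.
    apply: CN => /= fr; apply: h; rewrite in_itv/= => rt.
    by rewrite lee_fin distrC; apply: distle; exact: fr.
pose M := \sum_(z <- vals s) mass t (s @^-1` [set z]).
have M0 : 0 <= M by apply: sumr_ge0 => z _; exact: mass_ge0.
(* The distance to C need not be attained, so the values are moved into C up to eta; over the total
   mass M this costs at most e / 3. *)
pose eta := e / 3 / (M + 1).
have M1 : 0 < M + 1 by lra.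
have eta0 : 0 < eta by rewrite divr_gt0.
have etaM : M * eta <= e / 3.
  have : (M + 1) * eta = e / 3 by rewrite /eta mulrC divfK// gt_eqF.
  lra.
have /choice[c cP] : forall z, exists c, C c /\ `|z - c| < dist z + eta.
  move=> z; have [_ [c Cc <-] ?] := inf_adherent eta0 (conj (ne z) (lb z)).
  by exists c.
exists (\sum_(z <- vals s) mass t (s @^-1` [set z]) *: c z).
  apply: convex_cone_sum => // z _; case: cC => _ _; apply; first exact: mass_ge0.
  by case: (cP z).
set k := \sum_(z <- _) _ *: c z.
have -> : y - k = - (simple_integral t s - y) + (simple_integral t s - k) by vring.
rewrite (le_lt_trans (ler_normD _ _))// normrN.
have : `|simple_integral t s - k| <= e / 3 + e / 3.
  rewrite simple_integralE// /k -sumrB (le_trans (ler_norm_sum _ _ _))//.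
  apply: (@le_trans _ _ (\sum_(z <- vals s)
    (mass t (s @^-1` [set z]) * dist z + mass t (s @^-1` [set z]) * eta))).
    apply: ler_sum => z _; rewrite -scalerBr normrZ ger0_norm ?mass_ge0//.
    rewrite -mulrDr ler_wpM2l ?mass_ge0//; case: (cP z) => _; exact: ltW.
  by rewrite big_split /= -mulr_suml lerD// ltW.
lra.
Qed.

End ConeIntegral.

(** * Translation of the Lebesgue measure, of integrals and of controls *)

Section Translation.
Context {R : realType}.
Local Notation mu := (@lebesgue_measure R).

Definition trans (c : R) : R -> R := fun x => x - c.

Lemma measurable_trans (c : R) : measurable_fun setT (trans c).
Proof. by apply: measurable_funB => //; exact: measurable_cst. Qed.

Lemma measurable_trans_preimage (c : R) (A : set R) : measurable A ->
  measurable (trans c @^-1` A).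
Proof. by move=> mA; rewrite -[_ @^-1` _]setTI; exact: measurable_trans. Qed.

(** The image measure agrees with the Lebesgue measure on half-open intervals, which determine
    it. *)
Lemma lebesgue_measure_trans (c : R) (A : set R) : measurable A ->
  mu (trans c @^-1` A) = mu A.
Proof.
move=> mA; suff : pushforward mu (trans c : _ -> measurableTypeR R) A = mu A by [].
apply/esym/lebesgue_measure_unique => //=; first exact: measurable_trans.
move=> _ _ [[a b]] _ <-.
rewrite /pushforward (_ : trans c @^-1` _ = `]a + c, b + c]%classic); last first.
  by apply/seteqP; split=> x /=; rewrite !in_itv/= /trans ltrBrDr lerBlDr.
rewrite !lebesgue_measure_itv/= !lte_fin ltrD2r -!EFinD.
by case: ifP => // _; congr EFin; ring.
Qed.

Lemma ge0_integral_trans (c : R) (D : set R) (h : R -> \bar R) : measurable D ->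
  measurable_fun D h -> (forall x, D x -> 0 <= h x)%E ->
  (\int[mu]_(x in trans c @^-1` D) h (trans c x) = \int[mu]_(x in D) h x)%E.
Proof.
move=> mD mh h0.
have h0' : {in D, forall x, (0 <= h x)%E} by move=> x /set_mem; exact: h0.
have := @ge0_integral_pushforward _ _ (measurableTypeR R) (measurableTypeR R) R (trans c)
  (measurable_trans c) mu D h mD mh h0'.
move=> <-; apply: eq_measure_integral => [|? A mA _]; first exact: measurable_trans.
exact: lebesgue_measure_trans.
Qed.

Lemma ae_trans (c : R) (P : R -> Prop) : {ae mu, forall x, P x} ->
  {ae mu, forall x, P (trans c x)}.
Proof.
move=> [N [mN N0 PN]]; exists (trans c @^-1` N); split.
- exact: measurable_trans_preimage.
- by rewrite lebesgue_measure_trans.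
- by move=> x /= h; apply: PN.
Qed.

End Translation.

Section Shift.
Context {R : realType} {X : completeNormedModType R}.
Local Notation mu := (@lebesgue_measure R).
Implicit Types (f s : R -> X) (t c : R).

(** Positive c delays a control, c = 0 extends it by zero outside [0, t], and negative c extracts
    its later part. *)
Definition ext_shift t c f : R -> X :=
  fun r => if 0 <= r - c <= t then f (r - c) else 0.

Lemma ext_shiftE t c f : ext_shift t c f =
  fun r => if r \in trans c @^-1` `[0, t] then (f \o trans c) r else 0.
Proof.
apply/funext => r; rewrite /ext_shift; congr (if _ then _ else _).
by apply/idP/idP => [h|/set_mem]; [apply/mem_set|]; rewrite /= in_itv.
Qed.

Lemma simple_shift t c s : simple_function s -> simple_function (ext_shift t c s).
Proof.
move=> ss; rewrite ext_shiftE; apply: simple_restrict.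
  exact: measurable_trans_preimage.
split=> [|x].
  by apply: (sub_finite_set _ ss.1) => _ [r _ <-]; exists (trans c r).
by rewrite comp_preimage; apply: measurable_trans_preimage; exact: ss.2.
Qed.

Lemma strongly_measurable_shift t t' c f : strongly_measurable t f ->
  strongly_measurable t' (ext_shift t c f).
Proof.
move=> [s ss sf]; exists (fun n => ext_shift t c (s n)).
  by move=> n; exact: simple_shift.
move=> r _; rewrite /ext_shift; case: ifP => [rt|_]; [exact: sf|exact: cvg_cst].
Qed.

(** The function phi stands for the norm or for one of its powers. Only an inequality holds, since
    the translate of [0, t] may stick out of [0, t']. *)
Lemma integral_shift t t' c f (phi : X -> R) : (forall x, 0 <= phi x) ->
  phi 0 = 0 -> measurable_fun `[0, t] (fun r => phi (f r)) ->
  (\int[mu]_(r in `[0%R, t']) (phi (ext_shift t c f r))%:E <=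
   \int[mu]_(r in `[0%R, t]) (phi (f r))%:E)%E.
Proof.
move=> phi0 phi00 mf; pose D := trans c @^-1` `[0, t].
have mD : measurable D by exact: measurable_trans_preimage.
have mh : measurable_fun `[0, t] (fun r => (phi (f r))%:E) by exact/measurable_EFinP.
have mhD : measurable_fun D ((fun r => (phi (f r))%:E) \o trans c).
  apply: (@measurable_comp _ _ _ _ _ _ `[0, t]) => //.
  - by move=> _ [r Dr <-].
  - by apply: measurable_funTS; exact: measurable_trans.
rewrite -[leRHS](@ge0_integral_trans _ c)//; last by move=> r _; rewrite lee_fin.
rewrite (_ : (\int[_]_(_ in _) _)%E = (\int[mu]_(r in `[0%R, t'] `&` D) (phi (f (trans c r)))%:E)%E).
  by apply: ge0_subset_integral => //; [exact: measurableI|move=> r _; rewrite lee_fin].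
rewrite [LHS]integral_mkcond [RHS]integral_mkcond; apply: eq_integral => r _.
rewrite ext_shiftE /patch in_setI; case: ifP => //= _; case: ifP => // _.
by rewrite phi00.
Qed.

Lemma L1norm_shift t t' c f : strongly_measurable t f -> 0 <= c -> c + t <= t' ->
  (L1norm t' (ext_shift t c f) <= L1norm t f)%E.
Proof.
move=> mf c0 ct; apply: (@integral_shift t t' c f (fun x => `|x|)).
- by [].
- exact: normr0.
- exact: measurable_norm.
Qed.

Lemma simple_integral_shift t t' c s : simple_function s -> 0 <= c ->
  c + t <= t' -> simple_integral t' (ext_shift t c s) = simple_integral t s.
Proof.
move=> ss c0 ct; apply: eq_fsbigr => x _.
(* The extension by zero changes the level set of the value 0, whose contribution vanishes; the
   other level sets are translated. *)
have [->|x0] := eqVneq x 0; first by rewrite !scaler0.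
congr (fine _ *: _).
rewrite -(@lebesgue_measure_trans _ c (`[0, t] `&` _)); last first.
  by apply: measurableI => //; exact: ss.2.
congr (mu _); apply/seteqP; split=> r /=; rewrite !in_itv/= /ext_shift /trans.
  move=> [_]; case: ifP => // _ x0'; by move: x0; rewrite -x0' eqxx.
by move=> [rt ->]; rewrite rt; split=> //; lra.
Qed.

Lemma is_bochner_integral_shift t t' c f y : 0 <= c -> c + t <= t' ->
  is_bochner_integral t f y -> is_bochner_integral t' (ext_shift t c f) y.
Proof.
move=> c0 ct /is_bochner_integralP[mf fs]; apply/is_bochner_integralP.
split; first exact: strongly_measurable_shift.
move=> e e0; have [s [ss fse sy]] := fs e e0; exists (ext_shift t c s).
split; [exact: simple_shift| |by rewrite simple_integral_shift].
rewrite (@eq_L1norm _ _ _ _ (ext_shift t c (fun r => f r - s r))).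
  rewrite (le_lt_trans _ fse)// L1norm_shift//.
  by apply: strongly_measurableB => //; exact: simple_strongly_measurable.
by move=> r _; rewrite /ext_shift; case: ifP => _; rewrite ?subrr.
Qed.

End Shift.

(** * Lebesgue spaces *)

Section AlmostEverywhere.
Context {R : realType}.
Local Notation mu := (@lebesgue_measure R).

Lemma ae_impl (P Q : R -> Prop) : (forall x, P x -> Q x) ->
  {ae mu, forall x, P x} -> {ae mu, forall x, Q x}.
Proof.
move=> PQ [N [mN N0 PN]]; exists N; split=> // x /= nQ.
by apply: PN => /= /PQ.
Qed.

Lemma ae_and (P Q : R -> Prop) : {ae mu, forall x, P x} ->
  {ae mu, forall x, Q x} -> {ae mu, forall x, P x /\ Q x}.
Proof.
move=> [N [mN N0 PN]] [M [mM M0 QM]]; exists (N `|` M); split.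
- exact: measurableU.
- exact: null_set_setU.
- move=> x /= /not_andP[nP|nQ]; [left; exact: PN|right; exact: QM].
Qed.

Lemma ae_all (P : R -> Prop) : (forall x, P x) -> {ae mu, forall x, P x}.
Proof.
move=> aP; exists set0; split; [by []|exact: measure0|by move=> x /= /(_ (aP x))].
Qed.

End AlmostEverywhere.

Section Lp.
Context {R : realType} {U : completeNormedModType R}.
Local Notation mu := (@lebesgue_measure R).
Implicit Types (u v : R -> U) (t : R) (p : \bar R).

Lemma Lp_finP (V : completeNormedModType R) (r t : R) (u : R -> V) : 1 <= r -> Lp r%:E t u <->
  strongly_measurable t u /\
  (\int[mu]_(x in `[0%R, t]) (`|u x| `^ r)%:E < +oo)%E.
Proof.
move=> r1; have r0 : r != 0 by rewrite gt_eqF//; lra.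
suff E : Lnorm mu r%:E ((fun x => `|u x|%:E) \_ `[0, t]) =
    poweR (\int[mu]_(x in `[0%R, t]) (`|u x| `^ r)%:E)%E r^-1.
  rewrite /Lp /= E; split=> -[mu_ h]; split=> //.
    by apply: lty_poweRy h; rewrite invr_neq0.
  exact: poweR_lty.
rewrite unlock; congr (poweR _ _); rewrite [RHS]integral_mkcond.
apply: eq_integral => x _; rewrite /patch; case: ifP => _ /=.
  by rewrite normr_id.
by rewrite normr0 powR0.
Qed.

Lemma Lp_inftyP (V : completeNormedModType R) t (u : R -> V) : Lp +oo t u <->
  strongly_measurable t u /\ exists2 C : R, 0 <= C &
    {ae mu, forall x, 0 <= x <= t -> `|u x| <= C}.
Proof.
(* The norm at [+oo] is an essential supremum only when the whole space has positive measure. *)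
have mu0 : (0 < mu [set: R])%E.
  apply: (@lt_le_trans _ _ (mu `[0%R, 1%R])); last by apply: le_measure; rewrite ?inE.
  by rewrite lebesgue_measure_itv/= lte_fin ltr01 -EFinB subr0 lte_fin.
pose g x := if x \in `[0, t]%classic then `|u x| else 0.
have gE : abse \o ((fun x => `|u x|%:E) \_ `[0, t]) = EFin \o g.
  apply/funext => x; rewrite /g /patch /=; case: ifP => _ /=.
    by rewrite normr_id.
  by rewrite normr0.
have It x : (x \in `[0, t]%classic) = (0 <= x <= t).
  by apply/idP/idP => [/set_mem|h]; [|apply/mem_set]; rewrite /= in_itv.
rewrite /Lp /= unlock mu0 gE; split=> -[mu_ h]; split=> //.
  have [M MP] := ess_supr_bounded h; exists `|M| => //.
  case: MP => N [mN N0 MN]; exists N; split=> // x /= hx; apply: MN => /= gM.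
  apply: hx => xt; move: gM; rewrite /g It xt => /le_trans; apply; exact: ler_norm.
case: h => C C0 CP; apply: (@le_lt_trans _ _ C%:E); last exact: ltry.
apply/ess_supP; case: CP => N [mN N0 CN]; exists N; split=> // x /= hx.
apply: CN => /= hC; apply: hx; rewrite lee_fin /g It.
by case: ifP => // /hC.
Qed.

Lemma le_Lp (V : completeNormedModType R) p t (C : R) (v : R -> V) u : (1 <= p)%E -> 0 <= C ->
  strongly_measurable t v -> (forall x, 0 <= x <= t -> `|v x| <= C * `|u x|) ->
  Lp p t u -> Lp p t v.
Proof.
case: p => [r| |//].
  rewrite lee_fin => r1 C0 mv vu /(Lp_finP _ _ r1)[mu_ ui].
  have r0 : 0 <= r by lra.
  apply/(Lp_finP _ _ r1); split; first exact: mv.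
  have mpow (W : completeNormedModType R) (w : R -> W) : strongly_measurable t w ->
      measurable_fun `[0, t] (fun x => (`|w x| `^ r)%:E).
    move=> mw; apply/measurable_EFinP.
    by apply: (@measurableT_comp _ _ _ _ _ _ (@powR R ^~ r)) => //; exact: measurable_norm.
  apply: (@le_lt_trans _ _ (\int[mu]_(x in `[0%R, t])
    ((C `^ r)%:E * (`|u x| `^ r)%:E))%E).
    apply: ge0_le_integral => //.
    - exact: mpow.
    - by apply: measurable_funeM; exact: mpow.
    - move=> x /=; rewrite in_itv/= => /vu vxu; rewrite -EFinM lee_fin -powRM//.
      by apply: ge0_ler_powR; rewrite ?nnegrE ?mulr_ge0.
  rewrite ge0_integralZl_EFin ?powR_ge0//; last exact: mpow.
  by rewrite lte_mul_pinfty ?lee_fin ?powR_ge0.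
move=> _ C0 mv vu /Lp_inftyP[mu_ [D D0 uD]]; apply/Lp_inftyP; split=> //.
exists (C * D); first exact: mulr_ge0.
apply: ae_impl uD => x uD xt.
by rewrite (le_trans (vu _ xt))// ler_wpM2l// uD.
Qed.

(** Only finiteness is at stake, so for finite p it is enough to bound the norm of u + v by twice
    the larger of the two norms. *)
Lemma Lp_add p t u v : (1 <= p)%E -> Lp p t u -> Lp p t v ->
  Lp p t (fun x => u x + v x).
Proof.
case: p => [r| |//].
  rewrite lee_fin => r1 /(Lp_finP _ _ r1)[mu_ ui] /(Lp_finP _ _ r1)[mv vi].
  apply/(Lp_finP _ _ r1); split; first exact: strongly_measurableD.
  have r0 : 0 <= r by lra.
  have mpow w : strongly_measurable t w ->
      measurable_fun `[0, t] (fun x => (`|w x| `^ r)%:E).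
    move=> mw; apply/measurable_EFinP.
    by apply: (@measurableT_comp _ _ _ _ _ _ (@powR R ^~ r)) => //; exact: measurable_norm.
  apply: (@le_lt_trans _ _ (\int[mu]_(x in `[0%R, t])
    (((2 `^ r)%:E * (`|u x| `^ r)%:E) + ((2 `^ r)%:E * (`|v x| `^ r)%:E)))%E).
    apply: ge0_le_integral => //.
    - by apply: mpow; exact: strongly_measurableD.
    - by apply: emeasurable_funD; apply: measurable_funeM; exact: mpow.
    - move=> x _; rewrite -!EFinM -EFinD lee_fin -!powRM//.
      have [uv|vu] := leP (`|u x|) (`|v x|).
        apply: (@le_trans _ _ ((2 * `|v x|) `^ r)); last by rewrite lerDr powR_ge0.
        apply: ge0_ler_powR; rewrite ?nnegrE ?mulr_ge0//.
        by rewrite (le_trans (ler_normD _ _))//; lra.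
      apply: (@le_trans _ _ ((2 * `|u x|) `^ r)); last by rewrite lerDl powR_ge0.
      apply: ge0_ler_powR; rewrite ?nnegrE ?mulr_ge0//.
      by rewrite (le_trans (ler_normD _ _))//; lra.
  rewrite ge0_integralD//; [|by apply: measurable_funeM; exact: mpow..].
  rewrite !ge0_integralZl_EFin ?powR_ge0//; [|exact: mpow..].
  apply: lte_add_pinfty.
    by apply: lte_mul_pinfty; [rewrite lee_fin powR_ge0| |exact: ui].
  by apply: lte_mul_pinfty; [rewrite lee_fin powR_ge0| |exact: vi].
move=> _ /Lp_inftyP[mu_ [C C0 uC]] /Lp_inftyP[mv [D D0 vD]].
apply/Lp_inftyP; split; first exact: strongly_measurableD.
exists (C + D); first exact: addr_ge0.
apply: ae_impl (ae_and uC vD) => x [{}uC {}vD] xt.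
by rewrite (le_trans (ler_normD _ _))// lerD ?uC ?vD.
Qed.

Lemma Lp_shift p t t' c u : (1 <= p)%E -> Lp p t u -> Lp p t' (ext_shift t c u).
Proof.
case: p => [r| |//].
  rewrite lee_fin => r1 /(Lp_finP _ _ r1)[mu_ ui].
  apply/(Lp_finP _ _ r1); split; first exact: strongly_measurable_shift mu_.
  apply: le_lt_trans ui; apply: (@integral_shift _ _ t t' c u (fun x => `|x| `^ r)).
  - by move=> x; exact: powR_ge0.
  - by rewrite normr0 powR0// gt_eqF//; lra.
  - by apply: (@measurableT_comp _ _ _ _ _ _ (@powR R ^~ r)) => //; exact: measurable_norm.
move=> _ /Lp_inftyP[mu_ [C C0 uC]].
apply/Lp_inftyP; split; first exact: strongly_measurable_shift mu_.
exists C => //; have := @ae_trans _ c _ uC; apply: ae_impl => x uC' _.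
by rewrite /ext_shift; case: ifP => [/uC'//|_]; rewrite normr0.
Qed.

(** The interval has finite measure, and a norm is at most 1 plus its r-th power when r >= 1. *)
Lemma Lp_L1norm p t u : (1 <= p)%E -> Lp p t u -> (L1norm t u < +oo)%E.
Proof.
have It : (mu `[0%R, t] < +oo)%E.
  by have := @lebesgue_itv_fin _ t setT measurableT; rewrite setIT.
case: p => [r| |//].
  rewrite lee_fin => r1 /(Lp_finP _ _ r1)[mu_ ui].
  have mpow : measurable_fun `[0, t] (fun x => (`|u x| `^ r)%:E).
    apply/measurable_EFinP.
    by apply: (@measurableT_comp _ _ _ _ _ _ (@powR R ^~ r)) => //; exact: measurable_norm.
  apply: (@le_lt_trans _ _ (\int[mu]_(x in `[0%R, t]) (1%:E + (`|u x| `^ r)%:E))%E).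
    apply: ge0_le_integral => //; first exact: measurable_enorm.
    - by apply: emeasurable_funD.
    - move=> x _; rewrite -EFinD lee_fin.
      have [u1|u1] := leP (`|u x|) 1.
        by rewrite (le_trans u1)// lerDl powR_ge0.
      by rewrite (le_trans (le1r_powR (ltW u1) r1))// lerDr.
  rewrite ge0_integralD// integral_cst// mul1e.
  by apply: lte_add_pinfty; [exact: It|exact: ui].
move=> _ /Lp_inftyP[mu_ [C C0 uC]].
apply: (@le_lt_trans _ _ (\int[mu]_(x in `[0%R, t]) C%:E)%E).
  apply: ae_ge0_le_integral => //; first exact: measurable_enorm.
by rewrite integral_cst// lte_mul_pinfty.
Qed.

Lemma bounded_Lp p t (C : R) u : (1 <= p)%E -> strongly_measurable t u ->
  (forall x, 0 <= x <= t -> `|u x| <= C) -> Lp p t u.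
Proof.
have It : (mu `[0%R, t] < +oo)%E.
  by have := @lebesgue_itv_fin _ t setT measurableT; rewrite setIT.
case: p => [r| |//].
  rewrite lee_fin => r1 mu_ uC.
  apply/(Lp_finP _ _ r1); split; first exact: mu_.
  apply: (@le_lt_trans _ _ (\int[mu]_(x in `[0%R, t]) (`|C| `^ r)%:E)%E).
    apply: ge0_le_integral => //.
    - apply/measurable_EFinP.
      by apply: (@measurableT_comp _ _ _ _ _ _ (@powR R ^~ r)) => //; exact: measurable_norm.
    - move=> x /=; rewrite in_itv/= => /uC uxC; rewrite lee_fin.
      apply: ge0_ler_powR; rewrite ?nnegrE//; first lra.
      by rewrite (le_trans uxC)// ler_norm.
  by rewrite integral_cst// lte_mul_pinfty// lee_fin powR_ge0.
move=> _ mu_ uC; apply/Lp_inftyP; split=> //; exists `|C| => //.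
by apply: ae_all => x /uC /le_trans; apply; exact: ler_norm.
Qed.

End Lp.

(** * Semigroups and resolvents *)

Section RightDerivatives.
Context {R : realType}.

(** From e^y >= 1 + y at y and at - y, the difference e^y - 1 - y lies between 0 and 2 y^2 when y
    has absolute value at most 1/2. *)
Lemma expR_quot (a : R) : h^-1 * (expR (a * h) - 1) @[h --> 0^'+] --> a.
Proof.
apply/cvg_right0P => e e0.
have a20 : 0 <= a ^+ 2 by exact: sqr_ge0.
(* Below [d1], a h has absolute value at most 1/2; below [d2], 2 (a h)^2 is less than e h. *)
pose d1 := (2 * (`|a| + 1))^-1; pose d2 := e / (2 * a ^+ 2 + 1).
have a1 : 0 < 2 * (`|a| + 1) by have := normr_ge0 a; lra.
have d10 : 0 < d1 by rewrite invr_gt0.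
have d20 : 0 < d2 by rewrite divr_gt0//; lra.
exists (Num.min d1 d2); first by rewrite lt_min d10.
move=> h /andP[h0]; rewrite lt_min => /andP[hd1 hd2].
have ah : `|a * h| <= 2^-1.
  rewrite normrM (gtr0_norm h0).
  have : h * (2 * (`|a| + 1)) < 1.
    by rewrite -[ltRHS](mulVf (lt0r_neq0 a1)) ltr_pM2r.
  by have := normr_ge0 a; nra.
have ahe : 2 * (a * h) ^+ 2 < e * h.
  have : h * (2 * a ^+ 2 + 1) < e.
    rewrite -[ltRHS](@divfK _ (2 * a ^+ 2 + 1)) ?gt_eqF//; last lra.
    by rewrite ltr_pM2r//; lra.
  nra.
rewrite -(ltr_pM2l h0) -{1}(gtr0_norm h0) -normrM mulrBr mulrA divff ?gt_eqF// mul1r.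
rewrite [h * a]mulrC (mulrC h e).
move: (a * h) ah ahe => y; rewrite ler_norml => /andP[y1 y2] ye.
have ey := expR_ge1Dx y; have eny := expR_ge1Dx (- y).
have : expR y * expR (- y) = 1 by rewrite -expRD subrr expR0.
have := expR_gt0 y.
rewrite ltr_norml => e1 e2; apply/andP; split; first by nra.
have : expR y * (1 - y) <= 1 by nra.
nra.
Qed.

Lemma right_deriv_expR (a s : R) :
  h^-1 *: (expR (a * (s + h)) - expR (a * s)) @[h --> 0^'+] --> a * expR (a * s).
Proof.
have -> : (fun h => h^-1 *: (expR (a * (s + h)) - expR (a * s))) =
   (fun h => h^-1 * (expR (a * h) - 1) * expR (a * s)).
  by apply/funext => h; rewrite mulrDr expRD -[_ *: _]/(_ * _); ring.
by apply: cvgMl; exact: expR_quot.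
Qed.

Context {V : normedModType R}.

Lemma cvg_shift_right (c : R -> V) (s : R) : {for s, continuous c} ->
  c (s + h) @[h --> 0^'+] --> c s.
Proof.
move=> /cvgrPdist_lt cs; apply/cvg_right0P => e /cs /nbhs_ballP[d /= d0 dP].
exists d => // h /andP[h0 hd]; rewrite distrC; apply: dP.
by rewrite -ball_normE /ball_ /= opprD addrA subrr sub0r normrN gtr0_norm.
Qed.

Lemma cvg_shift_left (c : R -> V) (s : R) : {for s, continuous c} ->
  c (s - h) @[h --> 0^'+] --> c s.
Proof.
move=> /cvgrPdist_lt cs; apply/cvg_right0P => e /cs /nbhs_ballP[d /= d0 dP].
exists d => // h /andP[h0 hd]; rewrite distrC; apply: dP.
by rewrite -ball_normE /ball_ /= subKr gtr0_norm.
Qed.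

Lemma right_derivZ (c : R -> R) (v : R -> V) (c' : R) (v' : V) (s : R) :
  h^-1 *: (c (s + h) - c s) @[h --> 0^'+] --> c' ->
  c (s + h) @[h --> 0^'+] --> c s ->
  h^-1 *: (v (s + h) - v s) @[h --> 0^'+] --> v' ->
  h^-1 *: (c (s + h) *: v (s + h) - c s *: v s) @[h --> 0^'+] -->
    c s *: v' + c' *: v s.
Proof.
move=> dc cc dv.
have -> : (fun h => h^-1 *: (c (s + h) *: v (s + h) - c s *: v s)) =
  (fun h => c (s + h) *: (h^-1 *: (v (s + h) - v s)) +
            (h^-1 *: (c (s + h) - c s)) *: v s).
  by apply/funext => h; rewrite -[_^-1 *: (c _ - _)]/(_ * _); vring.
by apply: cvgD; [exact: cvgZ|apply: cvgZ => //; exact: cvg_cst].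
Qed.

Lemma continuous_expRM (a : R) : continuous (fun s => expR (a * s)).
Proof.
move=> s; apply: continuous_comp; last exact: continuous_expR.
by apply: cvgMr; exact: cvg_id.
Qed.

End RightDerivatives.

Section SemigroupBounds.
Context {R : realType} {X : completeNormedModType R}.
Variable T : R -> {linear X -> X}.
Hypothesis hT : C0_semigroup T.

Let T0 x : T 0 x = x. Proof. by case: hT. Qed.

Let TD s t x : 0 <= s -> 0 <= t -> T (s + t) x = T s (T t x).
Proof. by case: hT => _ _ + _; apply. Qed.

Let Tr x : T h x @[h --> 0^'+] --> x. Proof. by case: hT. Qed.

Lemma semigroup_bounded_linear t : 0 <= t -> bounded_linear (T t).
Proof.
move=> t0; apply: continuous_bounded_linear; last by case: hT => + _ _ _; exact.
by move=> a x y; rewrite linearP.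
Qed.

(** Otherwise there are times tending to 0 at which the operators have unbounded norms, although
    they are pointwise bounded by right continuity at 0; this contradicts uniform boundedness. *)
Lemma semigroup_bound_near0 : exists2 d : R, 0 < d &
  exists2 M : R, 1 <= M & forall h x, 0 <= h <= d -> `|T h x| <= M * `|x|.
Proof.
apply: contrapT => nb.
have /choice[u uP] : forall n : nat, exists hx : R * X,
    0 <= hx.1 <= n.+1%:R^-1 /\ n.+1%:R * `|hx.2| < `|T hx.1 hx.2|.
  move=> n; apply: contrapT => nn; apply: nb.
  exists n.+1%:R^-1; first by rewrite invr_gt0.
  exists n.+1%:R; first by rewrite ler1n.
  move=> h x hn; rewrite leNgt; apply/negP => nx; apply: nn.
  by exists (h, x).
have [|x|M M0 MP] := @uniform_boundedness _ _ _ nat (fun n => T (u n).1).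
- by move=> n; apply: semigroup_bounded_linear; case: (uP n) => /andP[].
- have /cvg_right0P/(_ 1 ltr01)[d d0 dP] := @Tr x.
  have /cvg_seqP/(_ d d0)[N NP] := @cvg_harmonic R.
  (* The first two terms bound the late times, where the orbit is within 1 of x; the sum covers the
     first N times. *)
  exists (`|x| + 1 + \sum_(n < N) `|T (u n).1 x|) => n.
  have [Nn|nN] := leqP N n; last first.
    by rewrite (bigD1 (Ordinal nN))//= addrCA lerDl !addr_ge0// sumr_ge0.
  have s0 : 0 <= \sum_(n < N) `|T (u n).1 x| by exact: sumr_ge0.
  have [u0|u0] := eqVneq (u n).1 0; first by rewrite u0 T0; lra.
  have : `|T (u n).1 x - x| < 1.
    case: (uP n) => /andP[un0 un] _; apply: dP; rewrite lt_neqAle eq_sym u0 un0/=.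
    rewrite (le_lt_trans un)//; have := NP n Nn.
    by rewrite /harmonic subr0; exact: le_lt_trans (ler_norm _).
  have := ler_normD (T (u n).1 x - x) x; rewrite subrK; lra.
- have [_] := uP (Num.truncn M); apply/negP; rewrite -leNgt (le_trans (MP _ _))//.
  by rewrite ler_wpM2r// ltW// truncnS_gt.
Qed.

Lemma semigroup_exp_bound : exists2 M : R, 0 < M & exists w : R,
  forall t x, 0 <= t -> `|T t x| <= M * expR (w * t) * `|x|.
Proof.
have [d d0 [M M1 MP]] := semigroup_bound_near0.
have M0 : 0 < M by lra.
(* The exponent is chosen so that e^(w d) = M: each further interval of length d costs one factor
   M. *)
exists M => //; exists (ln M / d) => t x t0.
have w0 : 0 <= ln M / d by rewrite divr_ge0 ?ln_ge0// ltW.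
have Mw : expR (ln M / d * d) = M by rewrite divfK ?gt_eqF// lnK.
suff : forall n t, 0 <= t <= n.+1%:R * d -> `|T t x| <= M * expR (ln M / d * t) * `|x|.
  move=> /(_ (Num.truncn (t / d))); apply; rewrite t0 /=.
  by rewrite -ler_pdivrMr// ltW// truncnS_gt.
elim=> {t t0}[|n IH] t /andP[t0 tn].
  rewrite (le_trans (MP _ _ _)) ?t0//; first by rewrite mul1r in tn.
  rewrite ler_wpM2r// ler_peMr//; first lra.
  by rewrite -expR0 ler_expR mulr_ge0.
have [td|dt] := leP t d.
  rewrite (le_trans (MP _ _ _)) ?t0//.
  rewrite ler_wpM2r// ler_peMr//; first lra.
  by rewrite -expR0 ler_expR mulr_ge0.
have tE : t = d + (t - d) by rewrite addrC subrK.
rewrite {1}tE TD ?(ltW d0) ?subr_ge0 ?(ltW dt)//.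
rewrite (le_trans (MP _ _ _)) ?lexx ?(ltW d0)//.
have -> : M * expR (ln M / d * t) * `|x| = M * (M * expR (ln M / d * (t - d)) * `|x|).
  by rewrite {1}tE mulrDr expRD Mw; ring.
rewrite ler_pM2l//; apply: IH; rewrite subr_ge0 (ltW dt) /=.
by rewrite lerBlDr -[X in _ + X]mul1r -mulrDl natr1.
Qed.

Lemma growth_bound_lty : exists w : R, (growth_bound T < w%:E)%E.
Proof.
have [M M0 [w wP]] := semigroup_exp_bound; exists (w + 1).
apply: (@le_lt_trans _ _ w%:E); last by rewrite lte_fin; lra.
by apply: ereal_inf_lbound; exists w => //; exists M.
Qed.

Lemma growth_boundP (l : R) : (growth_bound T < l%:E)%E ->
  exists w, w < l /\ exists2 M : R, 0 < M &
    forall t x, 0 <= t -> `|T t x| <= M * expR (w * t) * `|x|.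
Proof.
move=> /ereal_inf_lt[_ [w [M MP] <-]]; rewrite lte_fin => wl; exists w; split=> //.
exists (`|M| + 1) => [|t x t0]; first by have := normr_ge0 M; lra.
rewrite (le_trans (MP t x t0))// ler_wpM2r// ler_pM2r ?expR_gt0//.
by have := ler_norm M; lra.
Qed.

Lemma semigroup_local_bound t : exists2 K : R, 0 < K &
  forall s x, 0 <= s <= t -> `|T s x| <= K * `|x|.
Proof.
have [M M0 [w wP]] := semigroup_exp_bound; exists (M * expR (`|w| * `|t|)).
  by rewrite mulr_gt0 ?expR_gt0.
move=> s x /andP[s0 st]; rewrite (le_trans (wP _ _ s0))// ler_wpM2r//.
rewrite ler_pM2l// ler_expR (le_trans (ler_norm _))// normrM ler_wpM2l//.
by rewrite ger0_norm// (le_trans st)// ler_norm.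
Qed.

Lemma semigroup_cvg_right s x : 0 <= s -> T (s + h) x @[h --> 0^'+] --> T s x.
Proof.
move=> s0; have [ls [K K0 KP]] := semigroup_bounded_linear s0.
apply/cvg_right0P => e e0.
have /cvg_right0P/(_ _ (divr_gt0 e0 K0))[d d0 dP] := @Tr x.
exists d => // h hd; have /andP[h0 _] := hd.
rewrite TD ?(ltW h0)// -linearB (le_lt_trans (KP _))//.
by rewrite mulrC -ltr_pdivlMr//; exact: dP.
Qed.

Lemma semigroup_cvg_left s x : 0 < s -> T (s - h) x @[h --> 0^'+] --> T s x.
Proof.
move=> s0; have [K K0 KP] := semigroup_local_bound s.
apply/cvg_right0P => e e0.
have /cvg_right0P/(_ _ (divr_gt0 e0 K0))[d d0 dP] := @Tr x.
exists (Num.min d s) => [|h]; first by rewrite lt_min d0.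
rewrite lt_min => /and3P[h0 hd hs].
have sh : 0 <= s - h by rewrite subr_ge0 ltW.
have -> : T s x = T (s - h) (T h x) by rewrite -TD ?subrK// ltW.
rewrite -linearB (le_lt_trans (KP _ _ _))//.
  by rewrite sh /=; lra.
by rewrite mulrC -ltr_pdivlMr// distrC; apply: dP; rewrite h0.
Qed.

End SemigroupBounds.

(** The two-sided inverse equations, so that later arguments never unfold the choice made by
    [resolvent]. *)
Definition is_resolvent (R : realType) (X : completeNormedModType R)
    (D : set X) (A : X -> X) (l : R) (L : X -> X) : Prop :=
  [/\ bounded_linear L, forall y, D (L y) /\ l *: L y - A (L y) = y
    & forall x, D x -> L (l *: x - A x) = x].

Lemma eq_cvg_right0 (R : realType) (V : normedModType R) (f g : R -> V) (l m : V) :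
  (forall h, 0 < h -> f h = g h) -> l = m ->
  f h @[h --> 0^'+] --> l -> g h @[h --> 0^'+] --> m.
Proof.
move=> fg <- /cvg_right0P fl; apply/cvg_right0P => e /fl[d d0 dP].
by exists d => // h /[dup] /andP[h0 _] /dP; rewrite fg.
Qed.

Lemma cvg_right0Z (R : realType) (V : normedModType R) (f : R -> V) (l : V) (a : R) :
  f h @[h --> 0^'+] --> l -> a *: f h @[h --> 0^'+] --> a *: l.
Proof. by move=> fl; apply: cvgZ => //; exact: cvg_cst. Qed.

Lemma cvg_right0_pair (R : realType) (V W : normedModType R) (f : R -> V * W) (z : V * W) :
  (f h).1 @[h --> 0^'+] --> z.1 -> (f h).2 @[h --> 0^'+] --> z.2 ->
  f h @[h --> 0^'+] --> z.
Proof.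
move=> /cvg_right0P f1 /cvg_right0P f2; apply/cvg_right0P => e e0.
have [d d0 dP] := f1 e e0; have [d' d'0 d'P] := f2 e e0.
exists (Num.min d d') => [|h]; first by rewrite lt_min d0.
rewrite lt_min => /and3P[h0 hd hd']; rewrite prod_normE gt_max.
by rewrite dP ?h0// d'P// h0.
Qed.

Arguments cvg_right0Z {R V f l} a _.

Section Generator.
Context {R : realType} {X : completeNormedModType R}.
Variables (T : R -> {linear X -> X}) (D : set X) (A : X -> X).
Hypothesis hT : C0_semigroup T.
Hypothesis gA : is_generator T D A.
Local Notation is_resolvent := (is_resolvent D A).

Let T0 x : T 0 x = x. Proof. by case: hT. Qed.

Let TD s t x : 0 <= s -> 0 <= t -> T (s + t) x = T s (T t x).
Proof. by case: hT => _ _ + _; apply. Qed.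

Let TC s t x : 0 <= s -> 0 <= t -> T s (T t x) = T t (T s x).
Proof. by move=> s0 t0; rewrite -!TD// addrC. Qed.

Lemma generator_cvg x : D x -> h^-1 *: (T h x - x) @[h --> 0^'+] --> A x.
Proof. by move=> Dx; apply/gA. Qed.

Lemma generator_lin a x y : D x -> D y ->
  D (a *: x + y) /\ A (a *: x + y) = a *: A x + A y.
Proof.
move=> Dx Dy; apply/gA.
have -> : (fun h => h^-1 *: (T h (a *: x + y) - (a *: x + y))) =
  (fun h => a *: (h^-1 *: (T h x - x)) + h^-1 *: (T h y - y)).
  by apply/funext => h; rewrite linearP; vring.
by apply: cvgD; [apply: cvgZ; [exact: cvg_cst|]|]; exact: generator_cvg.
Qed.

Lemma generator0 : D 0 /\ A 0 = 0.
Proof.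
apply/gA; have -> : (fun h => h^-1 *: (T h 0 - 0)) = fun=> 0.
  by apply/funext => h; rewrite linear0 subr0 scaler0.
exact: cvg_cst.
Qed.

Lemma generatorZ a x : D x -> D (a *: x) /\ A (a *: x) = a *: A x.
Proof.
move=> Dx; have [D0 A0] := generator0.
by have := generator_lin a Dx D0; rewrite A0 !addr0.
Qed.

Lemma generatorD x y : D x -> D y -> D (x + y) /\ A (x + y) = A x + A y.
Proof. by move=> Dx Dy; have := generator_lin 1 Dx Dy; rewrite !scale1r. Qed.

Lemma generatorB x y : D x -> D y -> D (x - y) /\ A (x - y) = A x - A y.
Proof.
move=> Dx Dy; have := generator_lin (-1) Dy Dx.
by rewrite !scaleN1r addrC [_ + A x]addrC.
Qed.

Lemma generator_semigroup s x : 0 <= s -> D x ->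
  D (T s x) /\ A (T s x) = T s (A x).
Proof.
move=> s0 Dx; apply/gA.
have cT : continuous (T s) by case: hT => + _ _ _; exact.
have Tq : T s (h^-1 *: (T h x - x)) @[h --> 0^'+] --> T s (A x).
  by apply: continuous_cvg; [exact: cT|exact: generator_cvg].
apply: eq_cvg_right0 Tq => // h h0.
by rewrite linearZ linearB /= TC// ltW.
Qed.

Lemma orbit_right_deriv s x : 0 <= s -> D x ->
  h^-1 *: (T (s + h) x - T s x) @[h --> 0^'+] --> T s (A x).
Proof.
move=> s0 Dx; have [Ds <-] := generator_semigroup s0 Dx.
apply: eq_cvg_right0 (generator_cvg Ds) => // h h0.
by rewrite [s + h]addrC TD// ltW.
Qed.

Lemma rescaled_orbit_left l s x : 0 < s ->
  expR (- l * (s - h)) *: T (s - h) x @[h --> 0^'+] --> expR (- l * s) *: T s x.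
Proof.
move=> s0; apply: cvgZ; last exact: semigroup_cvg_left.
exact: (@cvg_shift_left _ _ _ _ (@continuous_expRM _ (- l) s)).
Qed.

(** Minus the rescaled orbit of x is a primitive of e^(-l s) T(s) (l x - A x), the integrand in the
    Laplace formula for the resolvent. *)
Lemma rescaled_orbit_right_deriv l s x : 0 <= s -> D x ->
  h^-1 *: (- (expR (- l * (s + h)) *: T (s + h) x) - - (expR (- l * s) *: T s x))
  @[h --> 0^'+] --> expR (- l * s) *: T s (l *: x - A x).
Proof.
move=> s0 Dx; have dE := @right_derivZ R X (fun s => expR (- l * s)) (fun s => T s x) _ _ s
  (@right_deriv_expR _ (- l) s)
  (@cvg_shift_right _ _ _ _ (@continuous_expRM _ (- l) s)) (orbit_right_deriv s0 Dx).
have -> : T s (l *: x - A x) = l *: T s x - T s (A x) by rewrite linearB linearZ.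
have dE' := cvg_right0Z (-1) dE; apply: (eq_cvg_right0 _ _ dE') => [h _|].
all: by vring.
Qed.

Lemma rescaled_orbit_cone l (C : set X) y t : closed C -> convex_cone C ->
  D y -> 0 <= t -> (forall s, 0 <= s -> C (T s (l *: y - A y))) ->
  C (y - expR (- l * t) *: T t y).
Proof.
move=> clC cC Dy t0 Cs; have [C0 CD CZ] := cC.
pose g s := - (expR (- l * s) *: T s y).
have -> : y - expR (- l * t) *: T t y = g t - g 0.
  by rewrite /g mulr0 expR0 T0; vring.
apply: (@cone_mvt _ _ C g (fun s => expR (- l * s) *: T s (l *: y - A y))) => //.
- by move=> s /andP[s0 _]; apply: cvgN; exact: rescaled_orbit_left.
- by move=> s /andP[s0 _]; exact: rescaled_orbit_right_deriv.
- by move=> s /andP[s0 _]; apply: CZ; [rewrite expR_ge0|exact: Cs].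
Qed.

Section Growth.
Variables (M w : R).
Hypothesis M0 : 0 < M.
Hypothesis wP : forall t x, 0 <= t -> `|T t x| <= M * expR (w * t) * `|x|.

Lemma rescaled_orbit_small l x e : w < l -> 0 < e ->
  exists2 t, 0 <= t & `|expR (- l * t) *: T t x| < e.
Proof.
move=> wl e0; have b0 : 0 < M * `|x| + 1 by rewrite ltr_wpDl// mulr_ge0// ltW.
have lw : 0 < l - w by lra.
(* With this t, e^((l - w) t) exceeds (l - w) t, the quotient of M |x| + 1 by e, which makes the
   decay sufficient. *)
have t0 : 0 <= (M * `|x| + 1) / e / (l - w) by rewrite !divr_ge0// ltW.
exists ((M * `|x| + 1) / e / (l - w)) => //; set t := _ / (l - w).
rewrite normrZ gtr0_norm ?expR_gt0//.
apply: (@le_lt_trans _ _ (expR (- (l - w) * t) * (M * `|x|))).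
  have -> : - (l - w) * t = - l * t + w * t by ring.
  rewrite expRD -[leRHS]mulrA ler_pM2l ?expR_gt0//.
  by rewrite (le_trans (wP _ t0))// mulrAC [leLHS]mulrC.
have : expR (- (l - w) * t) * expR ((l - w) * t) = 1.
  by rewrite -expRD mulNr addNr expR0.
have := expR_ge1Dx ((l - w) * t); have := expR_gt0 (- (l - w) * t).
have -> : (l - w) * t = (M * `|x| + 1) / e by rewrite mulrC divfK// gt_eqF.
move: (expR (- (l - w) * t)) (expR ((M * `|x| + 1) / e)) => a b a0 be ab.
have : M * `|x| + 1 < b * e.
  rewrite -ltr_pdivrMr//; lra.
have : a * (M * `|x| + 1) < a * (b * e) -> a * (M * `|x|) < e.
  by rewrite mulrA ab mul1r mulrDr mulr1; lra.
by move=> h k; apply: h; rewrite ltr_pM2l.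
Qed.

(** In Laplace terms, y is the integral over the half-line of e^(-l s) T(s) (l y - A y); the
    boundary term at time t tends to 0. *)
Lemma orbit_cone l (C : set X) y : w < l -> closed C -> convex_cone C ->
  D y -> (forall s, 0 <= s -> C (T s (l *: y - A y))) -> C y.
Proof.
move=> wl clC cC Dy Cs; apply: closedP => // e e0.
have [t t0 te] := rescaled_orbit_small y wl e0.
exists (y - expR (- l * t) *: T t y); first exact: rescaled_orbit_cone.
by rewrite subKr.
Qed.

Lemma resolvent_cone l (C : set X) L y : w < l -> closed C -> convex_cone C ->
  is_resolvent l L -> (forall s, 0 <= s -> C (T s y)) -> C (L y).
Proof.
move=> wl clC cC [_ Ly _] Cs; have [DL LyE] := Ly y.
by apply: (orbit_cone wl) => // s s0; rewrite LyE; exact: Cs.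
Qed.

(* With cone elements of X * R of the form |x| <= r, the mean value theorem for
   cones bounds |x| by the integral of c e^((w - l) s). *)
Lemma orbit_bound l x c : w < l -> D x ->
  (forall s, 0 <= s -> `|T s (l *: x - A x)| <= c * expR (w * s)) ->
  `|x| <= c / (l - w).
Proof.
move=> wl Dx cP; have lw : 0 < l - w by lra.
pose C := [set z : X * R | `|z.1| <= z.2].
have clC : closed C.
  have -> : C = (fun z : X * R => z.2 - `|z.1|) @^-1` [set r | 0 <= r].
    by apply/seteqP; split=> z; rewrite /C /= subr_ge0.
  apply: preimage_closed; last exact: closed_ge.
  move=> z _; apply: cvgB; first exact: cvg_snd.
  by apply: cvg_norm; exact: cvg_fst.
have cC : convex_cone C.
  split; rewrite /C /=.
  - by rewrite normr0.
  - by move=> y z /= yC zC; rewrite (le_trans (ler_normD _ _))// lerD.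
  - by move=> a y /= a0 yC; rewrite normrZ ger0_norm// ler_wpM2l.
have main t : 0 <= t -> `|x - expR (- l * t) *: T t x| <= c / (l - w).
  move=> t0.
  (* The second component is the primitive of c e^(-(l - w) s) that vanishes at infinity. *)
  pose g s : X * R := (- (expR (- l * s) *: T s x), - (c / (l - w)) * expR (- (l - w) * s)).
  have : C (g t - g 0).
    apply: (@cone_mvt _ _ C g (fun s => (expR (- l * s) *: T s (l *: x - A x),
       c * expR (- (l - w) * s)))) => //.
    - move=> s /andP[s0 _]; apply: cvg_right0_pair; first by apply: cvgN; exact: rescaled_orbit_left.
      apply: cvgMr.
      exact: (@cvg_shift_left _ _ _ _ (@continuous_expRM _ (- (l - w)) s)).
    - move=> s /andP[s0 _]; apply: cvg_right0_pair.
        exact: rescaled_orbit_right_deriv.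
      have dE := cvg_right0Z (- (c / (l - w))) (@right_deriv_expR _ (- (l - w)) s).
      apply: (eq_cvg_right0 _ _ dE) => [h _|]; last first.
        by rewrite /= -[LHS]/(- (c / (l - w)) * (- (l - w) * expR (- (l - w) * s))); field; lra.
      rewrite -[LHS]/(- (c / (l - w)) * (h^-1 * (expR (- (l - w) * (s + h)) - expR (- (l - w) * s)))).
      rewrite -[RHS]/(h^-1 * (- (c / (l - w)) * expR (- (l - w) * (s + h)) -
         - (c / (l - w)) * expR (- (l - w) * s))).
      by ring.
    - move=> s /andP[s0 _]; rewrite /C /= normrZ gtr0_norm ?expR_gt0//.
      have -> : - (l - w) * s = - l * s + w * s by ring.
      by rewrite expRD mulrCA ler_pM2l ?expR_gt0// cP.
  rewrite /C /g /= !mulr0 !expR0 T0 scale1r mulr1.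
  have -> : - (expR (- l * t) *: T t x) - - x = x - expR (- l * t) *: T t x by vring.
  move=> /le_trans; apply; have := cP 0 (lexx 0).
  rewrite mulr0 expR0 mulr1 => /(le_trans (normr_ge0 _)) c0.
  by rewrite opprK addrC mulNr gerBl mulr_ge0 ?expR_ge0// divr_ge0// ltW.
apply/ler_addgt0Pr => e e0; have [t t0 te] := rescaled_orbit_small x wl e0.
have -> : x = (x - expR (- l * t) *: T t x) + expR (- l * t) *: T t x by vring.
by rewrite (le_trans (ler_normD _ _))// lerD ?main// ltW.
Qed.

End Growth.
End Generator.

(** Used with y = h |w|, z = h w and a = e^(2 |w| h), to bound the growth factor 1 / (1 - h w) of an
    implicit Euler step by an exponential. *)
Lemma euler_step_bound (R : realType) (y z a : R) : 0 <= y -> y <= 2^-1 ->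
  z <= y -> 1 + 2 * y <= a -> 1 <= a * (1 - z).
Proof.
move=> y0 y1 zy ya; apply: (@le_trans _ _ ((1 + 2 * y) * (1 - y))); first by nra.
by apply: ler_pM; lra.
Qed.

Section Resolvents.
Context {R : realType} {X : completeNormedModType R}.
Variables (T : R -> {linear X -> X}) (D : set X) (A : X -> X).
Hypothesis hT : C0_semigroup T.
Hypothesis gA : is_generator T D A.
Local Notation is_resolvent := (is_resolvent D A).
Local Notation Res := (resolvent D A).

Let T0 x : T 0 x = x. Proof. by case: hT. Qed.

Let TD s t x : 0 <= s -> 0 <= t -> T (s + t) x = T s (T t x).
Proof. by case: hT => _ _ + _; apply. Qed.

Let TC s t x : 0 <= s -> 0 <= t -> T s (T t x) = T t (T s x).
Proof. by move=> s0 t0; rewrite -!TD// addrC. Qed.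

Lemma semigroup_resolvent l L s y : 0 <= s -> is_resolvent l L ->
  T s (L y) = L (T s y).
Proof.
move=> s0 [_ Ly Lx]; have [DL yE] := Ly y.
have [DT AT] := generator_semigroup hT gA s0 DL.
by rewrite -[in RHS]yE linearB linearZ /= -AT Lx.
Qed.

Lemma resolvent_setP l : resolvent_set D A l -> is_resolvent l (Res l).
Proof.
move=> [[_ Dinj Dsurj] Rcont].
have RP y : D (Res l y) /\ l *: Res l y - A (Res l y) = y.
  have [x Dx xy] := Dsurj y I.
  by apply: (@xgetPex _ 0 [set x | D x /\ l *: x - A x = y]); exists x.
have RK x : D x -> Res l (l *: x - A x) = x.
  move=> Dx; have [DR RE] := RP (l *: x - A x).
  by apply: Dinj; rewrite ?inE.
split=> //; apply: continuous_bounded_linear => // a x y.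
have [Dx xE] := RP x; have [Dy yE] := RP y.
have [Dxy AE] := generator_lin gA a Dx Dy.
rewrite -[RHS]RK// AE; congr (Res l _).
by rewrite -[in LHS]xE -[in LHS]yE; vring.
Qed.

Section OneResolvent.
Variables (l1 : R) (L1 : X -> X).
Hypothesis rL1 : is_resolvent l1 L1.

(** Applying the bounded operator L1 to l1 u_n - A u_n returns u_n, so x = L1 (l1 x - z) in the
    limit. *)
Lemma generator_closed (u : nat -> X) x z : (forall n, D (u n)) ->
  u n @[n --> \oo] --> x -> A (u n) @[n --> \oo] --> z -> D x /\ A x = z.
Proof.
move=> Du ux Az; have [bL LP LK] := rL1.
have : L1 (l1 *: u n - A (u n)) @[n --> \oo] --> L1 (l1 *: x - z).
  apply: continuous_cvg; first exact: continuous_of_bounded_linear.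
  by apply: cvgB => //; apply: cvgZ => //; exact: cvg_cst.
under eq_fun do rewrite LK//.
move=> /(cvg_unique (@norm_hausdorff _ _) ux) xE; have [] := LP (l1 *: x - z); rewrite -xE => Dx.
by move=> /(congr1 (fun v => l1 *: x - v)); rewrite !subKr.
Qed.

(** In x = l1 L1 x - A (L1 x), the last term is a limit of difference quotients of the orbit of L1
    x, and these quotients lie in D. *)
Lemma generator_dense x e : 0 < e -> exists2 y, D y & `|x - y| < e.
Proof.
move=> e0; have [_ LP _] := rL1; have [Dz zE] := LP x.
have /cvg_right0P/(_ e e0)[d d0 dP] := generator_cvg gA Dz.
have d20 : 0 < d / 2 by rewrite divr_gt0.
exists (l1 *: L1 x - (d / 2)^-1 *: (T (d / 2) (L1 x) - L1 x)).
  have [DT _] := generator_semigroup hT gA (ltW d20) Dz.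
  have [DB _] := generatorB gA DT Dz.
  have [DZ _] := generatorZ gA (d / 2)^-1 DB; have [Dl _] := generatorZ gA l1 Dz.
  by have [] := generatorB gA Dl DZ.
rewrite -[X in `|X - _|]zE.
have -> : l1 *: L1 x - A (L1 x) - (l1 *: L1 x - (d / 2)^-1 *: (T (d / 2) (L1 x) - L1 x)) =
  (d / 2)^-1 *: (T (d / 2) (L1 x) - L1 x) - A (L1 x) by vring.
by apply: dP; rewrite d20; lra.
Qed.

Section Growth.
Variables (M w : R).
Hypothesis M0 : 0 < M.
Hypothesis wP : forall t x, 0 <= t -> `|T t x| <= M * expR (w * t) * `|x|.

Lemma generator_bound m x : w < m -> D x ->
  `|x| <= M / (m - w) * `|m *: x - A x|.
Proof.
move=> wm Dx; rewrite mulrAC.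
apply: (orbit_bound hT gA M0 wP wm Dx) => s s0.
by rewrite mulrAC; exact: wP.
Qed.

(** The range of m - A is invariant under the semigroup, so [orbit_cone] puts D, hence the whole
    space, in its closure. The lower bound [generator_bound] turns convergence in the range into
    convergence of preimages, and A is closed. *)
Lemma generator_surj m y : w < m -> exists x, D x /\ m *: x - A x = y.
Proof.
move=> wm; have mw : 0 < m - w by lra.
pose Rg := [set m *: x - A x | x in D].
have cRg : convex_cone Rg.
  have [D0 A0] := generator0 gA; split.
  - by exists 0 => //; rewrite A0 scaler0 subr0.
  - move=> _ _ [x Dx <-] [z Dz <-]; have [Dxz AE] := generatorD gA Dx Dz.
    by exists (x + z) => //; rewrite AE; vring.
  - move=> a _ _ [x Dx <-]; have [Dax AE] := generatorZ gA a Dx.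
    by exists (a *: x) => //; rewrite AE; vring.
have DRg x : D x -> closure Rg x.
  move=> Dx; apply: (orbit_cone hT gA M0 wP wm _ _ Dx).
  - exact: closed_closure.
  - exact: convex_cone_closure.
  - move=> s s0; apply: subset_closure.
    have [DT AT] := generator_semigroup hT gA s0 Dx.
    by exists (T s x) => //; rewrite AT linearB linearZ.
have : closure Rg y.
  apply: closedP; first exact: closed_closure.
  by move=> e /(generator_dense y)[z /DRg ? ?]; exists z.
move=> /closureP yRg.
have /choice[u uP] : forall n : nat, exists x, D x /\
    `|y - (m *: x - A x)| < n.+1%:R^-1.
  move=> n; have [|_ [x Dx <-] xy] := yRg (n.+1%:R^-1); first by rewrite invr_gt0.
  by exists x.
have Mw : 0 < M / (m - w) by rewrite divr_gt0.
have small (e : R) : 0 < e -> exists N, forall n, (N <= n)%N ->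
    `|y - (m *: u n - A (u n))| < e.
  move=> e0; have /cvg_seqP/(_ e e0)[N NP] := @cvg_harmonic R.
  exists N => n /NP ne; have [_ h] := uP n; rewrite (lt_trans h)//.
  by move: ne; rewrite /harmonic subr0; exact: le_lt_trans (ler_norm _).
have : cvg (u n @[n --> \oo]).
  apply: cauchy_cvg; apply: cauchy_exP => e e0.
  have [|N NP] := small (e / (M / (m - w)) / 2); first by rewrite !divr_gt0.
  exists (u N); exists N => // n /= Nn; rewrite -ball_normE /ball_ /=.
  have [DN _] := uP N; have [Dn _] := uP n.
  have [DB AB] := generatorB gA DN Dn.
  rewrite (le_lt_trans (generator_bound wm DB))// mulrC -ltr_pdivlMr//.
  have -> : m *: (u N - u n) - A (u N - u n) =
     (y - (m *: u n - A (u n))) - (y - (m *: u N - A (u N))).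
    by rewrite AB; vring.
  rewrite (le_lt_trans (ler_normB _ _))//.
  have := NP N (leqnn N); have := NP n Nn; lra.
move=> /cvg_ex[x ux]; exists x.
have yu : m *: u n - A (u n) @[n --> \oo] --> y.
  by apply/cvg_seqP => e /small[N NP]; exists N => n /NP; rewrite distrC.
have Au : A (u n) @[n --> \oo] --> m *: x - y.
  have -> : (fun n => A (u n)) = (fun n => m *: u n - (m *: u n - A (u n))).
    by apply/funext => n; vring.
  by apply: cvgB => //; apply: cvgZ => //; exact: cvg_cst.
have [Dx ->] := generator_closed (fun n => (uP n).1) ux Au.
by split=> //; vring.
Qed.

Lemma resolvent_set_growth m : w < m -> resolvent_set D A m.
Proof.
move=> wm; have mw : 0 < m - w by lra.
have inj x x' : D x -> D x' -> m *: x - A x = m *: x' - A x' -> x = x'.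
  move=> Dx Dx' E; have [DB AB] := generatorB gA Dx Dx'.
  have := generator_bound wm DB.
  have -> : m *: (x - x') - A (x - x') = 0.
    have -> : m *: (x - x') - A (x - x') = (m *: x - A x) - (m *: x' - A x').
      by rewrite AB; vring.
    by rewrite E subrr.
  by rewrite normr0 mulr0 normr_le0 subr_eq0 => /eqP.
have RP y : D (Res m y) /\ m *: Res m y - A (Res m y) = y.
  have [x xP] := generator_surj y wm.
  by apply: (@xgetPex _ 0 [set x | D x /\ m *: x - A x = y]); exists x.
split.
  split=> //.
    by move=> x x' /set_mem Dx /set_mem Dx'; exact: inj.
  by move=> y _; exists (Res m y); case: (RP y).
apply: continuous_of_bounded_linear; split.
  move=> a x y; have [Dx xE] := RP x; have [Dy yE] := RP y.
  have [Dxy AE] := generator_lin gA a Dx Dy.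
  have [DR RE] := RP (a *: x + y).
  by apply: inj => //; rewrite AE RE -{1}xE -{1}yE; vring.
exists (M / (m - w)) => [|y]; first by rewrite divr_gt0.
by have [DR RE] := RP y; rewrite -{2}RE generator_bound.
Qed.

Lemma resolvent_growth m : w < m -> is_resolvent m (Res m).
Proof. by move=> wm; apply: resolvent_setP; exact: resolvent_set_growth. Qed.

(** A weighted bound on the whole orbit amounts to an equivalent norm in which the resolvent has
    norm at most 1 / (m - w). Iterates then do not accumulate powers of M. *)
Lemma orbit_resolvent_bound m L y c : w < m -> is_resolvent m L ->
  (forall s, 0 <= s -> `|T s y| <= c * expR (w * s)) ->
  forall s, 0 <= s -> `|T s (L y)| <= c / (m - w) * expR (w * s).
Proof.
move=> wm [_ LP _] yc s s0; have [DL LE] := LP y.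
have [DT AT] := generator_semigroup hT gA s0 DL.
rewrite mulrAC; apply: (orbit_bound hT gA M0 wP wm DT) => r r0.
rewrite AT -linearZ -linearB LE -TD//.
rewrite (le_trans (yc _ _))//; first exact: addr_ge0.
by rewrite mulrDr expRD mulrA mulrAC.
Qed.

Lemma yosida_cvg x e : 0 < e -> exists2 m0, w < m0 & forall m L, m0 < m ->
  is_resolvent m L -> `|m *: L x - x| < e.
Proof.
move=> e0; have Mp := M0; have M1 : 0 < 2 * M + 1 by rewrite addr_gt0// mulr_gt0.
have [x' Dx' xx'] := generator_dense x (divr_gt0 (divr_gt0 e0 (ltr0n _ 2)) M1).
have w0 := normr_ge0 w; have ww := ler_norm w.
have q0 : 0 <= 4 * M * `|A x'| / e by rewrite divr_ge0 ?mulr_ge0// ltW.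
(* For m > 2 |w| the norm of m L is at most 2 M; the last term makes L (A x') smaller than e / 2.
   The distance of x to x' was chosen for the factor 2 M + 1. *)
exists (2 * `|w| + 1 + 4 * M * `|A x'| / e); first lra.
move=> m L m0m rL; have [[lL _] LP LK] := rL.
have wm : w < m by lra.
have m0 : 0 < m by lra.
have Lb y : `|m *: L y| <= 2 * M * `|y|.
  rewrite normrZ gtr0_norm//; have [DL LE] := LP y.
  have := generator_bound wm DL; rewrite LE => /(ler_wpM2l (ltW m0)) /le_trans; apply.
  rewrite mulrA ler_wpM2r// mulrA ler_pdivrMr; last lra.
  have : 0 < M * (m - 2 * w) by rewrite mulr_gt0//; lra.
  lra.
have -> : m *: L x - x = m *: L (x - x') + (L (A x')) - (x - x').
  have := LK x' Dx'; rewrite linB// linZ// (linB lL) => E.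
  have -> : L (A x') = m *: L x' - (m *: L x' - L (A x')) by vring.
  by rewrite E; vring.
have LA : `|L (A x')| < e / 2.
  have := Lb (A x'); rewrite normrZ gtr0_norm// => h.
  have : 4 * M * `|A x'| / e < m by lra.
  by rewrite ltr_pdivrMr//; nra.
rewrite (le_lt_trans (ler_normB _ _))// -ltrBrDr (le_lt_trans (ler_normD _ _))//.
move: xx'; rewrite ltr_pdivlMr// => xx'.
have := Lb (x - x'); lra.
Qed.

Lemma power_bound m L n y : w < m -> is_resolvent m L ->
  `|iter n L y| <= M * `|y| / (m - w) ^+ n.
Proof.
move=> wm rL.
have : forall s, 0 <= s -> `|T s (iter n L y)| <= M * `|y| / (m - w) ^+ n * expR (w * s).
  elim: n => [|n IH] s s0; first by rewrite expr0 divr1 mulrAC wP.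
  have := orbit_resolvent_bound wm rL IH s0.
  by rewrite exprSr invfM mulrA.
by move=> /(_ 0 (lexx 0)); rewrite mulr0 expR0 mulr1 T0.
Qed.

(** L' is the sum of (l - m)^n L^(n+1), whose coefficients are nonnegative. The remainder after n
    terms is at most a constant times ((l - m) / (l - w))^n by [power_bound]. *)
Lemma neumann_cone (C : set X) l m L L' : closed C -> convex_cone C ->
  w < m -> m <= l -> is_resolvent l L -> is_resolvent m L' ->
  (forall x, C x -> C (L x)) -> forall x, C x -> C (L' x).
Proof.
move=> clC cC wm ml rL rL' CL x Cx; have wl : w < l by lra.
have lw : 0 < l - w by lra.
have [[lL _] LP LK] := rL; have [[lL' _] L'P L'K] := rL'.
have resE y : L' y = L y + (l - m) *: L (L' y).
  have [DL' E] := L'P y; rewrite -[LHS](LK _ DL').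
  have -> : l *: L' y - A (L' y) = (m *: L' y - A (L' y)) + (l - m) *: L' y by vring.
  by rewrite E linD// linZ.
have lin_iter n a y : iter n L (a *: y) = a *: iter n L y.
  by elim: n => //= n ->; rewrite linZ.
have lin_iterD n y z : iter n L (y + z) = iter n L y + iter n L z.
  by elim: n => //= n ->; rewrite linD.
have Citer n y : C y -> C (iter n L y) by elim: n => //= n IH /IH/CL.
have part n : exists2 k, C k & L' x = k + (l - m) ^+ n *: iter n L (L' x).
  elim: n => [|n [k Ck E]]; first by exists 0; [case: cC|rewrite expr0 scale1r add0r].
  exists (k + (l - m) ^+ n *: iter n L (L x)).
    case: cC => _ CD CZ; apply: CD => //; apply: CZ; first by rewrite exprn_ge0//; lra.
    by apply: Citer; exact: CL.
  by rewrite iterSr {1}E {1}resE lin_iterD lin_iter exprSr; vring.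
apply: closedP => // e e0.
pose q := (l - m) / (l - w).
have q0 : 0 <= q by rewrite divr_ge0//; lra.
have q1 : q < 1 by rewrite ltr_pdivrMr//; lra.
have c0 : 0 < M * `|L' x| + 1 by rewrite ltr_wpDl// mulr_ge0// ltW.
have : q ^+ n @[n --> \oo] --> (0 : R) by apply: cvg_expr; rewrite ger0_norm.
move=> /cvg_seqP/(_ _ (divr_gt0 e0 c0))[N /(_ N (leqnn N))].
rewrite subr0 => /(le_lt_trans (ler_norm _)); rewrite ltr_pdivlMr// => qN.
have [k Ck E] := part N; exists k => //.
rewrite {1}E addrAC subrr add0r normrZ ger0_norm ?exprn_ge0//; last lra.
apply: le_lt_trans qN.
apply: (@le_trans _ _ (q ^+ N * (M * `|L' x|))); last first.
  by rewrite ler_wpM2l ?exprn_ge0//; lra.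
rewrite /q expr_div_n mulrAC -mulrA ler_wpM2l ?exprn_ge0//; first lra.
exact: power_bound.
Qed.

(* Implicit Euler steps: T(t) x = lim (n/t R(n/t, A))^n x. *)
Lemma cone_semigroup_invariant (C : set X) : closed C -> convex_cone C ->
  (forall m, w < m -> forall x, C x -> C (Res m x)) ->
  forall t x, 0 <= t -> C x -> C (T t x).
Proof.
move=> clC cC CR t x t0 Cx; have [C0 CD CZ] := cC.
(* The elements m R(m) x lie in both D and C and approximate x, so the Euler scheme may be run on D,
   where its local error is small compared with the step. *)
suff main y : D y -> C y -> C (T t y).
  have bT := semigroup_bounded_linear hT t0.
  apply: (@bounded_linear_closure _ _ _ (T t) [set y | D y /\ C y] C bT clC).
    by move=> y [Dy Cy]; exact: main.
  apply/closureP => e e0; have [m0 wm0 m0P] := yosida_cvg x e0.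
  pose m := `|m0| + 1.
  have m0m : m0 < m by rewrite /m; have := ler_norm m0; lra.
  have mp : 0 < m by rewrite /m; have := normr_ge0 m0; lra.
  have wm : w < m by lra.
  have rL := resolvent_growth wm.
  exists (m *: Res m x); last by rewrite distrC; exact: m0P.
  split; last by apply: CZ; [exact: ltW|exact: CR].
  by case: rL => _ /(_ x)[DL _] _; have [] := generatorZ gA m DL.
move=> Dy Cy; have [->|tn0] := eqVneq t 0; first by rewrite T0.
have {tn0}tp : 0 < t by rewrite lt_neqAle eq_sym tn0.
apply: closedP => // e e0.
(* The n local errors, each at most 2 h eps, are amplified by at most K, so the total is at most 2 t
   K eps for every n. *)
pose K := M * expR (2 * `|w| * t).
have K0 : 0 < K by rewrite mulr_gt0 ?expR_gt0.
have tK : 0 < 2 * t * K + 1 by rewrite ltr_wpDl// !mulr_ge0// ltW.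
have eps0 : 0 < e / (2 * t * K + 1) by rewrite divr_gt0.
set eps := e / _ in eps0.
have epsE : 2 * t * K * eps < e.
  have : (2 * t * K + 1) * eps = e by rewrite mulrC divfK// gt_eqF.
  lra.
have /cvg_right0P/(_ _ eps0)[d d0 dP] := generator_cvg gA Dy.
have [m0 wm0 m0P] := yosida_cvg (A y) eps0.
have w0 := normr_ge0 w.
(* A step h with 1 / h > b satisfies h < d, 1 / h > m0 and h |w| <= 1/2 at once. *)
pose b := 1 / d + `|m0| + 2 * `|w|.
have b0 : 0 < b.
  have : 0 < 1 / d by rewrite divr_gt0.
  by rewrite /b; have := normr_ge0 m0; lra.
pose n := (Num.truncn (t * b)).+1.
have nb : t * b < n%:R by exact: truncnS_gt.
have n0 : 0 < n%:R :> R by rewrite ltr0n.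
pose h := t / n%:R.
have h0 : 0 < h by rewrite divr_gt0.
have nh : n%:R * h = t by rewrite /h mulrC divfK// gt_eqF.
have bh : b < h^-1 by rewrite /h invf_div ltr_pdivlMr// mulrC.
have d1 : 0 < 1 / d by rewrite divr_gt0.
have m00 := normr_ge0 m0.
have hd : h < d.
  have : 1 / d < h^-1 by rewrite /b in bh; lra.
  by rewrite div1r ltf_pV2.
have m0h : m0 < h^-1 by have := ler_norm m0; rewrite /b in bh; lra.
have wh : w < h^-1 by lra.
have hw : h * `|w| <= 2^-1.
  have : 2 * `|w| < h^-1 by rewrite /b in bh; lra.
  by rewrite -(ltr_pM2l h0) divff ?gt_eqF//; lra.
have rL := resolvent_growth wh; set L := Res h^-1 in rL.
have [[lL _] LP LK] := rL.
pose F z := h^-1 *: L z.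
have lF : linear F.
  by move=> a u v; rewrite /F lL; vring.
(* A common bound for the growth over one step of the semigroup, e^(w h), and of the scheme, 1 / (1
   - h w). *)
pose th := expR (2 * `|w| * h).
have th1 : 1 <= th by rewrite -expR0 ler_expR !mulr_ge0// ltW.
have th0 : 0 < th by rewrite expR_gt0.
have thw : expR (w * h) <= th.
  by rewrite ler_expR; apply: ler_wpM2r; [exact: ltW|have := ler_norm w; lra].
have Fb c z : 0 <= c -> (forall s, 0 <= s -> `|T s z| <= c * expR (w * s)) ->
    forall s, 0 <= s -> `|T s (F z)| <= th * c * expR (w * s).
  move=> c0 zc s s0; rewrite /F linearZ /= normrZ gtr0_norm ?invr_gt0//.
  have := orbit_resolvent_bound wh rL zc s0.
  rewrite -(ler_pM2l (_ : 0 < h^-1)) ?invr_gt0// => /le_trans; apply.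
  rewrite mulrA ler_wpM2r ?expR_ge0// mulrCA mulrC ler_wpM2r//.
  have hwl : 0 < 1 - h * w by have := ler_norm w; nra.
  have -> : h^-1 / (h^-1 - w) = (1 - h * w)^-1.
    have -> : h^-1 - w = h^-1 * (1 - h * w) by field; rewrite gt_eqF.
    by field; rewrite !gt_eqF.
  rewrite -[leLHS]mul1r ler_pdivrMr//.
  have := expR_ge1Dx (2 * `|w| * h); rewrite -/th => hth.
  have hw2 : h * w <= h * `|w| by rewrite ler_pM2l// ler_norm.
  have hw3 : 0 <= h * `|w| by rewrite mulr_ge0// ltW.
  by apply: (euler_step_bound hw3 hw hw2); rewrite (mulrC h) mulrA.
have TF s z : 0 <= s -> T s (F z) = F (T s z).
  by move=> s0; rewrite /F linearZ /= (semigroup_resolvent _ s0 rL).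
pose del := `|T h y - F y|.
have c0P k : 0 <= k%:R * th ^+ k * M * del.
  apply: mulr_ge0; last exact: normr_ge0.
  apply: mulr_ge0; last exact: ltW.
  by apply: mulr_ge0; [exact: ler0n|apply: exprn_ge0; exact: ltW].
(* The error after k + 1 steps is T(k h) applied to a local error plus F applied to the error after
   k steps. The statement covers whole orbits because [Fb] propagates only orbit bounds without loss
   of a factor M. *)
have err k : forall s, 0 <= s ->
    `|T s (T (k%:R * h) y - iter k F y)| <= k%:R * th ^+ k * M * del * expR (w * s).
  elim: k => [|k IH] s s0.
    by rewrite !mul0r T0 subrr linear0 normr0.
  have kh0 : 0 <= k%:R * h by rewrite mulr_ge0// ltW.
  have -> : T (k.+1%:R * h) y - iter k.+1 F y =
     T (k%:R * h) (T h y - F y) + F (T (k%:R * h) y - iter k F y).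
    rewrite -natr1 mulrDl mul1r TD ?(ltW h0)// linearB /= TF// (linB lF); vring.
  rewrite linearD (le_trans (ler_normD _ _))//.
  have c0 : 0 <= k%:R * th ^+ k * M * del by exact: c0P.
  have h1 := Fb _ _ c0 IH s s0.
  have h2 : `|T s (T (k%:R * h) (T h y - F y))| <= th ^+ k.+1 * M * del * expR (w * s).
    rewrite -TD// (le_trans (wP _ (addr_ge0 s0 kh0)))//.
    rewrite mulrDr expRD -/del.
    have -> : M * (expR (w * s) * expR (w * (k%:R * h))) * del =
      expR (w * (k%:R * h)) * (M * del * expR (w * s)) by ring.
    have -> : th ^+ k.+1 * M * del * expR (w * s) = th ^+ k.+1 * (M * del * expR (w * s)).
      by ring.
    apply: ler_wpM2r.
      by apply: mulr_ge0; [apply: mulr_ge0; [exact: ltW|exact: normr_ge0]|exact: expR_ge0].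
    have -> : w * (k%:R * h) = k%:R * (w * h) by ring.
    rewrite expRM_natl (le_trans (_ : _ <= th ^+ k))//.
      by rewrite lerXn2r// nnegrE ?expR_ge0// ltW.
    by rewrite exprS ler_peMl// exprn_ge0// ltW.
  rewrite (le_trans (lerD h2 h1))//.
  have -> : th * (k%:R * th ^+ k * M * del) = k%:R * (th ^+ k.+1 * M * del).
    by rewrite exprS; ring.
  by rewrite -natr1 -mulrDl; apply: ler_wpM2r; [exact: expR_ge0|lra].
(* Since F y = y + L (A y), the local error is h times the difference between the difference
   quotient of the orbit and h^-1 L (A y), both of which are within eps of A y. *)
have delh : del <= 2 * h * eps.
  have FE : F y = y + L (A y).
    have := LK _ Dy; rewrite (linB lL) (linZ lL) -/(F y) => E.
    have -> : F y = (F y - L (A y)) + L (A y) by vring.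
    by rewrite E.
  have -> : del = `|h *: ((h^-1 *: (T h y - y) - A y) - (h^-1 *: L (A y) - A y))|.
    rewrite /del FE; congr (`|_|); vring; field; rewrite gt_eqF//.
  rewrite normrZ gtr0_norm// -mulrA mulrCA ler_pM2l//.
  rewrite (le_trans (ler_normB _ _))//.
  have := dP h; rewrite h0 hd => /(_ isT); have := m0P _ _ m0h rL; lra.
exists (iter n F y).
  have Cit k : C (iter k F y).
    elim: k => //= k IH; apply: CZ; first by rewrite invr_ge0 ltW.
    exact: CR.
  exact: Cit.
have := err n 0 (lexx 0); rewrite mulr0 expR0 mulr1 T0 nh => /le_lt_trans; apply.
apply: le_lt_trans epsE.
have thn : th ^+ n = expR (2 * `|w| * t).
  by rewrite /th -expRM_natl; congr expR; rewrite -nh; ring.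
have -> : 2 * t * K * eps = n%:R * th ^+ n * M * (2 * h * eps).
  by rewrite thn /K -nh; ring.
apply: ler_wpM2l => //; apply: mulr_ge0; last exact: ltW.
by apply: mulr_ge0; [exact: ler0n|apply: exprn_ge0; exact: ltW].
Qed.

End Growth.
End OneResolvent.
End Resolvents.

(** * The fundamental theorem of calculus *)

Section Indicators.
Context {R : realType} {X : completeNormedModType R}.
Local Notation mu := (@lebesgue_measure R).
Implicit Types (t : R) (E : set R) (c : X).

Lemma simple_integral_indic t E c : measurable E ->
  simple_integral t (fun r => if r \in E then c else 0) = mass t E *: c.
Proof.
move=> mE; have sE := simple_map_indic mE.
rewrite (@simple_integral_comp _ _ t _ _ (fun b : bool => if b then c else 0) sE).
have Etrue : (fun r => r \in E) @^-1` [set true] = E.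
  by apply/seteqP; split=> r /=; [move=> /set_mem|move=> /mem_set].
have [tv|tv] := boolP (true \in vals (fun r => r \in E)).
  rewrite (bigD1_seq true) ?vals_uniq//= Etrue big1 ?addr0//.
  by case=> // _; rewrite scaler0.
rewrite big_seq big1 => [|[] bv]; last 2 first.
- by rewrite bv in tv.
- by rewrite scaler0.
have -> : E = set0.
  apply/seteqP; split=> // r Er; move: tv; apply/negP; rewrite negbK.
  by have := mem_vals sE r; rewrite mem_set.
by rewrite /mass setI0 measure0 scale0r.
Qed.

Lemma is_bochner_integral_simple t (s : R -> X) : simple_function s ->
  is_bochner_integral t s (simple_integral t s).
Proof.
move=> ss; apply/is_bochner_integralP; split; first exact: simple_strongly_measurable.
move=> e e0; exists s; split=> //; last by rewrite subrr normr0.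
by rewrite /L1norm; under eq_integral do rewrite subrr normr0; rewrite integral0 lte_fin.
Qed.

Lemma is_bochner_integral_indic t E c : measurable E ->
  is_bochner_integral t (fun r => if r \in E then c else 0) (mass t E *: c).
Proof.
move=> mE; rewrite -simple_integral_indic//; apply: is_bochner_integral_simple.
exact: (simple_map_comp (simple_map_indic mE) (fun b => if b then c else 0)).
Qed.

Lemma L1norm_indic_le t E (f : R -> X) (k : R) : measurable E -> 0 <= k ->
  strongly_measurable t f ->
  (forall r, 0 <= r <= t -> `|f r| <= if r \in E then k else 0) ->
  (L1norm t f <= (k * mass t E)%:E)%E.
Proof.
move=> mE k0 mf fk.
pose g := fun r : R => if r \in E then k else 0.
have sg : simple_map g.
  exact: (simple_map_comp (simple_map_indic mE) (fun b : bool => if b then k else 0)).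
have -> : (k * mass t E)%:E = (\int[mu]_(r in `[0%R, t]) (g r)%:E)%E.
  rewrite (_ : (\int[_]_(_ in _) _)%E = (\int[mu]_(r in `[0%R, t]) (k%:E * (\1_E r)%:E))%E).
    rewrite ge0_integralZl_EFin//; last first.
      by apply/measurable_EFinP; exact: measurable_indic.
    by rewrite integral_indic// EFinM massE// setIC.
  apply: eq_integral => r _; rewrite /g indicE; case: (r \in E).
    by rewrite mule1.
  by rewrite mule0.
apply: ge0_le_integral => //; first exact: measurable_enorm.
by apply/measurable_EFinP; exact: (measurable_fun_simple sg id).
Qed.

Lemma mass_itv t (a b : R) : 0 <= a -> a <= b -> b <= t ->
  mass t `]a, b] = b - a.
Proof.
move=> a0 ab bt; rewrite /mass (_ : _ `&` _ = `]a, b]%classic).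
  rewrite lebesgue_measure_itv/= lte_fin; case: ifP => // /negbT.
  by rewrite -leNgt => ba; rewrite (@le_anti _ _ a b) ?ab// subrr.
apply/seteqP; split=> r /=; rewrite !in_itv/=; first by case.
move=> /andP[ar rb]; rewrite ar rb; split=> //; apply/andP; split; lra.
Qed.

Lemma bounded_integrable t (f : R -> X) (k : R) : strongly_measurable t f ->
  (forall r, 0 <= r <= t -> `|f r| <= k) -> exists y, is_bochner_integral t f y.
Proof.
move=> mf fk; apply: is_bochner_integral_exists => //.
apply: (@Lp_L1norm _ _ 1%E) => //; exact: bounded_Lp fk.
Qed.

(** Let G s be the integral of phi over ]a, s]. Then G - F is left continuous with zero right
    derivative, so [cone_mvt] for the cone {0} makes it constant. *)
Lemma bochner_FTC t (a b k : R) (phi F : R -> X) : 0 <= a -> a <= b -> b <= t ->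
  strongly_measurable t phi -> (forall r, 0 <= r <= t -> `|phi r| <= k) ->
  (forall s, a <= s < b -> phi (s + h) @[h --> 0^'+] --> phi s) ->
  (forall s, a < s <= b -> F (s - h) @[h --> 0^'+] --> F s) ->
  (forall s, a <= s < b -> h^-1 *: (F (s + h) - F s) @[h --> 0^'+] --> phi s) ->
  is_bochner_integral t (fun r => if r \in `]a, b]%classic then phi r else 0) (F b - F a).
Proof.
move=> a0 ab bt mphi phik phir Fl Fr.
have k0 : 0 <= k by apply: le_trans (phik a _) => //; rewrite a0 (le_trans ab).
have It (c d r : R) : (r \in `]c, d]%classic) = (c < r <= d).
  by apply/idP/idP => [/set_mem|h]; [|apply/mem_set]; rewrite /= in_itv.
have mres (E : set R) (f : R -> X) : measurable E -> strongly_measurable t f ->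
    strongly_measurable t (fun r => if r \in E then f r else 0).
  exact: strongly_measurable_restrict.
have /choice[G GP] : forall s, exists y, is_bochner_integral t
    (fun r => if r \in `]a, s]%classic then phi r else 0) y.
  move=> s; apply: (@bounded_integrable _ _ k); first exact: mres.
  by move=> r rt; case: ifP => _; [exact: phik|rewrite normr0].
have GB s s' : a <= s -> s <= s' -> is_bochner_integral t
    (fun r => if r \in `]s, s']%classic then phi r else 0) (G s' - G s).
  move=> as_ ss; apply: eq_is_bochner_integral (is_bochner_integralB (GP s') (GP s)) => r _.
  rewrite !It; have [ar|ra] := ltP a r => /=; last first.
    case: ifP => [/andP[sr _]|_]; last by rewrite subrr.
    by move: ra; rewrite leNgt (le_lt_trans as_ sr).
  by have [rs|sr] := leP r s => /=; rewrite ?(le_trans rs ss) ?subrr ?subr0.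
have Gincr s s' c e : a <= s -> s <= s' -> s' <= b -> 0 <= e ->
    (forall r, s < r <= s' -> `|phi r - c| <= e) ->
    `|G s' - G s - (s' - s) *: c| <= e * (s' - s).
  move=> as_ ss sb e0 phic.
  have mE : measurable `]s, s']%classic by exact: measurable_itv.
  have := is_bochner_integralB (GB s s' as_ ss) (is_bochner_integral_indic t c mE).
  rewrite mass_itv//; [|exact: le_trans as_|exact: le_trans sb bt].
  move=> /[dup] -[mf _] /is_bochner_integral_le /le_trans h.
  rewrite -lee_fin; apply: h.
  have <- := @mass_itv t s s' (le_trans a0 as_) ss (le_trans sb bt).
  apply: L1norm_indic_le => // r rt; rewrite It.
  by case: ifP => [|_]; [exact: phic|rewrite subrr normr0].
suff : [set 0] ((G b - F b) - (G a - F a)).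
  have -> : G a = 0.
    apply: (is_bochner_integral_unique (GP a)).
    apply: eq_is_bochner_integral (is_bochner_integral0 t) => r _.
    by rewrite It; case: ifP => // /andP[ar ra]; move: (lt_le_trans ar ra); rewrite ltxx.
  rewrite /= => E; have -> : F b - F a = G b.
    have -> : F b - F a = G b - (G b - F b - (0 - F a)) by vring.
    by rewrite E subr0.
  exact: GP.
apply: (@cone_mvt _ _ [set 0] (fun s => G s - F s) (fun=> 0)) => //.
- by apply: accessible_closed_set1; apply: hausdorff_accessible; exact: norm_hausdorff.
- split=> //= [x y -> ->|c x _ ->]; [exact: addr0|exact: scaler0].
- move=> s /andP[as_ sb]; apply: cvgB; last by apply: Fl; rewrite as_.
  apply/cvg_right0P => e e0.
  have sa : 0 < s - a by lra.
  have k1 : 0 < k + 1 by lra.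
  exists (Num.min (s - a) (e / (k + 1))) => [|h]; first by rewrite lt_min sa divr_gt0.
  rewrite lt_min => /and3P[h0 hs he].
  rewrite distrC.
  have -> : G s - G (s - h) = G s - G (s - h) - (s - (s - h)) *: 0 by rewrite scaler0 subr0.
  have h1 : a <= s - h by lra.
  have h2 : s - h <= s by lra.
  rewrite (le_lt_trans (Gincr _ _ 0 k h1 h2 sb k0 _))//.
    move=> r /andP[sr rs]; rewrite subr0; apply: phik; apply/andP; split; lra.
  rewrite subKr; move: he; rewrite ltr_pdivlMr//; nra.
- move=> s /andP[as_ sb]; rewrite -(subrr (phi s)).
  have -> : (fun h => h^-1 *: (G (s + h) - F (s + h) - (G s - F s))) =
     (fun h => h^-1 *: (G (s + h) - G s) - h^-1 *: (F (s + h) - F s)).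
    by apply/funext => h; vring.
  apply: cvgB; last by apply: Fr; rewrite as_.
  apply/cvg_right0P => e e0.
  have e20 : 0 < e / 2 by lra.
  have /cvg_right0P/(_ _ e20)[d d0 dP] := phir s (introT andP (conj as_ sb)).
  exists (Num.min d (b - s)) => [|h]; first by rewrite lt_min d0 subr_gt0.
  rewrite lt_min => /and3P[h0 hd hb].
  have sh : s <= s + h by lra.
  have shb : s + h <= b by lra.
  have -> : h^-1 *: (G (s + h) - G s) - phi s =
     h^-1 *: (G (s + h) - G s - (s + h - s) *: phi s).
    by vring; field; rewrite gt_eqF.
  rewrite normrZ gtr0_norm ?invr_gt0// ltr_pdivrMl//.
  rewrite (le_lt_trans (Gincr _ _ _ _ as_ sh shb (ltW e20) _))//; last first.
    have -> : s + h - s = h by ring.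
    by rewrite mulrC ltr_pM2l//; lra.
  move=> r /andP[sr rs]; have -> : r = s + (r - s) by rewrite addrC subrK.
  by apply/ltW/dP; lra.
Qed.

End Indicators.

(** * Boundary control systems *)

Section OrbitMeasurability.
Context {R : realType} {X : completeNormedModType R}.
Variable T : R -> {linear X -> X}.
Hypothesis hT : C0_semigroup T.

(** The index of the multiple of 1 / (n + 1) just below r; the value 0 outside [0, t] keeps the
    range finite. *)
Definition grid (t : R) (n : nat) (r : R) : nat :=
  if r \in `[0, t]%classic then Num.truncn (r * n.+1%:R) else 0%N.

Lemma in_itv_cc (a b r : R) : (r \in `[a, b]%classic) = (a <= r <= b).
Proof. by apply/idP/idP => [/set_mem|h]; [|apply/mem_set]; rewrite /= in_itv. Qed.

Lemma simple_grid t n : simple_map (grid t n).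
Proof.
split=> [|k].
  apply: (@sub_finite_set _ _ `I_(Num.truncn (`|t| * n.+1%:R)).+1); last exact: finite_II.
  move=> _ [r _ <-]; rewrite /grid /= in_itv_cc; case: ifP => // /andP[r0 rt].
  by rewrite ltnS le_truncn// ler_wpM2r// (le_trans rt)// ler_norm.
rewrite (_ : _ @^-1` _ = (`[0, t] `&` `[k%:R / n.+1%:R, k.+1%:R / n.+1%:R[) `|`
    (if k == 0%N then ~` `[0, t] else set0)).
  apply: measurableU; first exact: measurableI.
  by case: ifP => // _; exact: measurableC.
apply/seteqP; split=> r; rewrite /= /grid in_itv_cc;
  have [rt|/negbTE rt] := boolP (0 <= r <= t).
- have r0 : 0 <= r * n.+1%:R by rewrite mulr_ge0//; case/andP: rt.
  move=> /eqP; rewrite truncn_eq// => /andP[h1 h2]; left.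
  by rewrite !in_itv/= rt ler_pdivrMr// ltr_pdivlMr// h1 h2.
- by move=> <-; right; rewrite eqxx /= in_itv/= rt.
- have r0 : 0 <= r * n.+1%:R by rewrite mulr_ge0//; case/andP: rt.
  move=> [[_]|].
    rewrite in_itv/= ler_pdivrMr// ltr_pdivlMr// => h.
    by apply/eqP; rewrite truncn_eq.
  by case: ifP => //= _; rewrite in_itv/= rt.
- move=> [[]|]; first by rewrite in_itv/= rt.
  by case: ifP => // /eqP ->.
Qed.

Lemma grid_bounds t n r : 0 <= r <= t ->
  0 <= r - (grid t n r)%:R / n.+1%:R < n.+1%:R^-1.
Proof.
move=> rt; have /andP[r0 _] := rt; rewrite /grid in_itv_cc rt.
have rn : 0 <= r * n.+1%:R by rewrite mulr_ge0.
have /andP[h1 h2] := truncn_itv rn.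
rewrite subr_ge0 ler_pdivrMr// h1 /= ltrBlDr -[X in X + _]mul1r -mulrDl.
by rewrite ltr_pdivlMr// nat1r.
Qed.

(* The evaluation point is rounded to a grid, so that the approximants take
   finitely many values. *)
Lemma strongly_measurable_orbit t (g : R -> X) : strongly_measurable t g ->
  strongly_measurable t (fun s => T (t - s) (g s)).
Proof.
move=> [sg ssg sgg].
pose s n r := if r \in `[0, t]%classic then T (t - (grid t n r)%:R / n.+1%:R) (sg n r) else 0.
exists s => [n|r rt].
  have sp := simple_map_pair (simple_map_indic (measurable_itv `[0, t]))
    (simple_map_pair (simple_grid t n) (ssg n)).
  exact: (simple_map_comp sp (fun z : bool * (nat * X) =>
    if z.1 then T (t - z.2.1%:R / n.+1%:R) z.2.2 else 0)).
rewrite /s in_itv_cc rt; have /andP[r0 rt'] := rt.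
have [K K0 KP] := semigroup_local_bound hT t.
apply/cvg_seqP => e e0.
have e20 : 0 < e / 2 by lra.
have /cvg_seqP/(_ _ (divr_gt0 e20 K0))[N NP] := sgg r rt.
have tr : 0 <= t - r by lra.
(* The grid rounds r down, so t - q approaches t - r from the right. *)
have /cvg_right0P/(_ _ e20)[d d0 dP] := @semigroup_cvg_right _ _ _ hT _ (g r) tr.
have /cvg_seqP/(_ _ d0)[N' NP'] := @cvg_harmonic R.
exists (maxn N N') => n; rewrite geq_max => /andP[/NP h1 /NP' h2].
have /andP[b0 b1] := grid_bounds n rt.
set q := _ / _ in b0 b1 *.
have q0 : 0 <= q by rewrite divr_ge0.
have -> : T (t - q) (sg n r) - T (t - r) (g r) =
    T (t - q) (sg n r - g r) + (T (t - q) (g r) - T (t - r) (g r)).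
  by rewrite linearB; vring.
rewrite (le_lt_trans (ler_normD _ _))//.
have a1 : `|T (t - q) (sg n r - g r)| < e / 2.
  rewrite (le_lt_trans (KP _ _ _))//; first by apply/andP; split; lra.
  by rewrite mulrC -ltr_pdivlMr.
have a2 : `|T (t - q) (g r) - T (t - r) (g r)| < e / 2.
  have -> : t - q = (t - r) + (r - q) by ring.
  have [->|rq] := eqVneq (r - q) 0; first by rewrite addr0 subrr normr0.
  apply: dP; rewrite lt_neqAle eq_sym rq b0 /= (lt_trans b1)//.
  by move: h2; rewrite /harmonic subr0; exact: le_lt_trans (ler_norm _).
lra.
Qed.

End OrbitMeasurability.

Section Boundary.
Context {R : realType} {X dX U : completeNormedModType R}.
Variable S : boundary_control_system X dX U.
Local Notation T := (bcs_T S).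
Local Notation A := (bcs_Am S).
Local Notation Q := (bcs_Q S).
Local Notation D := (bcs_dom S).
Local Notation Dm := (bcs_domm S).
Local Notation is_resolvent := (is_resolvent D A).

Lemma bcs_generator : is_generator T D A.
Proof. exact: bcs_T_generator. Qed.

Lemma Am_lin a x y : Dm x -> Dm y -> Dm (a *: x + y) /\ A (a *: x + y) = a *: A x + A y.
Proof. by case: (bcs_Am_linear S) => _; apply. Qed.

Lemma Q_lin a x y : Dm x -> Dm y -> Q (a *: x + y) = a *: Q x + Q y.
Proof. by move=> Dx Dy; case: (bcs_Q_linear S) => _ /(_ a x y Dx Dy)[]. Qed.

Section Dirichlet.
Variables (l : R) (L : X -> X).
Hypothesis rL : is_resolvent l L.

(** Start from any preimage x0 of d under Q and subtract L (l x0 - A x0), which lies in ker Q and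
    has the same image under l - A_m. *)
Lemma dirichlet_opP d : [/\ Dm (dirichlet_op S l d),
  l *: dirichlet_op S l d = A (dirichlet_op S l d) & Q (dirichlet_op S l d) = d].
Proof.
have [_ LP _] := rL.
have [x0 Dx0 Qx0] : (Q @` Dm) d by rewrite bcs_Q_surj.
have [[Dz Qz] zE] := LP (l *: x0 - A x0).
pose z := L (l *: x0 - A x0).
have [Dx AE] := Am_lin (-1) Dz Dx0.
have QE := Q_lin (-1) Dz Dx0.
have ex : [set x | [/\ Dm x, l *: x - A x = 0 & Q x = d]] (-1 *: z + x0).
  split=> //; last by rewrite QE Qz scaler0 add0r.
  rewrite AE -/z; have -> : l *: (-1 *: z + x0) - (-1 *: A z + A x0) =
    (l *: x0 - A x0) - (l *: z - A z) by vring.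
  by rewrite zE subrr.
have [D1 E1 Q1] := @xgetPex _ 0 _ (ex_intro _ _ ex).
by split=> //; apply/eqP; rewrite -subr_eq0; apply/eqP.
Qed.

Lemma dirichlet_unique x d : Dm x -> l *: x = A x -> Q x = d ->
  x = dirichlet_op S l d.
Proof.
move=> Dx xE Qx; have [Dd dE Qd] := dirichlet_opP d.
have [_ LP LK] := rL; have [bL _ _] := rL; case: bL => lL _.
have [DB AB] := Am_lin (-1) Dd Dx.
have QB := Q_lin (-1) Dd Dx.
have DD : D (-1 *: dirichlet_op S l d + x).
  by split=> //; rewrite QB Qd Qx scaleN1r addNr.
have := LK _ DD; rewrite AB -xE -dE.
have -> : l *: (-1 *: dirichlet_op S l d + x) - (-1 *: (l *: dirichlet_op S l d) + l *: x) = 0.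
  by vring.
rewrite lin0// => /esym/eqP; rewrite scaleN1r addrC subr_eq0; exact/eqP.
Qed.

(** By the closed graph theorem: a limit of solutions of A_m x = l x is a solution since A_m is
    closed, and its boundary value is the limit of theirs since Q is bounded for the graph norm. *)
Lemma dirichlet_bounded_linear : bounded_linear (dirichlet_op S l).
Proof.
apply: closed_graph_bounded.
  move=> a c d; have [Dc cE Qc] := dirichlet_opP c; have [Dd dE Qd] := dirichlet_opP d.
  have [Dx AE] := Am_lin a Dc Dd.
  apply/esym/dirichlet_unique => //; last by rewrite Q_lin// Qc Qd.
  by rewrite AE -cE -dE; vring.
move=> u d y ud uy; apply/esym; pose x n := dirichlet_op S l (u n).
have xP n : [/\ Dm (x n), l *: x n = A (x n) & Q (x n) = u n] by exact: dirichlet_opP.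
have [Dy AyE] : Dm y /\ A y = l *: y.
  have clG := @bcs_Am_closed _ _ _ _ S.
  have xy : (x n, l *: x n) @[n --> \oo] --> (y, l *: y).
    by apply: cvg_pair => //; apply: cvgZ => //; exact: cvg_cst.
  have nG : \forall n \near \oo, [set z | Dm z.1 /\ A z.1 = z.2] (x n, l *: x n).
    by apply: nearW => n /=; case: (xP n) => ? -> _.
  have Gy := @closed_cvg nat (X * X)%type \oo _ (fun n => (x n, l *: x n)) _ clG nG _ xy.
  exact: Gy.
apply: dirichlet_unique => //.
have [C CP] := bcs_Q_bounded S.
apply/eqP; rewrite -subr_eq0 -normr_le0; apply/ler_addgt0Pr => e e0; rewrite add0r.
pose C1 := `|C| * (1 + `|l|) + 1.
have C10 : 0 < C1 by rewrite ltr_wpDl// mulr_ge0// addr_ge0.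
have e20 : 0 < e / 2 by lra.
have /cvg_seqP/(_ _ e20)[N NP] := ud.
have /cvg_seqP/(_ _ (divr_gt0 e20 C10))[N' NP'] := uy.
pose n := maxn N N'; have := NP n (leq_maxl _ _); have := NP' n (leq_maxr _ _).
rewrite -/(x n) ltr_pdivlMr// => h1 h2; have [Dn nE Qn] := xP n.
have [DB AB] := Am_lin (-1) Dy Dn; have QB := Q_lin (-1) Dy Dn.
have := CP _ DB; rewrite QB AB AyE -nE Qn.
have -> : -1 *: (l *: y) + l *: x n = l *: (x n - y) by vring.
have -> : -1 *: y + x n = x n - y by vring.
rewrite normrZ => h3.
have h4 : C * (`|x n - y| + `|l| * `|x n - y|) <= `|x n - y| * C1.
  have -> : C * (`|x n - y| + `|l| * `|x n - y|) = `|x n - y| * (C * (1 + `|l|)) by ring.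
  rewrite ler_wpM2l//.
  apply: (@le_trans _ _ (`|C| * (1 + `|l|))); last by rewrite lerDl.
  by rewrite ler_wpM2r ?addr_ge0// ler_norm.
have -> : Q y - d = (u n - d) - (-1 *: Q y + u n) by vring.
by rewrite (le_trans (ler_normB _ _))//; lra.
Qed.

Lemma bcs_Bl_bounded_linear : bounded_linear (bcs_Bl S l).
Proof.
have [ld [M M0 MP]] := dirichlet_bounded_linear.
have [lB [K K0 KP]] : bounded_linear (bcs_B S).
  apply: continuous_bounded_linear; last exact: bcs_B_continuous.
  by move=> a x y; rewrite linearP.
split; first by move=> a x y; rewrite /bcs_Bl linearP ld.
exists (M * K) => [|x]; first exact: mulr_gt0.
by rewrite /bcs_Bl (le_trans (MP _))// -mulrA ler_pM2l.
Qed.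

End Dirichlet.

(** The right-hand side lies in ker (m - A_m) and has the boundary value of B_l v, because R(m)
    takes its values in ker Q. *)
Lemma bcs_BlE l L m Lm v : is_resolvent l L -> is_resolvent m Lm ->
  bcs_Bl S m v = bcs_Bl S l v + (l - m) *: Lm (bcs_Bl S l v).
Proof.
move=> rL rLm; set d := bcs_B S v.
have [Dd dE Qd] := dirichlet_opP rL d.
have [_ LP _] := rLm; have [[Dz Qz] zE] := LP (bcs_Bl S l v).
have [Dx AE] := Am_lin (l - m) Dz Dd.
rewrite addrC; apply/esym; apply: (dirichlet_unique rLm) => //.
  rewrite AE /bcs_Bl -/d -dE.
  have -> : A (Lm (dirichlet_op S l d)) = m *: Lm (dirichlet_op S l d) - dirichlet_op S l d.
    by have := congr1 (fun q => m *: Lm (bcs_Bl S l v) - q) zE; rewrite subKr.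
  by vring.
by rewrite Q_lin// Qz Qd scaler0 add0r.
Qed.

End Boundary.

Section Control.
Context {R : realType} {X dX U : completeNormedModType R}.
Variables (S : boundary_control_system X dX U) (p : \bar R).
Hypothesis hp : (1 <= p)%E.
Local Notation T := (bcs_T S).
Local Notation A := (bcs_Am S).
Local Notation D := (bcs_dom S).
Local Notation Bl := (bcs_Bl S).
Local Notation is_resolvent := (is_resolvent D A).
Implicit Types (t l m : R) (u : R -> U) (L : X -> X).

Let hT : C0_semigroup T := bcs_T_semigroup S.
Let gA : is_generator T D A := bcs_generator S.

Definition input_integrand l t u : R -> X := fun s => T (t - s) (Bl l (u s)).

Lemma strongly_measurable_input l L t u : is_resolvent l L ->
  strongly_measurable t u -> strongly_measurable t (input_integrand l t u).
Proof.
move=> rL mu; apply: (strongly_measurable_orbit hT).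
apply: (strongly_measurable_comp _ mu).
exact: continuous_of_bounded_linear (bcs_Bl_bounded_linear rL).
Qed.

Lemma input_integrand_exists l L t u : is_resolvent l L -> Lp p t u ->
  exists y, is_bochner_integral t (input_integrand l t u) y.
Proof.
move=> rL Lu; have mu : strongly_measurable t u by case: Lu.
have mf := strongly_measurable_input rL mu.
apply: is_bochner_integral_exists => //.
have [_ [M M0 MP]] := bcs_Bl_bounded_linear rL.
have [K K0 KP] := semigroup_local_bound hT t.
apply: (@le_lt_trans _ _ ((K * M)%:E * L1norm t u)%E).
  apply: le_L1norm => //; first by rewrite mulr_ge0// ltW.
  move=> r /andP[r0 rt]; rewrite (le_trans (KP _ _ _))//; first by apply/andP; split; lra.
  by rewrite -mulrA ler_pM2l.
apply: lte_mul_pinfty => //; first by rewrite lee_fin mulr_ge0// ltW.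
exact: Lp_L1norm hp Lu.
Qed.

(** The operator 1 + (l - m) R(m) maps B_l to B_m and commutes with the semigroup, so it passes
    through the integral. *)
Lemma input_integral_change l L m Lm t u y : is_resolvent l L ->
  is_resolvent m Lm -> is_bochner_integral t (input_integrand l t u) y ->
  is_bochner_integral t (input_integrand m t u) (y + (l - m) *: Lm y).
Proof.
move=> rL rLm fy; have [[lLm [M M0 MP]] _ _] := rLm.
have bop : bounded_linear (fun x => x + (l - m) *: Lm x).
  split; first by move=> a x z; rewrite lLm; vring.
  exists (1 + `|l - m| * M) => [|x]; first by rewrite ltr_pwDl// mulr_ge0// ltW.
  rewrite (le_trans (ler_normD _ _))// normrZ mulrDl mul1r lerD2l -mulrA.
  by rewrite ler_wpM2l.
have := is_bochner_integral_comp bop fy.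
apply: eq_is_bochner_integral => r /andP[r0 rt].
have tr : 0 <= t - r by lra.
rewrite /input_integrand /= (bcs_BlE _ rL rLm) linearD linearZ /=.
by rewrite (semigroup_resolvent hT gA _ tr rLm).
Qed.

(** Phrased with a value y of the integral, so that the default value of [bochner_integral] never
    enters. *)
Definition maps_to_domain l t : Prop := forall u y, Lp p t u ->
  is_bochner_integral t (input_integrand l t u) y -> D y.

Lemma maps_to_domain_change l L m Lm t : is_resolvent l L -> is_resolvent m Lm ->
  maps_to_domain l t -> maps_to_domain m t.
Proof.
move=> rL rLm Dl u y Lu fy.
have fl := input_integral_change rLm rL fy; have Dy' := Dl _ _ Lu fl.
have fm := input_integral_change rL rLm fl.
rewrite (is_bochner_integral_unique fy fm).
have [_ /(_ (y + (m - l) *: L y))[DL _] _] := rLm.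
have [DZ _] := generatorZ gA (l - m) DL.
by have [] := generatorD gA Dy' DZ.
Qed.

Let T0 x : T 0 x = x. Proof. by case: hT. Qed.

(** A control delayed by t' - t has the same integral over [0, t'] as the original over [0, t]. *)
Lemma maps_to_domain_le l L t t' : is_resolvent l L -> 0 <= t -> t <= t' ->
  maps_to_domain l t' -> maps_to_domain l t.
Proof.
move=> rL t0 tt Dt u y Lu fy.
have c0 : 0 <= t' - t by lra.
have ct : (t' - t) + t <= t' by lra.
apply: (Dt (ext_shift t (t' - t) u)); first exact: Lp_shift.
apply: eq_is_bochner_integral (is_bochner_integral_shift c0 ct fy) => r _.
rewrite /ext_shift /input_integrand; case: ifP => _.
  by congr (T _ _); ring.
have [bl _] := bcs_Bl_bounded_linear rL.
by rewrite (lin0 bl) linear0.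
Qed.

(* The integral over [0, 2t] is T(t) applied to the integral over [0, t], plus
   the integral of the control translated by t. *)
Lemma maps_to_domain_double l L t : is_resolvent l L -> 0 <= t ->
  maps_to_domain l t -> maps_to_domain l (t + t).
Proof.
move=> rL t0 Dt u y Lu fy; have [bl _] := bcs_Bl_bounded_linear rL.
have Bl0 : Bl l 0 = 0 by exact: lin0.
have mE : measurable `]-oo, t[%classic by exact: measurable_itv.
have Et r : (r \in `]-oo, t[%classic) = (r < t).
  by apply/idP/idP => [/set_mem|h]; [|apply/mem_set]; rewrite /= in_itv.
pose u0 := ext_shift (t + t) 0 u.
have Lu0 : Lp p t u0 by exact: Lp_shift.
(* The first half is taken without the instant t, which already belongs to the translated second
   half; the sum of integrands then agrees at every point. *)
pose u1 r := if r \in `]-oo, t[%classic then u0 r else 0.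
have Lu1 : Lp p t u1.
  apply: (@le_Lp _ _ _ _ _ 1 _ u0) => //.
    by apply: strongly_measurable_restrict => //; case: Lu0.
  by move=> r _; rewrite /u1 mul1r; case: ifP => // _; rewrite normr0.
pose u2 := ext_shift (t + t) (- t) u.
have Lu2 : Lp p t u2 by exact: Lp_shift.
have [y1 f1] := input_integrand_exists rL Lu1.
have [y2 f2] := input_integrand_exists rL Lu2.
have D1 := Dt _ _ Lu1 f1; have D2 := Dt _ _ Lu2 f2.
have g1 := is_bochner_integral_comp (semigroup_bounded_linear hT t0) f1.
have t0t : 0 + t <= t + t by lra.
have h1 := is_bochner_integral_shift (lexx 0) t0t g1.
have h2 := is_bochner_integral_shift t0 (lexx (t + t)) f2.
have fy' : is_bochner_integral (t + t) (input_integrand l (t + t) u) (T t y1 + y2).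
  apply: eq_is_bochner_integral (is_bochner_integralD h1 h2) => r /andP[r0 rt].
  rewrite /ext_shift /input_integrand /= subr0 r0 /u1 /u2 /u0 /ext_shift Et subr0 opprK.
  have [rt'|tr] := ltP r t.
    have -> : (0 <= r - t) = false by apply/negbTE; rewrite -ltNge; lra.
    rewrite (ltW rt') r0 rt /= addr0.
    have -> : t + t - r = t + (t - r) by ring.
    have tr : 0 <= t - r by lra.
    by case: (hT) => _ _ TD _; rewrite (TD t (t - r)).
  have -> : 0 <= r - t <= t by apply/andP; split; lra.
  rewrite subrK r0 rt /= Bl0 !linear0.
  have -> : (if r <= t then 0 else 0) = 0 :> X by case: ifP.
  by rewrite add0r; congr (T _ _); ring.
rewrite (is_bochner_integral_unique fy fy').
have [DT _] := generator_semigroup hT gA t0 D1.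
by have [] := generatorD gA DT D2.
Qed.

Lemma admissible_maps_to_domain l L t : boundary_admissible S p ->
  is_resolvent l L -> 0 <= t -> maps_to_domain l t.
Proof.
move=> [t1 [l1 [t10 rho1 adm]]] rL t0; have r1 := resolvent_setP gA rho1.
apply: (maps_to_domain_change r1 rL).
have D1 : maps_to_domain l1 t1.
  by move=> u y Lu fy; have := adm _ Lu; rewrite /input_integral (bochner_integralE fy).
(* Doubling reaches a time beyond t, since 2^n > n, and the property then descends to t. *)
have Dn n : maps_to_domain l1 ((2 ^ n)%:R * t1).
  elim: n => [|n IH]; first by rewrite expn0 mul1r.
  have -> : (2 ^ n.+1)%:R * t1 = (2 ^ n)%:R * t1 + (2 ^ n)%:R * t1.
    by rewrite expnS natrM; ring.
  by apply: (maps_to_domain_double r1) => //; rewrite mulr_ge0// ltW.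
apply: (maps_to_domain_le r1 t0 _ (Dn (Num.truncn (t / t1)).+1)).
rewrite -ler_pdivrMr// ltW// (lt_le_trans (truncnS_gt _))// ler_nat.
exact/ltnW/ltn_expl.
Qed.

Section Admissible.
Hypothesis hB : boundary_admissible S p.

Lemma bcs_rho_xget : bcs_rho S (xget 0 (bcs_rho S)).
Proof. by case: hB => t1 [l1 [_ rho1 _]]; apply: xgetPex; exists l1. Qed.

(** With y the integral at the selected parameter l, the state is (l - A) y = (m - A) y + (l - m) y.
    Its image under R(m) is y + (l - m) R(m) y, which is the integral of B_m. *)
Lemma controllability_mapP m Lm t u : is_resolvent m Lm -> 0 <= t -> Lp p t u ->
  is_bochner_integral t (input_integrand m t u) (Lm (controllability_map S t u)).
Proof.
move=> rLm t0 Lu; set l := xget 0 (bcs_rho S).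
have rL : is_resolvent l (bcs_R S l) by exact: (resolvent_setP gA bcs_rho_xget).
have [y fy] := input_integrand_exists rL Lu.
have Dy := admissible_maps_to_domain hB rL t0 Lu fy.
have := input_integral_change rL rLm fy.
rewrite /controllability_map -/l /input_integral (bochner_integralE fy).
have [[lLm _] LP LK] := rLm.
have -> : l *: y - A y = (m *: y - A y) + (l - m) *: y by vring.
by rewrite (linD lLm) (linZ lLm) LK.
Qed.

Lemma controllability_map_unique m Lm t u c : is_resolvent m Lm -> 0 <= t ->
  Lp p t u -> is_bochner_integral t (input_integrand m t u) (Lm c) ->
  controllability_map S t u = c.
Proof.
move=> rLm t0 Lu fc; have [_ LP _] := rLm.
have := is_bochner_integral_unique (controllability_mapP rLm t0 Lu) fc.
by move=> E; have [_ <-] := LP (controllability_map S t u); rewrite E; case: (LP c).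
Qed.

End Admissible.
End Control.

(** * Closed convex hulls *)

Section Hull.
Context {R : realType} {X : completeNormedModType R}.
Implicit Types (A C : set X).

Lemma convex_setP C : convex_set C <->
  forall (a : R) x y, 0 <= a <= 1 -> C x -> C y -> C (a *: x + (1 - a) *: y).
Proof.
split=> [cC a x y /andP[a0 a1] Cx Cy|cC x y a /set_mem Cx /set_mem Cy].
  have a01 : (0 <= a <= 1) by rewrite a0.
  by have := cC x y (Itv01 a0 a1) (mem_set Cx) (mem_set Cy) => /set_mem.
by apply/mem_set; apply: cC => //; apply/andP; split.
Qed.

Lemma convex_cone_convex C : convex_cone C -> convex_set C.
Proof.
move=> [_ CD CZ]; apply/convex_setP => a x y /andP[a0 a1] Cx Cy.
by apply: CD; apply: CZ => //; rewrite subr_ge0.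
Qed.

Lemma closed_convex_coneP C : closed_convex_cone C <-> closed C /\ convex_cone C.
Proof.
split=> [[clC /convex_setP cC C0 CZ]|[clC cC]].
  split=> //; split=> // x y Cx Cy.
  have -> : x + y = 2 *: (2^-1 *: x + (1 - 2^-1) *: y) by vring; field.
  by apply: CZ => //; apply: cC => //; apply/andP; split; lra.
by split=> //; [exact: convex_cone_convex|case: cC|case: cC].
Qed.

Lemma hull_closed A : closed (closed_convex_hull A).
Proof. move=> x clx C [[clC cC] AC]; apply: (clC); apply: closureS clx => y Ay.
by apply: Ay; split; [split|]. Qed.

Lemma hull_convex A : convex_set (closed_convex_hull A).
Proof.
apply/convex_setP => a x y a01 Ax Ay C [[clC cC] AC].
by move/convex_setP: (cC); apply => //; [apply: Ax|apply: Ay].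
Qed.

Lemma sub_hull A x : A x -> closed_convex_hull A x.
Proof. exact: sub_gen_smallest. Qed.

Lemma hull_min A C : closed C -> convex_set C -> A `<=` C ->
  closed_convex_hull A `<=` C.
Proof. by move=> clC cC AC; apply: smallest_sub. Qed.

End Hull.

Section HullMap.
Context {R : realType} {X : completeNormedModType R}.

(** The preimage under f of the hull of B is closed and convex. *)
Lemma hull_map (Y : completeNormedModType R) (f : X -> Y) (A : set X) (B : set Y) :
  bounded_linear f ->
  (forall x, A x -> closed_convex_hull B (f x)) ->
  forall x, closed_convex_hull A x -> closed_convex_hull B (f x).
Proof.
move=> bf AB; apply: hull_min => //.
  apply: preimage_closed; last exact: hull_closed.
  by move=> x _; exact: continuous_of_bounded_linear.
have [lf _] := bf; apply/convex_setP => a x y a01 Bx By.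
rewrite /preimage /= (linD lf) !(linZ lf).
by have /convex_setP := @hull_convex _ _ B; apply.
Qed.

Lemma bounded_linearZ (a : R) : bounded_linear (fun x : X => a *: x).
Proof.
split=> [b x y|]; first by vring.
exists (`|a| + 1) => [|x]; first by rewrite ltr_wpDl.
by rewrite normrZ ler_wpM2r// lerDl.
Qed.

Lemma hull_cone (A : set X) : A 0 -> (forall (a : R) x, 0 <= a -> A x -> A (a *: x)) ->
  convex_cone (closed_convex_hull A).
Proof.
move=> A0 AZ; have HZ (a : R) x : 0 <= a -> closed_convex_hull A x -> closed_convex_hull A (a *: x).
  move=> a0; apply: (hull_map (bounded_linearZ a)) => y Ay.
  by apply: sub_hull; exact: AZ.
suff [] : closed (closed_convex_hull A) /\ convex_cone (closed_convex_hull A) by [].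
apply/closed_convex_coneP; split=> //; first exact: hull_closed.
  exact: hull_convex.
exact: sub_hull.
Qed.

End HullMap.

(** * Laplace averages and integrals of exponentially weighted orbits *)

Section LaplaceCone.
Context {R : realType} {X : completeNormedModType R}.
Variables (T : R -> {linear X -> X}) (D : set X) (A : X -> X).
Hypothesis hT : C0_semigroup T.
Hypothesis gA : is_generator T D A.
Variables (M w : R).
Hypothesis M0 : 0 < M.
Hypothesis wP : forall t x, 0 <= t -> `|T t x| <= M * expR (w * t) * `|x|.

(* y - (m - l) R(m) y is the average of y - e^(-l s) T(s) y against the
   probability density (m - l) e^(-(m - l) s). *)
Lemma laplace_cone (C : set X) l m Lm y : closed C -> convex_cone C ->
  w < l -> l < m -> is_resolvent D A m Lm ->
  (forall s, 0 <= s -> C (y - expR (- l * s) *: T s y)) ->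
  C (y - (m - l) *: Lm y).
Proof.
move=> clC cC wl lm [_ LP _] Cs; have [C0 CD CZ] := cC.
have [Dz zE] := LP y; set z := Lm y in Dz zE *.
have ml : 0 < m - l by lra.
have wm : w < m by lra.
have T0 x : T 0 x = x by case: (hT).
have Cy : C y.
  apply: closedP => // e e0; have [s s0 se] := rescaled_orbit_small M0 wP y wl e0.
  by exists (y - expR (- l * s) *: T s y); [exact: Cs|rewrite subKr].
suff : C ((m - l)^-1 *: y - z).
  move=> /(CZ _ _ (ltW ml)); rewrite scalerBr scalerA divff ?scale1r//.
  by rewrite gt_eqF.
apply: closedP => // e e0; have [t t0 te] := rescaled_orbit_small M0 wP z wm e0.
exists ((m - l)^-1 *: y - z + expR (- m * t) *: T t z); last first.
  by rewrite opprD addrA subrr sub0r normrN.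
(* A primitive of e^(-(m - l) s). As (m - A) z = y, the function g below has derivative e^(-(m - l)
   s) (y - e^(-l s) T(s) y). *)
pose k s := - (m - l)^-1 * expR (- (m - l) * s).
pose g s := k s *: y - - (expR (- m * s) *: T s z).
have Cg : C (g t - g 0).
  apply: (@cone_mvt _ _ C g (fun s => expR (- (m - l) * s) *: (y - expR (- l * s) *: T s y))) => //.
  - move=> s /andP[s0 _]; apply: cvgB.
      apply: cvgZr_tmp; apply: cvgMr.
      exact: (@cvg_shift_left _ _ _ _ (@continuous_expRM _ (- (m - l)) s)).
    by apply: cvgN; exact: rescaled_orbit_left.
  - move=> s /andP[s0 _].
    have d1 : (- (m - l)^-1 * (h^-1 * (expR (- (m - l) * (s + h)) - expR (- (m - l) * s)))) *: y
        @[h --> 0^'+] --> (- (m - l)^-1 * (- (m - l) * expR (- (m - l) * s))) *: y.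
      by apply: cvgZr_tmp; apply: cvgMr; exact: right_deriv_expR.
    have d2 := @rescaled_orbit_right_deriv _ _ _ _ _ hT gA m _ _ s0 Dz.
    apply: (eq_cvg_right0 _ _ (cvgB d1 d2)) => [h h0|]; rewrite /g /k.
      by rewrite opprfctE; vring.
    rewrite zE.
    have -> : expR (- m * s) = expR (- (m - l) * s) * expR (- l * s).
      by rewrite -expRD; congr expR; ring.
    by vring; field; rewrite gt_eqF.
  - by move=> s /andP[s0 _]; apply: CZ; [exact: expR_ge0|exact: Cs].
(* Adding this nonnegative multiple of y cancels the boundary term of k at t and leaves exactly the
   approximant chosen above. *)
have Ck : C (- k t *: y) by apply: CZ => //; rewrite /k mulNr opprK mulr_ge0 ?expR_ge0// invr_ge0 ltW.
have := CD _ _ Cg Ck; rewrite /g /k !mulr0 expR0 T0.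
by congr C; vring.
Qed.

End LaplaceCone.

Lemma strongly_measurable_continuous (R : realType) (X : completeNormedModType R)
    (t : R) (f : R -> X) : continuous f -> strongly_measurable t f.
Proof.
move=> cf; exists (fun n r => f ((grid t n r)%:R / n.+1%:R)) => [n|r rt].
  exact: (simple_map_comp (simple_grid t n) (fun k : nat => f (k%:R / n.+1%:R))).
apply: (@cvg_comp _ _ _ (fun n => (grid t n r)%:R / n.+1%:R) f \oo (nbhs r)); last exact: cf.
apply/cvg_seqP => e e0; have /cvg_seqP/(_ _ e0)[N NP] := @cvg_harmonic R.
exists N => n /NP; rewrite /harmonic subr0 => h; have /andP[b0 b1] := grid_bounds n rt.
rewrite distrC ger0_norm// (lt_trans b1)// (le_lt_trans _ h)//; exact: ler_norm.
Qed.

Section BackwardOrbit.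
Context {R : realType} {X : completeNormedModType R}.
Variables (T : R -> {linear X -> X}) (D : set X) (A : X -> X).
Hypothesis hT : C0_semigroup T.
Hypothesis gA : is_generator T D A.

Lemma orbit_left_deriv s x : 0 < s -> D x ->
  h^-1 *: (T (s - h) x - T s x) @[h --> 0^'+] --> - T s (A x).
Proof.
move=> s0 Dx; apply/cvg_right0P => e e0; have e20 : 0 < e / 2 by lra.
have [K K0 KP] := semigroup_local_bound hT s.
have /cvg_right0P/(_ _ (divr_gt0 e20 K0))[d d0 dP] := generator_cvg gA Dx.
have /cvg_right0P/(_ _ e20)[d' d'0 dP'] := @semigroup_cvg_left _ _ _ hT _ (A x) s0.
exists (Num.min s (Num.min d d')) => [|h]; first by rewrite !lt_min s0 d0.
rewrite !lt_min => /and4P[h0 hs hd hd']; have sh : 0 <= s - h by lra.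
have h0' := ltW h0.
have -> : h^-1 *: (T (s - h) x - T s x) - - T s (A x) =
    - (T (s - h) (h^-1 *: (T h x - x) - A x) + (T (s - h) (A x) - T s (A x))).
  have -> : T s x = T (s - h) (T h x).
    by case: (hT) => _ _ TD _; rewrite -TD// subrK.
  have -> : T (s - h) (h^-1 *: (T h x - x) - A x) =
      h^-1 *: (T (s - h) (T h x) - T (s - h) x) - T (s - h) (A x).
    by rewrite linearB linearZ /= linearB.
  by vring.
rewrite normrN (le_lt_trans (ler_normD _ _))//.
have a1 : `|T (s - h) (h^-1 *: (T h x - x) - A x)| < e / 2.
  rewrite (le_lt_trans (KP _ _ _))//; first by apply/andP; split; lra.
  by rewrite mulrC -ltr_pdivlMr// dP// h0.
have a2 : `|T (s - h) (A x) - T s (A x)| < e / 2 by rewrite dP'// h0.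
lra.
Qed.

Variables (l : R) (L : X -> X).
Hypothesis rL : is_resolvent D A l L.

(** A primitive is e^(l r) T(t - r) (L x): its derivative is e^(l r) T(t - r) applied to l L x - A
    (L x) = x. L stands outside because a state is recognised by its image under the resolvent. *)
Lemma bochner_exp_orbit t a b x : 0 <= a -> a <= b -> b <= t ->
  is_bochner_integral t
    (fun r => if r \in `]a, b]%classic then T (t - r) (expR (l * r) *: x) else 0)
    (L (expR (l * b) *: T (t - b) x - expR (l * a) *: T (t - a) x)).
Proof.
move=> a0 ab bt; have [[lL _] LP _] := rL; have [Dz zE] := LP x.
pose F r := expR (l * r) *: T (t - r) (L x).
have -> : L (expR (l * b) *: T (t - b) x - expR (l * a) *: T (t - a) x) = F b - F a.
  rewrite (linB lL) !(linZ lL) /F.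
  have tb : 0 <= t - b by lra.
  have ta : 0 <= t - a by lra.
  by rewrite !(semigroup_resolvent hT gA _ _ rL).
have [K K0 KP] := semigroup_local_bound hT t.
apply: (@bochner_FTC _ _ t a b (K * (expR (`|l| * t) * `|x|)) _ F) => //.
- apply: (strongly_measurable_orbit hT); apply: strongly_measurable_continuous => s.
  by apply: cvgZr_tmp; exact: continuous_expRM.
- move=> r /andP[r0 rt]; rewrite (le_trans (KP _ _ _))//; first by apply/andP; split; lra.
  rewrite ler_pM2l// normrZ ler_wpM2r// gtr0_norm ?expR_gt0// ler_expR.
  by rewrite (@le_trans _ _ (`|l| * r))// ?ler_wpM2r ?ler_wpM2l// ler_norm.
- move=> s /andP[sa sb]; have ts : 0 < t - s by lra.
  have cE : expR (l * (s + h)) *: T ((t - s) - h) x @[h --> 0^'+] --> expR (l * s) *: T (t - s) x.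
    apply: cvgZ; last exact: semigroup_cvg_left.
    exact: (@cvg_shift_right _ _ _ _ (@continuous_expRM _ l s)).
  apply: (eq_cvg_right0 _ _ cE) => [h h0|]; last by rewrite linearZ.
  by rewrite linearZ /=; congr (_ *: T _ _); ring.
- move=> s /andP[sa sb]; have ts : 0 <= t - s by lra.
  have cE : expR (l * (s - h)) *: T ((t - s) + h) (L x) @[h --> 0^'+] --> F s.
    apply: cvgZ; last exact: semigroup_cvg_right.
    exact: (@cvg_shift_left _ _ _ _ (@continuous_expRM _ l s)).
  apply: (eq_cvg_right0 _ _ cE) => // h h0.
  by rewrite /F; congr (_ *: T _ _); ring.
- move=> s /andP[sa sb]; have ts : 0 < t - s by lra.
  have od : h^-1 *: (T (t - (s + h)) (L x) - T (t - s) (L x)) @[h --> 0^'+] --> - T (t - s) (A (L x)).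
    apply: (eq_cvg_right0 _ _ (orbit_left_deriv ts Dz)) => // h h0.
    by congr (_ *: (T _ _ - _)); ring.
  have := @right_derivZ R X (fun s => expR (l * s)) (fun s => T (t - s) (L x)) _ _ s
    (@right_deriv_expR _ l s) (@cvg_shift_right _ _ _ _ (@continuous_expRM _ l s)) od.
  apply: eq_cvg_right0 => // ; rewrite -[in RHS]zE linearZ linearB linearZ /=.
  by vring.
Qed.

End BackwardOrbit.

(** * Positive reachability *)

Section PositiveControls.
Context {R : realType} {U : banachLatticeType R}.
Local Notation pos := (@positive_cone R U).

Lemma convex_cone_positive : convex_cone pos.
Proof.
split=> [|x y x0 y0|a x]; [exact: vle_refl| |exact: vscale_ge0].
by have := vleD2r x _ _ y0; rewrite add0r [y + x]addrC; exact: vle_trans x0.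
Qed.

Lemma Lp_pos0 p t : (1 <= p)%E -> Lp_pos p t (fun=> 0 : U).
Proof.
move=> hp; split; last by apply: ae_all => r _; exact: vle_refl.
apply: (@bounded_Lp _ _ _ _ 0) => // [|x _]; last by rewrite normr0.
by apply: strongly_measurable_continuous => x; exact: cvg_cst.
Qed.

Lemma Lp_posD p t (u v : R -> U) : (1 <= p)%E -> Lp_pos p t u -> Lp_pos p t v ->
  Lp_pos p t (fun r => u r + v r).
Proof.
move=> hp [Lu pu] [Lv pv]; split; first exact: Lp_add.
have [_ PD _] := convex_cone_positive.
by apply: ae_impl (ae_and pu pv) => r [ur vr] rt; apply: PD; [exact: ur|exact: vr].
Qed.

Lemma Lp_posZ p t a (u : R -> U) : (1 <= p)%E -> 0 <= a -> Lp_pos p t u ->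
  Lp_pos p t (fun r => a *: u r).
Proof.
move=> hp a0 [Lu pu]; split.
  apply: (@le_Lp _ _ _ _ _ `|a| _ u) => // [|x _]; last by rewrite normrZ.
  by apply: strongly_measurableZ; case: Lu.
by apply: ae_impl pu => r ur /ur; exact: vscale_ge0.
Qed.

End PositiveControls.

Section Reachability.
Context {R : realType} {X dX : completeNormedModType R}.
Context {U : banachLatticeType R}.
Variables (S : boundary_control_system X dX U) (p : \bar R).
Hypothesis hp : (1 <= p)%E.
Hypothesis hB : boundary_admissible S p.
Local Notation T := (bcs_T S).
Local Notation A := (bcs_Am S).
Local Notation D := (bcs_dom S).
Local Notation Bl := (bcs_Bl S).
Local Notation Res := (bcs_R S).
Local Notation is_resolvent := (is_resolvent D A).
Local Notation pos := (@positive_cone R U).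

Let hT : C0_semigroup T := bcs_T_semigroup S.
Let gA : is_generator T D A := bcs_generator S.

Section OneResolvent.
Variables (l : R) (L : X -> X).
Hypothesis rL : is_resolvent l L.

(** Under L the states become Bochner integrals, which are linear in the control, and positive
    controls form a cone. *)
Lemma reach_cone t : 0 <= t -> convex_cone (exact_pos_reach S p t).
Proof.
move=> t0; have [[lL _] _ _] := rL.
have [bl _] := bcs_Bl_bounded_linear rL.
have cE u c : Lp_pos p t u -> is_bochner_integral t (input_integrand S l t u) (L c) ->
    exact_pos_reach S p t c.
  by move=> pu fc; exists u => //; apply: (controllability_map_unique hp hB rL t0) fc; case: pu.
have iE u : Lp_pos p t u -> is_bochner_integral t (input_integrand S l t u)
    (L (controllability_map S t u)).
  by move=> [Lu _]; exact: (controllability_mapP hp hB rL t0).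
split.
- apply: (cE _ _ (Lp_pos0 t hp)); rewrite (lin0 lL).
  apply: eq_is_bochner_integral (is_bochner_integral0 t) => r _.
  by rewrite /input_integrand (lin0 bl) linear0.
- move=> _ _ [u pu <-] [v pv <-]; apply: (cE _ _ (Lp_posD hp pu pv)); rewrite (linD lL).
  apply: eq_is_bochner_integral (is_bochner_integralD (iE _ pu) (iE _ pv)) => r _.
  by rewrite /input_integrand (linD bl) linearD.
- move=> a _ a0 [u pu <-]; apply: (cE _ _ (Lp_posZ hp a0 pu)); rewrite (linZ lL).
  apply: eq_is_bochner_integral (is_bochner_integralZ a (iE _ pu)) => r _.
  by rewrite /input_integrand (linZ bl) linearZ.
Qed.

(* The control is e^(l r) v on ]a, b], and 0 elsewhere. *)
Lemma reach_increment t a b v : 0 <= a -> a <= b -> b <= t -> pos v ->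
  exact_pos_reach S p t (expR (l * b) *: T (t - b) (Bl l v)
                         - expR (l * a) *: T (t - a) (Bl l v)).
Proof.
move=> a0 ab bt v0; have [bl _] := bcs_Bl_bounded_linear rL.

pose u r := if r \in `]a, b]%classic then expR (l * r) *: v else 0.
have Lu : Lp p t u.
  apply: (@bounded_Lp _ _ _ _ (expR (`|l| * t) * `|v|)) => //.
    apply: strongly_measurable_restrict => //.
    apply: strongly_measurable_continuous => s.
    by apply: cvgZr_tmp; exact: continuous_expRM.
  move=> r /andP[r0 rt]; rewrite /u; case: ifP => _; last first.
    by rewrite normr0 mulr_ge0// expR_ge0.
  rewrite normrZ ler_wpM2r// gtr0_norm ?expR_gt0// ler_expR.
  by rewrite (@le_trans _ _ (`|l| * r))// ?ler_wpM2r ?ler_wpM2l// ler_norm.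
exists u; first split=> //.
  apply: ae_all => r _; rewrite /u; case: ifP => _; last exact: vle_refl.
  by apply: vscale_ge0 => //; exact: expR_ge0.
apply: (controllability_map_unique hp hB rL _ Lu); first lra.
apply: eq_is_bochner_integral (bochner_exp_orbit hT gA rL (Bl l v) a0 ab bt) => r _.
rewrite /input_integrand /u; case: ifP => _; first by rewrite (linZ bl).
by rewrite (lin0 bl) linear0.
Qed.

End OneResolvent.
End Reachability.

Section Representations.
Context {R : realType} {X dX : completeNormedModType R}.
Context {U : banachLatticeType R}.
Variables (S : boundary_control_system X dX U) (p : \bar R).
Hypothesis hp : (1 <= p)%E.
Hypothesis hB : boundary_admissible S p.
Local Notation T := (bcs_T S).
Local Notation A := (bcs_Am S).
Local Notation D := (bcs_dom S).
Local Notation Bl := (bcs_Bl S).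
Local Notation Res := (bcs_R S).
Local Notation is_resolvent := (is_resolvent D A).
Local Notation pos := (@positive_cone R U).
Local Notation aR := (approx_pos_reach S p).
Local Notation hull := closed_convex_hull.

Let hT : C0_semigroup T := bcs_T_semigroup S.
Let gA : is_generator T D A := bcs_generator S.

Definition increments (l : R) : set X :=
  [set x | exists t a b : R, exists v : U,
    [/\ 0 <= t, 0 <= a, a <= b <= t, pos v &
        x = expR (l * b) *: T (t - b) (Bl l v) - expR (l * a) *: T (t - a) (Bl l v)]].

Definition input_orbits (w : R) : set X :=
  [set x | exists t l : R, exists v : U,
    [/\ 0 <= t, w < l, pos v & x = T t (Bl l v)]].

Definition resolvent_orbits (w : R) : set X :=
  [set x | exists (n : nat) (l : R), exists v : U,
    [/\ w < l, pos v & x = iter n (Res l) (Bl l v)]].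

Variables (M w : R).
Hypothesis M0 : 0 < M.
Hypothesis wP : forall t x, 0 <= t -> `|T t x| <= M * expR (w * t) * `|x|.

Lemma bcs_R_resolvent l : w < l -> is_resolvent l (Res l).
Proof. exact: (resolvent_growth hT gA (resolvent_setP gA (bcs_rho_xget hB)) M0 wP). Qed.

Let Bl_linear l : w < l -> linear (Bl l).
Proof. by move=> wl; case: (bcs_Bl_bounded_linear (bcs_R_resolvent wl)). Qed.

Let R_linear l : w < l -> linear (Res l).
Proof. by move=> wl; case: (bcs_R_resolvent wl) => -[]. Qed.

Let TD s t x : 0 <= s -> 0 <= t -> T (s + t) x = T s (T t x).
Proof. by case: hT => _ _ + _; apply. Qed.

Let T0 x : T 0 x = x. Proof. by case: hT. Qed.

(** The case l = w is allowed since only parameters above l occur; it is the one needed for the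
    representation by orbits. *)
Lemma cone_input_orbits l : w <= l -> convex_cone (hull (input_orbits l)).
Proof.
move=> wl; have ww : w < l + 1 by lra.
apply: hull_cone => [|a _ a0 [t [m [v [t0 lm v0 ->]]]]].
  exists 0, (l + 1), 0; split=> //; [lra|exact: vle_refl|].
  by rewrite (lin0 (Bl_linear ww)) linear0.
exists t, m, (a *: v); split=> //; first exact: vscale_ge0.
by rewrite (linZ (Bl_linear (le_lt_trans wl lm))) linearZ.
Qed.

Lemma cone_increments l : w < l -> convex_cone (hull (increments l)).
Proof.
move=> wl; have lB := Bl_linear wl; apply: hull_cone.
  exists 0, 0, 0, 0; split=> //; [by rewrite lexx|exact: vle_refl|].
  by rewrite (lin0 lB) subrr.
move=> a _ a0 [t [b [c [v [t0 b0 bct v0 ->]]]]].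
exists t, b, c, (a *: v); split=> //; first exact: vscale_ge0.
by rewrite (linZ lB) !linearZ /=; vring.
Qed.

(* By admissibility, R(m) of a reachable state is the integral of elements of
   the cone, and m R(m) tends to the identity. *)
Lemma reach_sub_input_orbits l : w <= l -> aR `<=` hull (input_orbits l).
Proof.
move=> wl; have clH := @hull_closed _ _ (input_orbits l); have cH := cone_input_orbits wl.
have [_ _ HZ] := cH.
suff H t : 0 <= t -> exact_pos_reach S p t `<=` hull (input_orbits l).
  apply: subset_trans (clH); apply: closureS => x [t t0 xt].
  by apply: (clH); apply: closureS xt; exact: H.
move=> t0 _ [u [Lu pu] <-]; set c := controllability_map S t u.
apply: closedP => // e e0.
have [m0 wm0 mP] := yosida_cvg hT gA (resolvent_setP gA (bcs_rho_xget hB)) M0 wP c e0.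
pose m := `|m0| + `|l| + 1; have := ler_norm m0; have := ler_norm l.
have := normr_ge0 m0; have := normr_ge0 l => nl nm0 ll mm0.
have mm : m0 < m by rewrite /m; lra.
have lm : l < m by rewrite /m; lra.
have m_ge0 : 0 <= m by rewrite /m; lra.
have wm : w < m by lra.
have rm := bcs_R_resolvent wm.
exists (m *: Res m c); last by rewrite distrC; exact: mP.
apply: HZ => //; apply: (is_bochner_integral_cone clH cH (controllability_mapP hp hB rm t0 Lu)).
apply: ae_impl pu => r ur /[dup] /ur vr /andP[r0 rt].
by apply: sub_hull; exists (t - r), m, (u r); split=> //; lra.
Qed.

Lemma increment_in_hull l s t v : w < l -> 0 <= s -> 0 <= t -> pos v ->
  hull (increments l) (T t (Bl l v) - expR (- l * s) *: T s (T t (Bl l v))).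
Proof.
move=> wl s0 t0 v0; have [_ _ HZ] := cone_increments wl.
(* The increment at time t + s with alpha = 0 and beta = s, normalised by e^(-l s). *)
have -> : T t (Bl l v) - expR (- l * s) *: T s (T t (Bl l v)) = expR (- l * s) *:
    (expR (l * s) *: T (t + s - s) (Bl l v) - expR (l * 0) *: T (t + s - 0) (Bl l v)).
  rewrite addrK subr0 mulr0 expR0 scale1r [t + s]addrC TD// scalerBr scalerA -expRD.
  by rewrite mulNr addNr expR0 scale1r.
apply: HZ; first exact: expR_ge0.
apply: sub_hull; exists (t + s), 0, s, v; split=> //; first by rewrite addr_ge0.
by rewrite s0 /=; lra.
Qed.

Lemma input_orbits_sub_increments l : w < l ->
  hull (input_orbits l) `<=` hull (increments l).
Proof.
move=> wl; have cH := cone_increments wl.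
have clH := @hull_closed _ _ (increments l).
apply: hull_min => //; first exact: convex_cone_convex.
move=> _ [t [m [v [t0 lm v0 ->]]]]; have rm := bcs_R_resolvent (lt_trans wl lm).
rewrite (bcs_BlE _ (bcs_R_resolvent wl) rm) linearD linearZ /=.
rewrite (semigroup_resolvent hT gA _ t0 rm) -opprB scaleNr.
apply: (laplace_cone hT gA M0 wP clH cH wl lm rm) => s s0.
exact: increment_in_hull.
Qed.

(* An increment reachable in time t is reachable in any time t' >= t, after
   translating the time interval by t' - t and rescaling the control. *)
Lemma increments_sub_reach l : w < l -> hull (increments l) `<=` aR.
Proof.
move=> wl; have rl := bcs_R_resolvent wl; have lB := Bl_linear wl.
(* States reachable in all large times form a cone: two of them are reachable in a common time,
   where they can be added. *)
pose K := [set x | exists2 t0 : R, 0 <= t0 & forall t, t0 <= t -> exact_pos_reach S p t x].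
have cK : convex_cone K.
  split.
  - by exists 0 => // t t0; case: (reach_cone hp hB rl t0).
  - move=> x y [t1 t10 xP] [t2 t20 yP]; exists (t1 + t2) => [|t tt]; first lra.
    have t0 : 0 <= t by lra.
    by have [_ RD _] := reach_cone hp hB rl t0; apply: RD; [apply: xP|apply: yP]; lra.
  - move=> a x a0 [t1 t10 xP]; exists t1 => // t tt; have t0 : 0 <= t by lra.
    by have [_ _ RZ] := reach_cone hp hB rl t0; apply: RZ => //; exact: xP.
have KR : K `<=` \bigcup_(t in [set t : R | 0 <= t]) approx_pos_reach_at S p t.
  by move=> x [t t0 xP]; exists t => //; apply: subset_closure; exact: xP.
apply: subset_trans (closureS KR).
apply: hull_min; [exact: closed_closure|exact/convex_cone_convex/convex_cone_closure|].
move=> _ [t [a [b [v [t0 a0 /andP[ab bt] v0 ->]]]]]; apply: subset_closure.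
exists t => // t' tt; pose d := t' - t.
have d0 : 0 <= d by rewrite subr_ge0.
have E q : expR (l * (q + d)) *: T (t' - (q + d)) (Bl l (expR (- l * d) *: v)) =
    expR (l * q) *: T (t - q) (Bl l v).
  rewrite (linZ lB) linearZ /= scalerA -expRD.
  by congr (expR _ *: T _ _); rewrite /d; ring.
rewrite -!E; apply: (reach_increment hp hB rl); rewrite ?/d; [lra|lra|lra|].
by apply: vscale_ge0 => //; exact: expR_ge0.
Qed.

Lemma reachE_increments l : w < l -> aR = hull (increments l).
Proof.
move=> wl; apply/seteqP; split; last exact: increments_sub_reach.
apply: subset_trans (input_orbits_sub_increments wl).
exact: reach_sub_input_orbits (ltW wl).
Qed.

Lemma closed_convex_cone_reach : closed_convex_cone aR.
Proof.
have wl : w < w + 1 by lra.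
apply/closed_convex_coneP; rewrite (reachE_increments wl).
by split; [exact: hull_closed|exact: cone_increments].
Qed.

(** The orbit value y is the limit of y - e^(-l s) T(s) y as s grows, because l exceeds the growth
    exponent. *)
Lemma input_orbit_reach l t v : w < l -> 0 <= t -> pos v -> aR (T t (Bl l v)).
Proof.
move=> wl t0 v0; rewrite (reachE_increments wl); apply: closedP; first exact: hull_closed.
move=> e e0; have [s s0 se] := rescaled_orbit_small M0 wP (T t (Bl l v)) wl e0.
exists (T t (Bl l v) - expR (- l * s) *: T s (T t (Bl l v))); last by rewrite subKr.
exact: increment_in_hull.
Qed.

Lemma reachE_input_orbits : aR = hull (input_orbits w).
Proof.
apply/seteqP; split; first exact: reach_sub_input_orbits.
have [clR cR _ _] := closed_convex_cone_reach.
by apply: hull_min => // _ [t [l [v [t0 wl v0 ->]]]]; exact: input_orbit_reach.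
Qed.

(** T(r) carries an increment at time t to the one at time r + t with the same alpha, beta and v. *)
Lemma reach_semigroup r x : 0 <= r -> aR x -> aR (T r x).
Proof.
move=> r0; have wl : w < w + 1 by lra.
rewrite (reachE_increments wl); apply: (hull_map (semigroup_bounded_linear hT r0)).
move=> _ [t [a [b [v [t0 a0 /andP[ab bt] v0 ->]]]]]; apply: sub_hull.
exists (r + t), a, b, v; split=> //; first lra.
  by rewrite ab /=; lra.
have E q : q <= t -> T r (expR ((w + 1) * q) *: T (t - q) (Bl (w + 1) v)) =
    expR ((w + 1) * q) *: T (r + t - q) (Bl (w + 1) v).
  by move=> qt; rewrite linearZ /= -TD ?subr_ge0// addrA.
by rewrite linearB /= !E//; lra.
Qed.

Lemma reach_resolvent l x : w < l -> aR x -> aR (Res l x).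
Proof.
move=> wl Rx; have [clR cR] := (closed_convex_coneP _).1 closed_convex_cone_reach.
apply: (resolvent_cone hT gA M0 wP wl clR cR (bcs_R_resolvent wl)) => s s0.
exact: reach_semigroup.
Qed.

Lemma iter_resolvent_reach n l v : w < l -> pos v -> aR (iter n (Res l) (Bl l v)).
Proof.
move=> wl v0; elim: n => [|n IH]; last exact: reach_resolvent.
by rewrite -[iter 0 _ _]T0; exact: input_orbit_reach.
Qed.

Definition resolvent_orbits_at (l : R) : set X :=
  [set x | exists (n : nat) (v : U), pos v /\ x = iter n (Res l) (Bl l v)].

Lemma iter_linear n l : w < l -> linear (fun v => iter n (Res l) (Bl l v)).
Proof.
move=> wl; elim: n => [|n IH] a x y /=; first exact: Bl_linear.
by rewrite IH (R_linear wl).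
Qed.

Lemma cone_resolvent_orbits_at l : w < l -> convex_cone (hull (resolvent_orbits_at l)).
Proof.
move=> wl; apply: hull_cone => [|a _ a0 [n [v [v0 ->]]]].
  exists 0%N, 0; split; first exact: vle_refl.
  by rewrite /= (lin0 (Bl_linear wl)).
exists n, (a *: v); split; first exact: vscale_ge0.
by rewrite (linZ (iter_linear n wl)).
Qed.

Lemma resolvent_orbits_at_resolvent l x : w < l -> hull (resolvent_orbits_at l) x ->
  hull (resolvent_orbits_at l) (Res l x).
Proof.
move=> wl; have [bR _ _] := bcs_R_resolvent wl; apply: (hull_map bR).
by move=> _ [n [v [v0 ->]]]; apply: sub_hull; exists n.+1, v.
Qed.

Lemma resolvent_orbits_at_lower l m x : w < m -> m <= l ->
  hull (resolvent_orbits_at l) x -> hull (resolvent_orbits_at l) (Res m x).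
Proof.
move=> wm ml; have wl := lt_le_trans wm ml.
have := neumann_cone hT gA M0 wP
  (@hull_closed _ _ _) (cone_resolvent_orbits_at wl) wm ml
  (bcs_R_resolvent wl) (bcs_R_resolvent wm).
apply=> y; exact: resolvent_orbits_at_resolvent.
Qed.

Lemma resolvent_orbits_at_sub l : w < l ->
  hull (resolvent_orbits_at l) `<=` hull (resolvent_orbits w).
Proof.
move=> wl; apply: hull_min; [exact: hull_closed|exact: hull_convex|].
by move=> _ [n [v [v0 ->]]]; apply: sub_hull; exists n, l, v.
Qed.

(* By the Neumann series, the cone of the vectors R(l)^n B_l v, for a single l,
   is R(m)-invariant for m <= l. For l < m the cone of m is used instead: it
   contains the range of B_l = B_m + (m - l) R(l) B_m. *)
Lemma resolvent_orbits_resolvent m x : w < m -> hull (resolvent_orbits w) x ->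
  hull (resolvent_orbits w) (Res m x).
Proof.
move=> wm; have [bR _ _] := bcs_R_resolvent wm; apply: (hull_map bR).
move=> _ [n [l [v [wl v0 ->]]]]; have [ml|lm] := leP m l.
  apply: (resolvent_orbits_at_sub wl); apply: resolvent_orbits_at_lower => //.
  by apply: sub_hull; exists n, v.
apply: (resolvent_orbits_at_sub wm); apply: resolvent_orbits_at_resolvent => //.
elim: n => [|n IH]; last by apply: resolvent_orbits_at_lower => //; exact: ltW.
have [_ CD CZ] := cone_resolvent_orbits_at wm.
have Cv : hull (resolvent_orbits_at m) (Bl m v) by apply: sub_hull; exists 0%N, v.
rewrite /= (bcs_BlE _ (bcs_R_resolvent wm) (bcs_R_resolvent wl)); apply: CD => //.
by apply: CZ; [rewrite subr_ge0 ltW|apply: resolvent_orbits_at_lower => //; exact: ltW].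
Qed.

Lemma cone_resolvent_orbits : convex_cone (hull (resolvent_orbits w)).
Proof.
have ww : w < w + 1 by lra.
apply: hull_cone => [|a _ a0 [n [l [v [wl v0 ->]]]]].
  exists 0%N, (w + 1), 0; split=> //; first exact: vle_refl.
  by rewrite /= (lin0 (Bl_linear ww)).
exists n, l, (a *: v); split=> //; first exact: vscale_ge0.
by rewrite (linZ (iter_linear n wl)).
Qed.

Lemma reachE_resolvent_orbits : aR = hull (resolvent_orbits w).
Proof.
apply/seteqP; split.
  rewrite reachE_input_orbits; apply: hull_min; [exact: hull_closed|exact: hull_convex|].
  move=> _ [t [l [v [t0 wl v0 ->]]]].
  apply: (cone_semigroup_invariant hT gA (resolvent_setP gA (bcs_rho_xget hB)) M0 wP
    (@hull_closed _ _ _) cone_resolvent_orbits) => // [m wm x|].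
    exact: resolvent_orbits_resolvent.
  by apply: sub_hull; exists 0%N, l, v.
have [clR cR _ _] := closed_convex_cone_reach.
by apply: hull_min => // _ [n [l [v [wl v0 ->]]]]; exact: iter_resolvent_reach.
Qed.

End Representations.

Theorem proposition4p4 (R : realType) (X U : banachLatticeType R)
    (dX : completeNormedModType R) (S : boundary_control_system X dX U)
    (p : \bar R) (hp : (1 <= p)%E) (hB : boundary_admissible S p)
    (hpos : forall t : R, 0 < t -> exact_pos_reach S p t `<=` @positive_cone R X) :
  let T := bcs_T S in
  let Bl := bcs_Bl S in
  let Res := bcs_R S in
  let aR := approx_pos_reach S p in
  let above (w : R) := (growth_bound T < w%:E)%E in
  [/\ (* (i) *)
      [/\ closed_convex_cone aR,
          forall t : R, 0 <= t -> T t @` aR `<=` aR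
        & forall lambda : R, above lambda -> Res lambda @` aR `<=` aR],
      (* (ii) *)
      forall lambda : R, above lambda ->
        aR = closed_convex_hull [set x | exists t alpha beta : R, exists v : U,
          [/\ 0 <= t, 0 <= alpha, alpha <= beta <= t, positive_cone v &
              x = expR (lambda * beta) *: T (t - beta) (Bl lambda v)
                - expR (lambda * alpha) *: T (t - alpha) (Bl lambda v)]],
      (* (iii) *)
      forall w : R, above w ->
        aR = closed_convex_hull [set x | exists t lambda : R, exists v : U,
          [/\ 0 <= t, w < lambda, positive_cone v & x = T t (Bl lambda v)]]
    & (* (iv) *)
      let eq_iv (w : R) :=
        aR = closed_convex_hull
          [set x | exists (n : nat) (lambda : R), exists v : U,
            [/\ w < lambda, positive_cone v &
                x = iter n (Res lambda) (Bl lambda v)]] in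
      (exists w : R, above w /\ eq_iv w) /\
      (forall w : R, above w -> eq_iv w)].
Proof.
have hT := bcs_T_semigroup S.
(* An exponent below w is weakened to w itself: the representations by orbits and by resolvents
   involve all lambda > w, whereas a fixed lambda needs an exponent strictly below it. *)
have bound w : (growth_bound (bcs_T S) < w%:E)%E -> exists2 M, 0 < M &
    forall t x, 0 <= t -> `|bcs_T S t x| <= M * expR (w * t) * `|x|.
  move=> /growth_boundP[w0 [w0w [M M0 MP]]]; exists M => // t x t0.
  rewrite (le_trans (MP _ _ t0))// ler_wpM2r// ler_pM2l// ler_expR.
  by rewrite ler_wpM2r// ltW.
have [w1 w1P] := growth_bound_lty hT; have [M1 M10 M1P] := bound _ w1P.
split.
- split; first exact: (closed_convex_cone_reach hp hB M10 M1P).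
  + by move=> t t0 _ [x Rx <-]; exact: (reach_semigroup hp hB M10 M1P).
  + move=> l /growth_boundP[w [wl [M M0 MP]]] _ [x Rx <-].
    exact: (reach_resolvent hp hB M0 MP).
- move=> l /growth_boundP[w [wl [M M0 MP]]].
  exact: (reachE_increments hp hB M0 MP wl).
- by move=> w /bound[M M0 MP]; exact: (reachE_input_orbits hp hB M0 MP).
- split; last by move=> w /bound[M M0 MP]; exact: (reachE_resolvent_orbits hp hB M0 MP).
  by exists w1; split=> //; exact: (reachE_resolvent_orbits hp hB M10 M1P).
Qed.
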